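(* Let $\mathcal{A}\in\mathbb{Z}_{\geq 0}^{(n+1)\times N}$ be as in the context, let $z\in\mathbb{C}^N$ with $\operatorname{Re} z_j>0$ for all $j$, and set $r:=N-n-1$. Let $\sigma\subset\{1,\ldots,N\}$ be an index set with $|\sigma|=n+1$ such that $\det\mathcal{A}_\sigma\neq 0$, and let $\bar\sigma=\{1,\ldots,N\}\setminus\sigma$. Let ${\underline{\nu}}=(\nu_0,\nu)\in\mathbb{C}^{n+1}$ with $\operatorname{Re}\nu_0>0$ and suppose there is $c\in\mathbb{R}^r_{>0}$ such that every component of $\mathcal{A}_\sigma^{-1}\operatorname{Re}{\underline{\nu}}-\mathcal{A}_\sigma^{-1}\mathcal{A}_{\bar\sigma}c$ is strictly positive, and that the integral below converges absolutely along $\gamma=c+i\mathbb{R}^r$. Then $$J_\mathcal{A}({\underline{\nu}},z)=\frac{z_\sigma^{-\mathcal{A}_\sigma^{-1}{\underline{\nu}}}}{|\det\mathcal{A}_\sigma|}\int_\gamma\frac{dt}{(2\pi i)^r}\,\Gamma(t)\,\Gamma\!\left(\mathcal{A}_\sigma^{-1}{\underline{\nu}}-\mathcal{A}_\sigma^{-1}\mathcal{A}_{\bar\sigma}t\right)\,z_{\bar\sigma}^{-t}\,z_\sigma^{\mathcal{A}_\sigma^{-1}\mathcal{A}_{\bar\sigma}t}.$$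
   Context: Fix integers $n\ge1$, $N\ge n+1$ and pairwise distinct column vectors $\mathrm{a}_1,\ldots,\mathrm{a}_N\in\mathbb{Z}_{\geq0}^n$; write $\mathcal{A}\in\mathbb{Z}_{\ge0}^{(n+1)\times N}$ for the matrix whose $j$-th column is $(1,\mathrm{a}_j)$ (first row all ones). For $z\in\mathbb{C}^N$ put $G_z(x)=\sum_{j=1}^N z_j x^{\mathrm{a}_j}$, $x\in\mathbb{R}^n_{>0}$. The generalized Feynman integral is (the meromorphic continuation in ${\underline{\nu}}=(\nu_0,\nu)\in\mathbb{C}\times\mathbb{C}^n$ of) $J_\mathcal{A}({\underline{\nu}},z)=\Gamma(\nu_0)\int_{\mathbb{R}^n_{>0}}x^{\nu-1}G_z(x)^{-\nu_0}\,dx$. Multi-index notation: $x^{\nu-1}=\prod_i x_i^{\nu_i-1}$, $\Gamma(v)=\prod_i\Gamma(v_i)$, $w^{u}=\prod_i w_i^{u_i}$ (principal branches), $dt=dt_1\cdots dt_r$. For an index set $\sigma$, $\mathcal{A}_\sigma$ is the submatrix of columns indexed by $\sigma$, $z_\sigma=(z_i)_{i\in\sigma}$, and similarly for $\bar\sigma$. *)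

(* Defs.v *)
From HB Require Import structures.
From mathcomp Require Import all_boot all_order all_algebra.
From mathcomp Require Import complex.
From mathcomp Require Import all_classical all_reals all_analysis.

Set Implicit Arguments.
Unset Strict Implicit.
Unset Printing Implicit Defensive.

Import Order.TTheory GRing.Theory Num.Theory.
Local Open Scope ring_scope.
Local Open Scope classical_set_scope.
Local Open Scope complex_scope.

Section FeynmanDefs.
Variable R : realType.
Local Notation C := R[i].
Local Notation Re := (@complex.Re R).
Local Notation Im := (@complex.Im R).

Definition cabs (z : C) : R := Num.sqrt (Re z ^+ 2 + Im z ^+ 2).

Definition cexp (z : C) : C :=
  Complex (expR (Re z) * cos (Im z)) (expR (Re z) * sin (Im z)).

(* principal argument, with values in (-pi, pi] *)
Definition carg (z : C) : R :=
  if 0 < Re z then atan (Im z / Re z)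
  else if Re z < 0 then
    (if 0 <= Im z then atan (Im z / Re z) + pi else atan (Im z / Re z) - pi)
  else (if 0 < Im z then pi / 2 else if Im z < 0 then - (pi / 2) else 0).

Definition clog (z : C) : C := Complex (ln (cabs z)) (carg z).

(* principal power  z^w = exp (w log z)  (convention 0^w = 0, never used) *)
Definition cpow (z w : C) : C := if z == 0 then 0 else cexp (w * clog z).

Definition Cint (D : set R) (f : R -> C) : C :=
  Complex (Rintegral (@lebesgue_measure R) D (fun x => Re (f x)))
          (Rintegral (@lebesgue_measure R) D (fun x => Im (f x))).

Definition upd {I : eqType} (x : I -> R) (i : I) (u : R) : I -> R :=
  fun j => if j == i then u else x j.

Fixpoint iterCint {I : eqType} (s : seq I) (D : set R)
    (f : (I -> R) -> C) (x : I -> R) : C :=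
  match s with
  | [::] => f x
  | i :: s' => Cint D (fun u => iterCint s' D f (upd x i u))
  end.

(* iterated (Tonelli) integral of |f| over the coordinates in s;
   by Tonelli this is the integral of |f| on D^s for measurable f. *)
Fixpoint iterAbsInt {I : eqType} (s : seq I) (D : set R)
    (f : (I -> R) -> C) (x : I -> R) : \bar R :=
  match s with
  | [::] => ((cabs (f x))%:E)
  | i :: s' => (\int[@lebesgue_measure R]_(u in D)
                   iterAbsInt s' D f (upd x i u))%E
  end.

(* Euler Gamma function, by its integral, valid for Re s > 0
   (the only arguments at which it is used below). *)
Definition cGamma (s : C) : C :=
  Cint `]0, +oo[ (fun x => cpow (x%:C) (s - 1) * cexp (- (x%:C))).

Variables (n N : nat) (a : 'I_N -> 'I_n -> nat).

Definition Acol (j : 'I_N) (i : 'I_n.+1) : nat :=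
  if unlift ord0 i is Some i' then a j i' else 1%N.

Definition Gz (z : 'I_N -> C) (x : 'I_n -> R) : C :=
  \sum_(j < N) z j * (\prod_(i < n) x i ^+ a j i)%:C.

Definition JA (nu0 : C) (nu : 'I_n -> C) (z : 'I_N -> C) : C :=
  cGamma nu0 *
  iterCint (enum 'I_n) `]0, +oo[
    (fun x => (\prod_(i < n) cpow ((x i)%:C) (nu i - 1)) * cpow (Gz z x) (- nu0))
    (fun _ => 0).

Definition nub (nu0 : C) (nu : 'I_n -> C) (i : 'I_n.+1) : C :=
  if unlift ord0 i is Some i' then nu i' else nu0.

Variable sigma : {set 'I_N}.

Definition sig_el (k : 'I_n.+1) : option 'I_N := onth (enum sigma) k.

Definition Asig : 'M[R]_n.+1 :=
  \matrix_(i, k) (if sig_el k is Some j then (Acol j i)%:R else 0).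

Definition Asiginv : 'M[R]_n.+1 := invmx Asig.

Definition zsig (z : 'I_N -> C) (k : 'I_n.+1) : C :=
  if sig_el k is Some j then z j else 0.

(* A_{bar sigma} t, for t indexed by bar sigma (values off bar sigma unused) *)
Definition Asigbar_t (t : 'I_N -> C) (i : 'I_n.+1) : C :=
  \sum_(j in ~: sigma) ((Acol j i)%:R)%:C * t j.

Definition mxCv (M : 'M[R]_n.+1) (v : 'I_n.+1 -> C) (k : 'I_n.+1) : C :=
  \sum_i (M k i)%:C * v i.

Definition Asigbar_c (c : 'I_N -> R) (i : 'I_n.+1) : R :=
  \sum_(j in ~: sigma) (Acol j i)%:R * c j.
Definition mxRv (M : 'M[R]_n.+1) (v : 'I_n.+1 -> R) (k : 'I_n.+1) : R :=
  \sum_i M k i * v i.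

Definition MBintegrand (nu0 : C) (nu : 'I_n -> C) (z : 'I_N -> C)
    (t : 'I_N -> C) : C :=
  (\prod_(j in ~: sigma) cGamma (t j)) *
  (\prod_k cGamma (mxCv Asiginv (nub nu0 nu) k - mxCv Asiginv (Asigbar_t t) k)) *
  (\prod_(j in ~: sigma) cpow (z j) (- t j)) *
  (\prod_k cpow (zsig z k) (mxCv Asiginv (Asigbar_t t) k)).

Definition rr : nat := #|~: sigma|.

Definition on_gamma (c s : 'I_N -> R) : 'I_N -> C :=
  fun j => Complex (c j) (s j).

(* contour integral over gamma = c + i R^r :  dt = i^r ds *)
Definition gamma_int (c : 'I_N -> R) (g : ('I_N -> C) -> C) : C :=
  (Complex 0 1) ^+ rr * iterCint (enum (~: sigma)) setT (fun s => g (on_gamma c s)) (fun _ => 0).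

Definition gamma_abs_conv (c : 'I_N -> R) (g : ('I_N -> C) -> C) : Prop :=
  (iterAbsInt (enum (~: sigma)) setT (fun s => g (on_gamma c s)) (fun _ => 0%R)
     < +oo)%E.

End FeynmanDefs.

(* Main.v *)
Require Import Defs.
From HB Require Import structures.
From mathcomp Require Import all_boot all_order all_algebra.
From mathcomp Require Import fingroup perm complex.
From mathcomp Require Import all_classical all_reals all_analysis.
From mathcomp Require Import measurable_realfun.
From mathcomp Require Import ring lra.
Import Order.TTheory GRing.Theory Num.Theory.
Import numFieldNormedType.Exports.
Import HBNNSimple.

Set Implicit Arguments.
Unset Strict Implicit.
Unset Printing Implicit Defensive.

Local Open Scope ring_scope.
Local Open Scope classical_set_scope.

(** Writing [x_i = e^(w_i)] and [Gamma(nu0) G^(-nu0) = \int e^(nu0 u_0 - G e^(u_0)) du_0], the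
    Feynman integral becomes the integral over [u] in [R^(n+1)] of
      [exp (<nu, u> - \sum_j z_j exp ((A^T u)_j))],
    and the substitution [v = A_sigma^T u] turns the terms with [j] in [sigma] into [z_j e^(v_j)].
    For each [j] outside [sigma], the factor [exp (- z_j e^y)] is replaced by its Mellin-Barnes
    integral [(2 pi)^-1 \int Gamma(c_j + i s) (z_j e^y)^(- c_j - i s) ds].  The integrand so obtained
    decays exponentially in all variables: [|Gamma(c + i s) z^(- c - i s)|] does because
    [|arg z| < pi / 2] and the integral defining Gamma can be rotated to a ray of angle arbitrarily
    close to [pi / 2].  Hence the [v]-integrals may be done first; they factor into Gamma integrals.
    The one-dimensional Mellin-Barnes formula is Fourier inversion at a point, obtained by
    inserting a Gaussian and letting it tend to [1]. *)

(** * Affine and exponential substitutions *)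

Section ChangeOfVariables.
Variable R : realType.
Notation mu := (@lebesgue_measure R).

(** All integrals are iterated one-dimensional Lebesgue integrals, so every interchange needs a
    condition that survives integrating out a coordinate. The condition is a bound
    [C * expR (- (d * S))], with [S] the sum of the absolute values of the listed coordinates,
    uniform in the others: it gives Fubini for two neighbouring variables and passes to inner
    integrals. In several variables it is checked only once, on the joint integrand in [v] and [s]:
    there the coefficient of [v_k] has a positive real part independent of [s], so the modulus is a
    product of one-variable functions. Decay in [v] alone, hence in [u], is inherited, although the
    linear exponents that remain there may have negative real part. Contour arguments become real
    calculus: in the coordinate [v = ln x] the derivative in the angle is, by Cauchy-Riemann, [i]
    times a derivative in [v], which integrates to zero by translation invariance. Real and
    imaginary parts are treated together through a phase [k], equal to [0] for the former and
    [- (pi / 2)] for the latter. *)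

Lemma measurable_affine (l c : R) : measurable_fun setT (fun u : R => l * u + c).
Proof. by apply: measurable_funD => //; apply: measurable_funM. Qed.

Definition pushmeasure (f : measurableTypeR R -> measurableTypeR R) (mf : measurable_fun setT f) :
  {measure set (measurableTypeR R) -> \bar R} :=
  measure_function_pushforward__canonical__measure_function_Measure mu mf.

(** Both sides are measures in [X], so uniqueness of Lebesgue measure reduces the claim to intervals
    []a, b]]. For negative [l] the preimage is closed on the left and open on the right, with the
    same length. *)
Lemma lebesgue_affine (l c : R) (X : set R) : l != 0 -> measurable X ->
  mu X = (`|l|%:E * mu ((fun u => (l * u + c)%R) @^-1` X))%E.
Proof.
move=> l0 mX.
have [l1 l2] : 0 < `|l| /\ `|l| != 0 by rewrite normr_gt0 normr_eq0.
pose f : measurableTypeR R -> measurableTypeR R := fun u => l * u + c.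
have mf : measurable_fun setT f by exact: measurable_affine.
pose m : {measure set (measurableTypeR R) -> \bar R} :=
  mscale (NngNum (ltW l1)) (pushmeasure mf).
have -> : (`|l|%:E * mu (f @^-1` X))%E = m X by [].
apply: (lebesgue_measure_unique (mu := m)) => // Y [[a b]] _ <-.
rewrite -[m _]/(`|l|%:E * mu (f @^-1` `]a, b]))%E.
have [lp|ln] := ltP 0 l.
- have -> : f @^-1` `]a, b] = `](a - c) / l, (b - c) / l]%classic.
    apply/seteqP; split => u; rewrite /f /= !in_itv /= => /andP[h1 h2]; apply/andP; split.
    - by rewrite ltr_pdivrMr// ltrBlDr mulrC.
    - by rewrite ler_pdivlMr// lerBrDr mulrC.
    - by move: h1; rewrite ltr_pdivrMr// ltrBlDr mulrC.
    - by move: h2; rewrite ler_pdivlMr// lerBrDr mulrC.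
  rewrite !lebesgue_measure_itv /= !lte_fin ltr_pM2r ?invr_gt0// ltrD2r.
  case: ifP => [_|_]; last by rewrite mule0.
  rewrite -!EFinB -EFinM gtr0_norm//; congr EFin.
  by field.
- have {}ln : l < 0 by rewrite lt_neqAle l0.
  have -> : f @^-1` `]a, b] = `[(b - c) / l, (a - c) / l[%classic.
    apply/seteqP; split => u; rewrite /f /= !in_itv /= => /andP[h1 h2]; apply/andP; split.
    - by rewrite ler_ndivrMr// lerBrDr mulrC.
    - by rewrite ltr_ndivlMr// ltrBlDr mulrC.
    - by move: h2; rewrite ltr_ndivlMr// ltrBlDr mulrC.
    - by move: h1; rewrite ler_ndivrMr// lerBrDr mulrC.
  rewrite !lebesgue_measure_itv /= !lte_fin ltr_nM2r ?invr_lt0// ltrD2r.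
  case: ifP => [_|_]; last by rewrite mule0.
  rewrite -!EFinB -EFinM ltr0_norm//; congr EFin.
  by field.
Qed.

Lemma ge0_integral_affine (l c : R) (f : R -> \bar R) : l != 0 ->
  measurable_fun setT f -> (forall x, 0 <= f x)%E ->
  (\int[mu]_u f (l * u + c)%R = `|l|^-1%:E * \int[mu]_x f x)%E.
Proof.
move=> l0 mf f0.
have [l1 l2] : 0 < `|l| /\ `|l| != 0 by rewrite normr_gt0 normr_eq0.
pose g : measurableTypeR R -> measurableTypeR R := fun u => l * u + c.
have mg : measurable_fun setT g by exact: measurable_affine.
have := @ge0_integral_pushforward _ _ _ _ _ g mg (mu : {measure set _ -> \bar R}) setT f measurableT mf (fun y _ => f0 y).
rewrite preimage_setT => /esym.
rewrite {1}/comp {1}/g => ->.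
pose m : {measure set (measurableTypeR R) -> \bar R} := pushmeasure mg.
rewrite -[LHS]/(\int[m]_y f y)%E.
rewrite (_ : \int[mu]_x f x = `|l|%:E * \int[m]_x f x)%E.
  by rewrite muleA -EFinM mulVf// mul1e.
rewrite -(@ge0_integral_mscale _ _ _ m setT measurableT (NngNum (ltW l1)) f mf (fun x _ => f0 x)).
apply: eq_measure_integral => //= A mA _.
by rewrite (@lebesgue_affine l c).
Qed.

(** A positive finite factor preserves infinities, so distributivity also covers the difference of
    two equal infinities. *)
Lemma pmuleBr (k : R) (x y : \bar R) : 0 < k ->
  (k%:E * (x - y) = k%:E * x - k%:E * y)%E.
Proof.
move=> k0; have k0' : (0 < k%:E)%E by rewrite lte_fin.
case: x y => [x| |] [y| |];
  by rewrite -?EFinB -?EFinM -?EFinB ?mulrBr//= ?(gt0_muley k0', gt0_muleNy k0').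
Qed.

Lemma fine_pmul (k : R) (x : \bar R) : 0 < k -> fine (k%:E * x)%E = k * fine x.
Proof.
move=> k0; case: x => [x| |] //=.
- by rewrite gt0_muley ?lte_fin//= mulr0.
- by rewrite gt0_muleNy ?lte_fin//= mulr0.
Qed.

(** Positive and negative parts are transformed separately, and [pmuleBr] and [fine_pmul] recombine
    them even when they are infinite. Measurability then suffices when the substitution is made
    inside an iterated integral. *)
Lemma Rintegral_affine (l c : R) (f : R -> R) : l != 0 ->
  measurable_fun setT f ->
  Rintegral mu setT (fun u => f (l * u + c)) = `|l|^-1 * Rintegral mu setT f.
Proof.
move=> l0 mf; rewrite /Rintegral integralE [in RHS]integralE.
have k0 : 0 < `|l|^-1 by rewrite invr_gt0 normr_gt0.
have mf' : measurable_fun setT (EFin \o f) by apply/measurable_EFinP.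
have h1 := @ge0_integral_affine l c (EFin \o f)^\+%E l0 (measurable_funepos mf') (@funepos_ge0 _ _ _).
have h2 := @ge0_integral_affine l c (EFin \o f)^\-%E l0 (measurable_funeneg mf') (@funeneg_ge0 _ _ _).
under eq_integral do rewrite funeposE.
under [X in (_ - X)%E]eq_integral do rewrite funenegE.
under eq_integral do rewrite -(funeposE (EFin \o f)).
under [X in (_ - X)%E]eq_integral do rewrite -(funenegE (EFin \o f)).
rewrite h1 h2.
by rewrite -pmuleBr// fine_pmul.
Qed.

Lemma Rintegral_pZl (D : set R) (k : R) (f : R -> R) : 0 < k -> measurable D ->
  measurable_fun D f ->
  Rintegral mu D (fun u => k * f u) = k * Rintegral mu D f.
Proof.
move=> k0 mD mf; rewrite /Rintegral integralE [in RHS]integralE.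
have mf' : measurable_fun D (EFin \o f) by apply/measurable_EFinP.
rewrite (_ : (fun u => (k * f u)%:E) = (fun u => k%:E * (EFin \o f) u)%E); last first.
  by apply/funext => u; rewrite EFinM.
rewrite ge0_funeposM ?ge0_funenegM ?ltW//.
rewrite ge0_integralZl_EFin//; last 2 first.
- exact: measurable_funepos.
- exact: ltW.
rewrite ge0_integralZl_EFin//; last 2 first.
- exact: measurable_funeneg.
- exact: ltW.
by rewrite -pmuleBr// fine_pmul.
Qed.

Let pos : set R := `]0, +oo[%classic.

Let mpos : measurable (pos : set (measurableTypeR R)).
Proof. exact: measurable_itv. Qed.

(* the Haar measure [dy / y] of the multiplicative group, read in the coordinate [ln y] *)
Definition logm (X : set (measurableTypeR R)) : \bar R :=
  (\int[mu]_(y in (pos `&` (@ln R @^-1` X))) (`|y|^-1)%:E)%E.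

Lemma measurable_invn (D : set R) : measurable_fun D (fun y : R => (`|y|^-1)).
Proof.
apply: measurable_funTS.
rewrite (_ : (fun _ => _) = (fun y => if y == 0 then 0 else expR (- ln `|y|))); last first.
  apply/funext => y; case: eqP => [->|/eqP y0]; first by rewrite normr0 invr0.
  by rewrite expRN lnK// posrE normr_gt0.
apply: measurable_fun_ifT => //.
- by apply: measurable_fun_eqr.
- apply: (measurableT_comp (@measurable_expR R)).
  apply: measurable_funN.
  apply: (measurableT_comp (@measurable_ln R)).
  exact: normr_measurable.
Qed.

Lemma measurable_lnpre (X : set (measurableTypeR R)) : measurable X ->
  measurable (pos `&` (@ln R @^-1` X)).
Proof.
move=> mX; rewrite /pos; apply: measurableI => //.
by have := @measurable_ln R measurableT X mX; rewrite setTI.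
Qed.

Let logm0 : logm set0 = 0%E.
Proof. by rewrite /logm preimage_set0 setI0 integral_set0. Qed.

Let logm_ge0 X : (0 <= logm X)%E.
Proof. by apply: integral_ge0 => y _; rewrite lee_fin invr_ge0. Qed.

Let logm_sigma_additive : semi_sigma_additive logm.
Proof.
move=> /= F mF tF mUF.
have := @semi_sigma_additive_nng_induced _ _ _ mu (fun y : R => (`|y|^-1)%:E).
move=> /(_ _ _ (fun n => pos `&` (@ln R @^-1` (F n)))).
rewrite -setI_bigcupr -preimage_bigcup; apply.
- by apply/measurable_EFinP; exact: measurable_invn.
- by move=> x; rewrite lee_fin invr_ge0.
- by move=> n; exact: measurable_lnpre.
- apply/trivIsetP => i j _ _ ij; rewrite setIACA -[X in _ `&` X]preimage_setI.
  move/trivIsetP : tF => /(_ i j I I ij) FF.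
  by rewrite setIid FF preimage_set0 setI0.
- exact: measurable_lnpre.
Qed.

HB.instance Definition _ := isMeasure.Build _ _ _ logm
  logm0 logm_ge0 logm_sigma_additive.

(** On []a, b]] the measure [logm] is the integral of [1 / y] over []expR a, expR b]], which is
    [b - a] by the fundamental theorem of calculus; uniqueness of Lebesgue measure does the rest. *)
Lemma lebesgue_logm (X : set R) : measurable X -> mu X = logm X.
Proof.
move=> mX; apply: (lebesgue_measure_unique (mu := logm)) => // Y [[a b]] _ <-.
rewrite /= /logm.
have -> : pos `&` (@ln R @^-1` `]a, b]) = `]expR a, expR b]%classic.
  apply/seteqP; split => y; rewrite /pos /= !in_itv /= ?andbT.
    move=> [y0 /andP[h1 h2]].
    by rewrite -(lnK y0) ltr_expR ler_expR h1.
  move=> /andP[h1 h2]; have y0 : 0 < y by rewrite (lt_trans _ h1)// expR_gt0.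
  by rewrite y0; split => //; rewrite -(lnK y0) ltr_expR ler_expR in h1 h2 *; rewrite expRK h1 h2.
rewrite lebesgue_measure_itv /= lte_fin.
case: ifPn => [ab|]; last first.
  rewrite -leNgt => ba; rewrite set_itv_ge ?integral_set0//.
  by rewrite bnd_simp -leNgt ler_expR.
rewrite integral_itv_obnd_cbnd; last by apply/measurable_EFinP; exact: measurable_invn.
have E (y : R) : expR a <= y -> 0 < y by apply: lt_le_trans; exact: expR_gt0.
have dln (y : R) : expR a <= y -> is_derive y 1 (@ln R) y^-1.
  by move=> /E y0; exact: is_derive1_ln.
rewrite (@continuous_FTC2 _ _ (@ln R)) ?ltr_expR ?expRK//.
- apply: continuous_in_subspaceT => y; rewrite inE /= in_itv /= => /andP[/E y0 _].
  have : (fun y : R => `|y|^-1) x @[x --> y] --> `|y|^-1; last by [].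
  apply: cvgV; first by rewrite normr_eq0 gt_eqF.
  exact: norm_continuous.
- split.
  + move=> y; rewrite in_itv /= => /andP[/ltW /dln ? _]; exact: ex_derive.
  + by apply: cvg_at_right_filter; apply: continuous_ln; exact: expR_gt0.
  + by apply: cvg_at_left_filter; apply: continuous_ln; exact: expR_gt0.
- move=> y; rewrite in_itv /= => /andP[ay _].
  have y0 := E _ (ltW ay); have ? := dln _ (ltW ay).
  by rewrite derive1E derive_val gtr0_norm.
Qed.

(** For indicators this is [lebesgue_logm]; simple functions follow by linearity, and nonnegative
    measurable functions by monotone convergence on both sides. *)
Lemma ge0_integral_expR (h : R -> \bar R) :
  measurable_fun setT h -> (forall x, 0 <= h x)%E ->
  (\int[mu]_u h u = \int[mu]_(y in pos) (h (ln y) * (`|y|^-1)%:E))%E.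
Proof.
move=> mh h0.
have mln : measurable_fun pos (@ln R) by exact: measurable_funTS (@measurable_ln R).
have mh' : measurable_fun [set: measurableTypeR R] h by exact: mh.
pose f_ := nnsfun_approx measurableT mh'.
have mfn n : measurable_fun [set: measurableTypeR R] (f_ n) by exact: measurable_funP.
have inv0 (y : R) : (0 <= (`|y|^-1)%:E :> \bar R)%E by rewrite lee_fin invr_ge0.
have minv : measurable_fun pos (fun y : R => (`|y|^-1)%:E : \bar R).
  by apply/measurable_EFinP; exact: measurable_invn.
transitivity (limn (fun n => \int[mu]_u (f_ n u)%:E))%E.
  rewrite -monotone_convergence//.
  - apply: eq_integral => y _; apply/esym/cvg_lim => //.
    by apply: cvg_nnsfun_approx=> // *.
  - by move=> n; exact/measurable_EFinP/measurable_funP.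
  - by move=> n y _; rewrite lee_fin.
  - by move=> y _ m n mn; rewrite lee_fin; exact/lefP/nd_nnsfun_approx.
transitivity (limn (fun n => \int[mu]_(y in pos) ((f_ n (ln y))%:E * (`|y|^-1)%:E)))%E; last first.
  rewrite -monotone_convergence//.
  - apply: eq_integral => y _; apply/cvg_lim => //.
    apply: cvgeZr => //.
    by apply: cvg_nnsfun_approx=> // *.
  - move=> n; apply: emeasurable_funM => //.
    apply/measurable_EFinP; apply: (measurable_comp measurableT) => //.
    exact: mfn.
  - by move=> n y _; rewrite mule_ge0// lee_fin.
  - move=> y _ m n mn; rewrite lee_wpmul2r// lee_fin.
    by have /lefP := nd_nnsfun_approx measurableT mh' mn; exact.
congr (limn _); apply/funext => n.
have mf (r : R) : measurable (f_ n @^-1` [set r]).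
  by rewrite -(setTI (_ @^-1` _)); exact: (measurable_funP (f_ n)).
have mfl (r : R) : measurable (pos `&` @ln R @^-1` (f_ n @^-1` [set r])).
  exact: measurable_lnpre.
have mind (r : R) : measurable_fun pos (fun y : R => \1_(f_ n @^-1` [set r]) (ln y) : R).
  have m1 : measurable_fun [set: R] (\1_(f_ n @^-1` [set r]) : R -> R).
    by apply/measurable_indicP; exact: mf.
  exact: (measurableT_comp m1 mln).
have key (r : R) : mu (f_ n @^-1` [set r]) =
    (\int[mu]_(y in pos) ((\1_(f_ n @^-1` [set r]) (ln y))%:E * (`|y|^-1)%:E))%E.
  rewrite lebesgue_logm /=; last exact: mf.
  rewrite -[LHS]/(\int[mu]_(y in pos `&` (@ln R @^-1` (f_ n @^-1` [set r]))) (`|y|^-1)%:E)%E.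
  rewrite integral_mkcondr.
  apply: eq_integral => y _; rewrite /patch /= indicE.
  case: ifPn; rewrite ?inE => yr; rewrite ?mul1e//.
  - by rewrite mem_set ?mul1e//.
  - by rewrite memNset ?mul0e// => yr'; move: yr; rewrite notin_setE; apply.
under [LHS]eq_integral do rewrite fimfunE -fsumEFin//.
rewrite ge0_integral_fsum//; last 2 first.
- by move=> r; exact/measurable_EFinP/measurable_funM.
- by move=> r x _; rewrite nnfun_muleindic_ge0.
transitivity (\int[mu]_(y in pos) \sum_(k \in range (f_ n))
    ((k * \1_(f_ n @^-1` [set k]) (ln y))%:E * (`|y|^-1)%:E))%E; last first.
  apply: eq_integral => y _; rewrite [in RHS](fimfunE (f_ n)) -fsumEFin//.
  rewrite ge0_mule_fsuml// => k; exact: nnfun_muleindic_ge0.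
rewrite ge0_integral_fsum//; last 2 first.
- move=> r; apply: emeasurable_funM => //; apply/measurable_EFinP/measurable_funM => //.
  exact: mind.
- by move=> r x _; rewrite mule_ge0// nnfun_muleindic_ge0.
apply: eq_fsbigr => r /set_mem /= [x _ xr].
have r0 : 0 <= r by rewrite -xr.
under [in RHS]eq_integral do rewrite EFinM -muleA.
rewrite [RHS]ge0_integralZl_EFin//; last first.
  by apply: emeasurable_funM => //; apply/measurable_EFinP; exact: mind.
under [LHS]eq_integral do rewrite EFinM.
rewrite ge0_integralZl_EFin//; last first.
  apply/measurable_EFinP/measurable_indicP; exact: mf.
rewrite -key -[in RHS](setIT (_ @^-1` _)) -integral_indic//.
Qed.

Lemma ge0_integral_pos_expR (g : R -> \bar R) :
  measurable_fun setT g -> (forall x, 0 <= g x)%E ->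
  (\int[mu]_(y in pos) g y = \int[mu]_u (g (expR u) * (expR u)%:E))%E.
Proof.
move=> mg g0; rewrite (@ge0_integral_expR (fun u => g (expR u) * (expR u)%:E)%E).
- apply: eq_integral => y; rewrite inE /pos /= in_itv /= andbT => y0.
  by rewrite lnK// -muleA -EFinM gtr0_norm// divff ?gt_eqF// mule1.
- apply: emeasurable_funM; last by apply/measurable_EFinP; exact: measurable_expR.
  exact: (measurableT_comp mg (@measurable_expR R)).
- by move=> x; rewrite mule_ge0// lee_fin expR_ge0.
Qed.

Lemma Rintegral_pos_expR (f : R -> R) : measurable_fun setT f ->
  Rintegral mu pos f = Rintegral mu setT (fun u => f (expR u) * expR u).
Proof.
move=> mf; rewrite /Rintegral integralE [in RHS]integralE.
have mf' : measurable_fun setT (EFin \o f) by apply/measurable_EFinP.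
have h1 := @ge0_integral_pos_expR (EFin \o f)^\+%E (measurable_funepos mf') (@funepos_ge0 _ _ _).
have h2 := @ge0_integral_pos_expR (EFin \o f)^\-%E (measurable_funeneg mf') (@funeneg_ge0 _ _ _).
rewrite h1 h2.
congr (fine (_ - _)); apply: eq_integral => u _.
  by rewrite !funeposE /= maxe_pMl ?mul0e ?lee_fin ?expR_ge0.
by rewrite !funenegE /= maxe_pMl ?mul0e ?lee_fin ?expR_ge0// -?EFinN -?EFinM mulNr.
Qed.

End ChangeOfVariables.

(** * Exponentially decaying functions *)

Section ExponentialDecay.
Variable R : realType.
Notation mu := (@lebesgue_measure R).
Implicit Types (f g h : R -> R) (d C : R).

Definition exp_decay f :=
  exists C d, [/\ 0 <= C, 0 < d & forall u, `|f u| <= C * expR (- (d * `|u|))].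

Lemma integrable_affine (l c : R) f : l != 0 ->
  mu.-integrable setT (EFin \o f) ->
  mu.-integrable setT (EFin \o (fun u => f (l * u + c))).
Proof.
move=> l0 /integrableP[mf fi].
have mf' : measurable_fun [set: R] f by exact/measurable_EFinP.
apply/integrableP; split.
  apply/measurable_EFinP; apply: (measurableT_comp mf'); exact: measurable_affine.
rewrite (@ge0_integral_affine _ l c (abse \o (EFin \o f)))//; last 2 first.
- exact: measurableT_comp.
- by move=> x; exact: abse_ge0.
by rewrite lte_mul_pinfty// ?lee_fin ?invr_ge0.
Qed.

Lemma integrable_expN_norm d : 0 < d ->
  mu.-integrable setT (EFin \o (fun u => expR (- (d * `|u|)))).
Proof.
move=> d0.
(* The exponential density plus its reflection is at least [d * expR (- (d * |u|))], which explains
   the factor [d^-1] below. *)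
have i1 := integrable_exponential_pdf d0.
have N10 : (-1 : R) != 0 by rewrite oppr_eq0 oner_eq0.
have i2 := @integrable_affine (-1) 0 _ N10 i1.
have := integrableZl measurableT d^-1 (integrableD measurableT i1 i2).
apply: le_integrable => //.
  apply/measurable_EFinP; apply: (measurableT_comp (@measurable_expR R)).
  by apply: measurable_funN; apply: measurable_funM => //; exact: normr_measurable.
move=> u _; rewrite /= lee_fin ger0_norm ?expR_ge0// (le_trans _ (ler_norm _))//.
rewrite mulN1r addr0 [leRHS]mulrC ler_pdivlMr//.
have [u0|u0] := leP 0 u.
- rewrite exponential_pdfE// ger0_norm// mulrC mulNr.
  by rewrite lerDl exponential_pdf_ge0// ltW.
- rewrite [X in _ + X]exponential_pdfE ?oppr_ge0 ?(ltW u0)// ltr0_norm// mulrC mulNr.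
  by rewrite lerDr exponential_pdf_ge0// (ltW d0).
Qed.

Lemma exp_decay_integrable f : measurable_fun setT f -> exp_decay f ->
  mu.-integrable setT (EFin \o f).
Proof.
move=> mf [C [d [C0 d0 fC]]].
have := integrableZl measurableT C (integrable_expN_norm d0).
apply: le_integrable => //; first exact/measurable_EFinP.
move=> u _; rewrite /= lee_fin; apply: (le_trans (fC u)).
exact: ler_norm.
Qed.

Lemma exp_decay_le f g : (forall u, `|f u| <= `|g u|) -> exp_decay g -> exp_decay f.
Proof.
move=> fg [C [d [C0 d0 gC]]]; exists C, d; split => // u.
exact: le_trans (fg u) (gC u).
Qed.

Lemma exp_decayZ (k : R) f : exp_decay f -> exp_decay (fun u => k * f u).
Proof.
move=> [C [d [C0 d0 gC]]]; exists (`|k| * C), d; split; rewrite ?mulr_ge0// => u.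
by rewrite normrM -mulrA ler_wpM2l.
Qed.

Lemma exp_decayD f g : exp_decay f -> exp_decay g -> exp_decay (fun u => f u + g u).
Proof.
move=> [C [d [C0 d0 fC]]] [C' [d' [C'0 d'0 gC]]].
exists (C + C'), (Num.min d d'); split; rewrite ?addr_ge0 ?lt_min ?d0// => u.
rewrite (le_trans (ler_normD _ _))// mulrDl lerD//.
- rewrite (le_trans (fC u))// ler_wpM2l// ler_expR lerN2 ler_wpM2r//.
  by rewrite ge_min lexx.
- rewrite (le_trans (gC u))// ler_wpM2l// ler_expR lerN2 ler_wpM2r//.
  by rewrite ge_min lexx orbT.
Qed.

Lemma linear_sub_exp_bounded (q k : R) : 0 < q -> 0 < k ->
  exists C, forall v, q * v - k * expR v <= C.
Proof.
(* The witness is the maximum, attained at [v = ln (q / k)]; the bound is the tangent inequality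
   [1 + w <= expR w] at [w = v - ln (q / k)]. *)
move=> q0 k0; exists (q * ln (q / k) - q) => v.
have := expR_ge1Dx (v - ln (q / k)).
rewrite expRD expRN lnK ?posrE ?divr_gt0// invf_div.
move=> /(ler_wpM2l (ltW q0)) H.
have -> : k * expR v = q * (expR v * (k / q)) by field; rewrite gt_eqF.
by move: H; lra.
Qed.

(** For [v >= 0], boundedness with the doubled slope [2 * p] leaves [- p * v] to spare; for [v < 0]
    the linear term alone already decays. *)
Lemma exp_sub_exp_bound (p k : R) : 0 < p -> 0 < k ->
  exists2 C, 0 <= C & forall v, expR (p * v - k * expR v) <= C * expR (- (p * `|v|)).
Proof.
move=> p0 k0; have p20 : 0 < 2 * p by rewrite mulr_gt0.
have [C HC] := linear_sub_exp_bounded p20 k0.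
exists (expR `|C|) => [|v]; first exact: expR_ge0.
rewrite -expRD ler_expR.
have [v0|v0] := leP 0 v.
  by rewrite (ger0_norm v0); have := HC v; have := ler_norm C; lra.
rewrite (ltr0_norm v0); have := mulr_ge0 (ltW k0) (expR_ge0 v).
by have := normr_ge0 C; lra.
Qed.

Lemma exp_decay_exp_sub_exp (p k : R) : 0 < p -> 0 < k ->
  exp_decay (fun v => expR (p * v - k * expR v)).
Proof.
move=> p0 k0; have [C C0 HC] := exp_sub_exp_bound p0 k0.
by exists C, p; split=> // u; rewrite ger0_norm ?expR_ge0.
Qed.

Lemma exp_decay_gauss (e : R) : 0 < e -> exp_decay (fun t => expR (- (e * t ^+ 2))).
Proof.
(* The constants come from completing the square: [e * (|u| - 1/2) ^+ 2] is nonnegative. *)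
move=> e0; exists (expR (e / 4)), e; split => // u.
rewrite ger0_norm ?expR_ge0// -expRD ler_expR.
have : 0 <= e * (`|u| - 2^-1) ^+ 2 by rewrite mulr_ge0 ?sqr_ge0 ?ltW.
rewrite sqrrB real_normK ?num_real//; lra.
Qed.

Lemma Rintegral_translation f (c : R) : measurable_fun setT f ->
  Rintegral mu setT (fun u => f (u + c)) = Rintegral mu setT f.
Proof.
move=> mf; have := @Rintegral_affine R 1 c f (oner_neq0 _) mf.
by rewrite normr1 invr1 mul1r; under eq_Rintegral do rewrite mul1r.
Qed.

Lemma is_derive_under_integral (F dF : R -> R -> R) (G : R -> R) (a r : R) : 0 < r ->
  (forall x, `|x - a| < r -> measurable_fun setT (F x)) ->
  (forall x, `|x - a| < r -> exp_decay (F x)) ->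
  (forall x y, `|x - a| < r -> is_derive x 1 (F^~ y) (dF x y)) ->
  measurable_fun setT G -> exp_decay G ->
  (forall x y, `|x - a| < r -> `|dF x y| <= G y) ->
  is_derive a 1 (fun x => Rintegral mu setT (F x)) (Rintegral mu setT (dF a)).
Proof.
move=> r0 mF eF dFE mG eG GdF.
have I x : `](a - r), (a + r)[%classic x -> `|x - a| < r.
  by rewrite /= in_itv /= ltr_distl.
have Ia : `](a - r), (a + r)[%classic a by rewrite /= in_itv /= ltrBlDr !ltrDl r0.
have iF x : `](a - r), (a + r)[%classic x -> mu.-integrable setT (EFin \o F x).
  by move=> /I xr; apply: exp_decay_integrable; [exact: mF|exact: eF].
have dF' x y : `](a - r), (a + r)[%classic x -> setT y -> derivable (F^~ y) x 1.
  by move=> /I xr _; have ? := dFE _ y xr; exact: ex_derive.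
have G0 y : 0 <= G y by apply: le_trans (GdF a y _); rewrite ?subrr ?normr0.
have iG := exp_decay_integrable mG eG.
have G_ub x y : `](a - r), (a + r)[%classic x -> setT y -> `|partial1of2 F x y| <= G y.
  by move=> /I xr _; have ? := dFE _ y xr; rewrite partial1of2E derive_val; exact: GdF.
have D := @derivable_under_integral R _ _ mu F setT measurableT a _ _ Ia iF dF' G G0 iG G_ub.
have E := @differentiation_under_integral R _ _ mu F setT measurableT a _ _ Ia iF dF' G G0 iG G_ub.
apply: DeriveDef => //; rewrite -derive1E E.
apply: eq_Rintegral => y _; have ? := dFE _ y (I _ Ia).
by rewrite partial1of2E derive_val.
Qed.

(* translation invariance makes [c |-> \int F (u + c) du] constant *)
Lemma Rintegral_derive0 (F dF : R -> R) (G : R -> R) :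
  measurable_fun setT F -> exp_decay F ->
  (forall u : R, is_derive u 1 F (dF u)) ->
  measurable_fun setT G -> exp_decay G ->
  (forall x y : R, `|x| < 1 -> `|dF (x + y)| <= G y) ->
  Rintegral mu setT dF = 0.
Proof.
move=> mF eF dFE mG eG dFG.
have H : is_derive (0 : R) (1 : R) (fun x : R => Rintegral mu setT (fun y => F (x + y))) (Rintegral mu setT (fun y => dF (0 + y))).
  apply: (@is_derive_under_integral (fun x y => F (x + y)) (fun x y => dF (x + y)) G 0 1) => //.
  - by move=> x _; apply: (measurableT_comp mF); exact: measurable_funD.
  - move=> x; rewrite subr0 => x1; case: eF => C [d [C0 d0 HC]].
    exists (C * expR d), d; split => // [|u]; first by rewrite mulr_ge0 ?expR_ge0.
    rewrite (le_trans (HC _))// -mulrA ler_wpM2l// -expRD ler_expR.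
    rewrite -[X in _ <= X + _]mulr1 -!mulrN -mulrDr ler_wpM2l ?ltW//.
    have : `|u| <= `|x + u| + `|x| by rewrite -{1}(addKr x u) addrC ler_normB.
    by have := ltW x1; lra.
  - move=> x y _.
    have h1 : is_derive x (1 : R) (fun x : R => x + y) (1 + 0) by exact: is_deriveD.
    by have := @is_derive1_comp _ F _ x _ _ (dFE (x + y)) h1; rewrite addr0 mulr1.
  - by move=> x y; rewrite subr0; exact: dFG.
have E : (fun x => Rintegral mu setT (fun y => F (x + y))) = cst (Rintegral mu setT F).
  apply/funext => x; rewrite /cst -(Rintegral_translation x mF).
  by under eq_Rintegral do rewrite addrC.
have F0 : (fun y => dF (0 + y)) = dF by apply/funext => y; rewrite add0r.
move: H; rewrite E F0.
by move=> H; rewrite -(@derive_val _ _ _ _ _ _ _ H) derive_cst.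
Qed.

End ExponentialDecay.

Ltac measurable_tac := repeat (first
  [ exact: measurable_cst | exact: measurable_id
  | apply: measurable_funD | apply: measurable_funB | apply: measurable_funN
  | apply: measurable_funM
  | apply: (measurableT_comp (@measurable_expR _))
  | apply: (measurableT_comp (continuous_measurable_fun (@continuous_cos _)))
  | apply: (measurableT_comp (continuous_measurable_fun (@continuous_sin _)))
  | apply: (measurableT_comp (@normr_measurable _ setT)) ]).

(** * Rotation of the Gamma integral *)

Section Gamma.
Variable R : realType.
Notation mu := (@lebesgue_measure R).

Lemma is_derive0_const (f : R -> R) (a b : R) : a < b ->
  (forall x, x \in `[a, b]%R -> is_derive x 1 f 0) -> f b = f a.
Proof.
move=> ab D.
have D' x : x \in `]a, b[%R -> is_derive x 1 f ((cst 0 : R -> R) x).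
  by move=> xab; apply: D; exact: subset_itv_oo_cc.
have [|c _] := MVT ab D'; last by rewrite /cst mul0r => /eqP; rewrite subr_eq0 => /eqP.
by apply: derivable_within_continuous => x /D ?; exact: ex_derive.
Qed.

Section Rotation.
Variables p q : R.
Hypothesis p0 : 0 < p.

(* real part of [e^(ik) exp (s w - e^w)] at [w = v + i t], where [s = p + i q] *)
Definition rotW (k t v : R) : R :=
  expR (p * v - q * t - expR v * cos t) * cos (q * v + p * t - expR v * sin t + k).

Definition rotDV (k t v : R) : R :=
  expR (p * v - q * t - expR v * cos t) *
  ((p - expR v * cos t) * cos (q * v + p * t - expR v * sin t + k)
   - (q - expR v * sin t) * sin (q * v + p * t - expR v * sin t + k)).

(** This is the derivative of [rotW] in [t]. Since [rotW] is the real part of a holomorphic function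
    of [v + i t], it is the derivative in [v] multiplied by [i], and that factor is absorbed by
    adding [pi / 2] to the phase. *)
Definition rotDT (k t v : R) : R := rotDV (k + pi / 2) t v.

Lemma measurable_rotW k t : measurable_fun setT (rotW k t).
Proof. by rewrite /rotW; measurable_tac. Qed.

Lemma is_derive_rotV (k t v : R) : is_derive v 1 (rotW k t) (rotDV k t v).
Proof.
rewrite /rotW.
have e1 : is_derive v (1 : R) (fun v : R => p * v - q * t - expR v * cos t) (p - expR v * cos t).
  apply: is_derive_eq.
  by rewrite /GRing.scale /=; ring.
have e2 : is_derive v (1 : R) (fun v : R => q * v + p * t - expR v * sin t + k) (q - expR v * sin t).
  apply: is_derive_eq.
  by rewrite /GRing.scale /=; ring.
have e3 := @is_derive1_comp _ (@expR R) _ v _ _ (is_derive_expR _) e1.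
have e4 := @is_derive1_comp _ (@cos R) _ v _ _ (is_derive_cos _) e2.
have := is_deriveM e3 e4; set d := (X in is_derive _ _ _ X) => e5.
have -> : rotDV k t v = d by rewrite /d /GRing.scale /rotDV /=; ring.
exact: e5.
Qed.

Lemma is_derive_rotT (k t v : R) : is_derive t 1 (fun t => rotW k t v) (rotDT k t v).
Proof.
rewrite /rotW.
have e1 : is_derive t (1 : R) (fun t : R => p * v - q * t - expR v * cos t) (- q + expR v * sin t).
  apply: is_derive_eq.
  by rewrite /GRing.scale /=; ring.
have e2 : is_derive t (1 : R) (fun t : R => q * v + p * t - expR v * sin t + k) (p - expR v * cos t).
  apply: is_derive_eq.
  by rewrite /GRing.scale /=; ring.
have e3 := @is_derive1_comp _ (@expR R) _ t _ _ (is_derive_expR _) e1.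
have e4 := @is_derive1_comp _ (@cos R) _ t _ _ (is_derive_cos _) e2.
have := is_deriveM e3 e4; set d := (X in is_derive _ _ _ X) => e5.
have -> : rotDT k t v = d.
  by rewrite /d /GRing.scale /rotDT /rotDV /= !addrA cosDpihalf sinDpihalf; ring.
exact: e5.
Qed.

(** A majorant of [rotDV] at [x + y], uniform for [|x| <= 1], [|t| <= 2] and [m <= cos t]. With
    [K = expR (p + 2 * |q|)] it absorbs [p * x] and [- q * t]; with [c = m * expR (-1)] it absorbs
    the factor [expR x] in the double exponential. The two summands bound the constant part and the
    [expR y] part of the algebraic prefactor. *)
Definition rotG (K c y : R) : R :=
  K * (expR (p * y - c * expR y) * (p + `|q|)) + K * (2 * expR 1 * expR ((p + 1) * y - c * expR y)).

Lemma measurable_rotG K c : measurable_fun setT (rotG K c).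
Proof. by rewrite /rotG; measurable_tac. Qed.

Lemma exp_decay_rotG K c : 0 < c -> exp_decay (rotG K c).
Proof.
move=> c0; apply: exp_decayD; apply: exp_decayZ.
- have := exp_decayZ (p + `|q|) (exp_decay_exp_sub_exp p0 c0).
  by apply: exp_decay_le => u; rewrite mulrC.
- by apply: exp_decayZ; apply: exp_decay_exp_sub_exp => //; rewrite addr_gt0.
Qed.

Lemma rotDV_bound k (m t x y : R) : 0 < m -> m <= cos t -> `|t| <= 2 -> `|x| <= 1 ->
  `|rotDV k t (x + y)| <= rotG (expR (p + 2 * `|q|)) (m * expR (-1)) y.
Proof.
move=> m0 mt t2 x1; rewrite /rotDV /rotG normrM (ger0_norm (expR_ge0 _)).
have [x1l x1r] : -1 <= x /\ x <= 1 by move: x1; rewrite ler_norml => /andP[].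
have E : expR (p * (x + y) - q * t - expR (x + y) * cos t) <=
    expR (p + 2 * `|q|) * expR (p * y - m * expR (-1) * expR y).
  rewrite -expRD ler_expR.
  have h1 : p * x <= p by rewrite ler_piMr// ltW.
  have h2 : - (q * t) <= 2 * `|q|.
    by rewrite (le_trans (ler_norm _))// normrN normrM mulrC ler_wpM2r.
  have h3 : m * expR (-1) * expR y <= expR (x + y) * cos t.
    rewrite -mulrA -expRD mulrC.
    by rewrite ler_pM ?expR_ge0 ?(ltW m0)// ler_expR lerD2r.
  lra.
have F : `|(p - expR (x + y) * cos t) * cos (q * (x + y) + p * t - expR (x + y) * sin t + k)
   - (q - expR (x + y) * sin t) * sin (q * (x + y) + p * t - expR (x + y) * sin t + k)|
   <= (p + `|q|) + 2 * expR 1 * expR y.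
  have h e : `|e| <= 1 -> `|expR (x + y) * e| <= expR 1 * expR y.
    move=> e1; rewrite normrM ger0_norm ?expR_ge0// -expRD.
    by rewrite (le_trans (ler_piMr (expR_ge0 _) e1))// ler_expR lerD2r.
  have hm (a b A : R) : `|b| <= 1 -> `|a| <= A -> `|a * b| <= A.
    by move=> b1 aA; rewrite normrM (le_trans _ aA)// ler_piMr.
  have a1 : `|p - expR (x + y) * cos t| <= p + expR 1 * expR y.
    rewrite (le_trans (ler_normB _ _))// (ger0_norm (ltW p0)) lerD2l.
    exact/h/cos_max.
  have a2 : `|q - expR (x + y) * sin t| <= `|q| + expR 1 * expR y.
    by rewrite (le_trans (ler_normB _ _))// lerD2l; exact/h/sin_max.
  have b1 := hm _ _ _ (cos_max (q * (x + y) + p * t - expR (x + y) * sin t + k)) a1.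
  have b2 := hm _ _ _ (sin_max (q * (x + y) + p * t - expR (x + y) * sin t + k)) a2.
  by rewrite (le_trans (ler_normB _ _))//; lra.
apply: (le_trans (ler_pM (expR_ge0 _) (normr_ge0 _) E F)).
have -> : (p + 1) * y - m * expR (-1) * expR y = y + (p * y - m * expR (-1) * expR y) by ring.
by rewrite [expR (y + _)]expRD le_eqVlt; apply/orP; left; apply/eqP; ring.
Qed.

Lemma exp_decay_rotW k t : 0 < cos t -> exp_decay (rotW k t).
Proof.
move=> ct; have := exp_decayZ (expR (- (q * t))) (exp_decay_exp_sub_exp p0 ct).
apply: exp_decay_le => u; rewrite /rotW -expRD normrM.
rewrite (_ : p * u - q * t - expR u * cos t = - (q * t) + (p * u - cos t * expR u)); last by ring.
by rewrite ler_piMr// cos_max.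
Qed.

Lemma pihalf_norm (t : R) : `|t| < pi / 2 -> 0 < cos t.
Proof. by rewrite ltr_norml; exact: cos_gt0_pihalf. Qed.

Lemma Rintegral_rotDV k t : `|t| < pi / 2 -> Rintegral mu setT (rotDV k t) = 0.
Proof.
move=> t2; have c0 := pihalf_norm t2.
apply: (@Rintegral_derive0 _ (rotW k t) (rotDV k t)
  (rotG (expR (p + 2 * `|q|)) (cos t * expR (-1)))).
- exact: measurable_rotW.
- exact: exp_decay_rotW.
- by move=> u; exact: is_derive_rotV.
- exact: measurable_rotG.
- by apply: exp_decay_rotG; rewrite mulr_gt0 ?expR_gt0.
- move=> x y x1; apply: rotDV_bound => //; last exact: ltW.
  by apply: ltW; rewrite (lt_trans t2) ?pihalf_lt2.
Qed.

Lemma is_derive_Rintegral_rotW (k t : R) : `|t| < pi / 2 ->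
  is_derive t 1 (fun t => Rintegral mu setT (rotW k t)) 0.
Proof.
(* Angles within [r] of [t], half the gap to [pi / 2], stay below [t1] in absolute value, so their
   cosines are bounded below by [cos t1 > 0] and one majorant serves them all. *)
move=> t2; pose r := (pi / 2 - `|t|) / 2.
have r0 : 0 < r by rewrite /r divr_gt0// subr_gt0.
pose t1 := `|t| + r.
have t12 : t1 < pi / 2 by rewrite /t1 /r; lra.
have t10 : 0 <= t1 by rewrite addr_ge0// ltW.
have xt1 x : `|x - t| < r -> `|x| <= t1.
  move=> xr; rewrite -(subrK t x) (le_trans (ler_normD _ _))// addrC lerD2l; exact: ltW.
have c1 : 0 < cos t1 by apply: pihalf_norm; rewrite ger0_norm.
have cx x : `|x - t| < r -> cos t1 <= cos x.
  move=> /xt1 xt; rewrite -(cos_norm x).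
  have ppi : pi / 2 <= pi :> R by have := @pi_gt0 R; lra.
  have B y : 0 <= y -> y <= t1 -> y \in `[0, pi]%R.
    by move=> y0 yt; rewrite in_itv /= y0 (le_trans yt)// (le_trans (ltW t12)).
  by rewrite leNgt ltr_cos ?B// -leNgt.
have x2 x : `|x - t| < r -> `|x| <= 2.
  by move=> /xt1 xt; rewrite (le_trans xt)// (le_trans (ltW t12))// ltW// pihalf_lt2.
(* The value [0] is rewritten as the integral of [rotDV] with phase [k + pi / 2], that is of
   [rotDT], which is what differentiation under the integral sign produces. *)
rewrite -(Rintegral_rotDV (k + pi / 2) t2).
apply: (@is_derive_under_integral _ (rotW k) (rotDT k)
  (rotG (expR (p + 2 * `|q|)) (cos t1 * expR (-1))) t r r0).
- by move=> x _; exact: measurable_rotW.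
- by move=> x xr; apply: exp_decay_rotW; rewrite (lt_le_trans c1)// cx.
- by move=> x y _; exact: is_derive_rotT.
- exact: measurable_rotG.
- by apply: exp_decay_rotG; rewrite mulr_gt0 ?expR_gt0.
- move=> x y xr; rewrite /rotDT -[X in rotDV _ _ X]add0r.
  apply: rotDV_bound => //; [exact: cx|exact: x2|by rewrite normr0].
Qed.

(** The derivative in the angle vanishes on the whole open interval from [- pi / 2] to [pi / 2].
    This replaces shifting the contour by Cauchy's theorem. *)
Lemma Rintegral_rotW k t : `|t| < pi / 2 ->
  Rintegral mu setT (rotW k t) = Rintegral mu setT (rotW k 0).
Proof.
move=> t2; pose f t := Rintegral mu setT (rotW k t).
have p2 : 0 < pi / 2 :> R by have := @pi_gt0 R; lra.
have H a b : a < b -> `|a| < pi / 2 -> `|b| < pi / 2 -> f b = f a.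
  rewrite !ltr_norml => ab /andP[a1 a2] /andP[b1 b2].
  have D x : x \in `[a, b]%R -> is_derive x 1 f 0.
    rewrite in_itv /= => /andP[ax xb]; apply: is_derive_Rintegral_rotW.
    by rewrite ltr_norml (lt_le_trans a1)//= (le_lt_trans xb).
  exact: is_derive0_const ab D.
have [t0|t0|->//] := ltgtP t 0.
- by apply/esym/H => //; rewrite normr0.
- by apply/H => //; rewrite normr0.
Qed.

End Rotation.
End Gamma.

(** * Fourier inversion *)

Section FourierInversion.
Variable R : realType.
Notation mu := (@lebesgue_measure R).

(** Tonelli gives measurability of the integrals of the positive and negative parts; the extended
    difference and [fine] preserve it even where these integrals are infinite. *)
Lemma measurable_Rintegral_param d (T : measurableType d) (f : T -> R -> R) :
  measurable_fun setT (fun z : T * R => f z.1 z.2) ->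
  measurable_fun setT (fun t : T => Rintegral mu setT (f t)).
Proof.
move=> mf.
have mf' : measurable_fun setT (fun z : T * R => (f z.1 z.2)%:E) by exact/measurable_EFinP.
have m1 := @measurable_fun_fubini_tonelli_F _ _ _ _ _ mu _ (measurable_funepos mf') (@funepos_ge0 _ _ _).
have m2 := @measurable_fun_fubini_tonelli_F _ _ _ _ _ mu _ (measurable_funeneg mf') (@funeneg_ge0 _ _ _).
rewrite /Rintegral; apply: (measurableT_comp (@fine_measurable R setT measurableT)).
rewrite (_ : (fun _ => _) = (fun t : T => (\int[mu]_y (fun z : T * R => (f z.1 z.2)%:E)^\+ (t, y)
    - \int[mu]_y (fun z : T * R => (f z.1 z.2)%:E)^\- (t, y))%E)).
  by apply: emeasurable_funB.
by apply/funext => t; rewrite integralE; congr (_ - _)%E; apply: eq_integral => y _;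
  rewrite ?funeposE ?funenegE.
Qed.

Lemma Rintegral_swap (f : R -> R -> R) (C d : R) : 0 < d ->
  measurable_fun setT (fun z : R * R => f z.1 z.2) ->
  (forall x y, `|f x y| <= C * expR (- (d * `|x|)) * expR (- (d * `|y|))) ->
  Rintegral mu setT (fun x => Rintegral mu setT (f x)) =
  Rintegral mu setT (fun y => Rintegral mu setT (f^~ y)).
Proof.
move=> d0 mf fC.
have mf' : measurable_fun setT (fun z : R * R => (f z.1 z.2)%:E) by exact/measurable_EFinP.
have me : measurable_fun setT (fun y : R => expR (- (d * `|y|))) by measurable_tac.
have ee : exp_decay (fun y : R => expR (- (d * `|y|))).
  by exists 1, d; split => // u; rewrite mul1r ger0_norm// expR_ge0.
have i1 x : mu.-integrable setT (EFin \o f x).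
  apply: exp_decay_integrable.
    by have := measurableT_comp mf (@pair1_measurable _ _ _ _ x).
  apply: (@exp_decay_le _ _ (fun y => C * expR (- (d * `|x|)) * expR (- (d * `|y|)))).
    by move=> u; rewrite (le_trans (fC _ _))// ler_norm.
  exact: exp_decayZ.
have i2 y : mu.-integrable setT (EFin \o f^~ y).
  apply: exp_decay_integrable.
    by have := measurableT_comp mf (@pair2_measurable _ _ _ _ y).
  apply: (@exp_decay_le _ _ (fun x => C * expR (- (d * `|y|)) * expR (- (d * `|x|)))).
    by move=> u; rewrite (le_trans (fC _ _))// mulrAC ler_norm.
  exact: exp_decayZ.
have ie := exp_decay_integrable me ee.
pose I := Rintegral mu setT (fun y : R => expR (- (d * `|y|))).
have I1 : (\int[mu]_y (expR (- (d * `|y|)))%:E = I%:E)%E.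
  by rewrite /I /Rintegral fineK// integrable_fin_num.
(* The majorant is a product, so its double integral is [|C|] times the square of the one-variable
   integral [I]. *)
have ifz : (mu \x mu)%E.-integrable setT (fun z : R * R => (f z.1 z.2)%:E).
  apply/integrable12ltyP => //=.
  apply: (@le_lt_trans _ _ (\int[mu]_x (\int[mu]_y (`|C| * expR (- (d * `|x|)) * expR (- (d * `|y|)))%:E))%E).
    apply: ge0_le_integral => //=.
    - by move=> x _; exact: integral_ge0.
    - have := @measurable_fun_fubini_tonelli_F _ _ _ _ _ mu (fun z : R * R => `|(f z.1 z.2)%:E|%E).
      by apply => //; exact: measurableT_comp.
    - pose b := fun z : R * R => (`|C| * expR (- (d * `|z.1|)) * expR (- (d * `|z.2|)))%:E.
      have b0 z : (0 <= b z)%E by rewrite lee_fin !mulr_ge0 ?expR_ge0.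
      have mb : measurable_fun setT b.
        apply/measurable_EFinP; apply: measurable_funM; first apply: measurable_funM => //.
          by apply: (measurableT_comp me); exact: measurable_fst.
        by apply: (measurableT_comp me); exact: measurable_snd.
      exact: (@measurable_fun_fubini_tonelli_F _ _ _ _ _ mu b mb b0).
    - move=> x _; apply: ge0_le_integral => //=.
      + by have := measurableT_comp (measurableT_comp (@abse_measurable R setT) mf') (@pair1_measurable _ _ _ _ x).
      + by apply/measurable_EFinP; apply: measurable_funM.
      + move=> y _; rewrite lee_fin (le_trans (fC _ _))// !ler_wpM2r ?expR_ge0//.
        exact: ler_norm.
  under eq_integral => x _.
    under eq_integral do rewrite EFinM.
    rewrite ge0_integralZl_EFin//; last first.
      exact/measurable_EFinP.
    rewrite I1 -EFinM mulrAC EFinM.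
    over.
  rewrite ge0_integralZl_EFin//.
  - by rewrite I1 -EFinM ltry.
  - exact/measurable_EFinP.
  - by rewrite mulr_ge0// /I; apply: Rintegral_ge0 => y _; exact: expR_ge0.
have := Fubini ifz; rewrite /=.
under eq_integral do rewrite -(fineK (integrable_fin_num measurableT (i1 _))).
move=> E; rewrite [LHS]/Rintegral E /Rintegral; congr fine.
apply: eq_integral => y _; rewrite fineK//.
exact: (integrable_fin_num measurableT (i2 y)).
Qed.

Lemma cvg_Rintegral_dominated (f_ : (R -> R)^nat) (f g : R -> R) :
  (forall n, measurable_fun setT (f_ n)) -> measurable_fun setT f ->
  (forall x, f_ n x @[n --> \oo] --> f x) ->
  measurable_fun setT g -> exp_decay g -> (forall n x, `|f_ n x| <= g x) ->
  Rintegral mu setT (f_ n) @[n --> \oo] --> Rintegral mu setT f.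
Proof.
move=> mf_ mf ff mg eg fg.
have ig := exp_decay_integrable mg eg.
have h1 n : measurable_fun setT (fun x => (f_ n x)%:E) by exact/measurable_EFinP.
have h2 : measurable_fun setT (fun x => (f x)%:E) by exact/measurable_EFinP.
have h3 : {ae mu, forall x, setT x -> (fun n => (f_ n x)%:E) @ \oo --> (f x)%:E}.
  by apply: aeW => x _; apply: cvg_EFin; [exact: nearW|exact: ff].
have h4 : {ae mu, forall x n, setT x -> (`|(f_ n x)%:E| <= (EFin \o g) x)%E}.
  by apply: aeW => x n _; rewrite lee_fin.
have [if_ _ L] := @dominated_convergence _ _ _ mu setT measurableT _ _ (EFin \o g) h1 h2 h3 ig h4.
rewrite /Rintegral; apply: fine_cvg.
by rewrite fineK ?integrable_fin_num.
Qed.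

(** * The Fourier transform of the Gaussian *)

Let egauss : exp_decay (fun t : R => expR (- t ^+ 2)).
Proof.
have := exp_decay_gauss (@ltr01 R); apply: exp_decay_le => u.
by rewrite mul1r.
Qed.

Let mgauss : measurable_fun setT (fun t : R => expR (- t ^+ 2)).
Proof.
by apply: (measurableT_comp (@measurable_expR R)); apply: measurable_funN; exact: exprn_measurable.
Qed.

Let expR2 (t : R) : expR (- t ^+ 2) <= expR 1 * expR (- (1 * `|t|)) /\
  `|t| * expR (- t ^+ 2) <= expR 2 * expR (- (1 * `|t|)).
Proof.
have h1 : 0 <= (`|t| - 1) ^+ 2 by exact: sqr_ge0.
move: h1; rewrite sqrrB real_normK ?num_real// expr1n mulr1 => h1.
split; first by rewrite -expRD ler_expR; have := normr_ge0 t; lra.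
have h2 : `|t| <= expR (`|t|) by have := expR_ge1Dx `|t|; lra.
rewrite (le_trans (ler_wpM2r (expR_ge0 _) h2))// -!expRD ler_expR.
have : 0 <= (`|t| - 1) ^+ 2 by exact: sqr_ge0.
by lra.
Qed.

Lemma is_derive_gaussian_cos (u : R) :
  is_derive u 1 (fun u => Rintegral mu setT (fun t : R => expR (- t ^+ 2) * cos (u * t)))
    (- (u / 2) * Rintegral mu setT (fun t : R => expR (- t ^+ 2) * cos (u * t))).
Proof.
have mt (f : R -> R) : measurable_fun setT f -> measurable_fun setT (fun t : R => expR (- t ^+ 2) * f t).
  by move=> mf; exact: measurable_funM.
have mcos (v : R) : measurable_fun setT (fun t : R => cos (v * t)) by measurable_tac.
have msin (v : R) : measurable_fun setT (fun t : R => sin (v * t)) by measurable_tac.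
have ecos (f : R -> R) : (forall t, `|f t| <= 1) -> exp_decay (fun t : R => expR (- t ^+ 2) * f t).
  by move=> f1; apply: exp_decay_le egauss => t; rewrite normrM ler_piMr.
pose G (K t : R) := K * expR (- (1 * `|t|)).
have mG K : measurable_fun setT (G K) by rewrite /G; measurable_tac.
have eG K : exp_decay (G K).
  by apply: exp_decayZ; exists 1, 1; split => // t; rewrite !mul1r ger0_norm ?expR_ge0//.
have -> : - (u / 2) * Rintegral mu setT (fun t : R => expR (- t ^+ 2) * cos (u * t)) =
    Rintegral mu setT (fun t : R => - (t * expR (- t ^+ 2) * sin (u * t))).
  (* Integration by parts: the integral of the derivative of [expR (- t ^+ 2) * sin (u * t)]
     vanishes, which expresses the integral with the extra factor [t] through the original one. *)
  have Z : Rintegral mu setT (fun t : R => - 2 * (t * expR (- t ^+ 2) * sin (u * t)) + u * (expR (- t ^+ 2) * cos (u * t))) = 0.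
    apply: (@Rintegral_derive0 _ (fun t : R => expR (- t ^+ 2) * sin (u * t)) _
      (G (2 * (expR 2 * expR 1) + `|u| * (expR 1 * expR 1)))).
    - exact: mt.
    - by apply: ecos => t; exact: sin_max.
    - move=> t.
      have e1 : is_derive t (1 : R) (fun t : R => - t ^+ 2) (- (2 * t)).
        by apply: is_derive_eq; rewrite /GRing.scale /=; ring.
      have e2 : is_derive t (1 : R) (fun t : R => u * t) u.
        by apply: is_derive_eq; rewrite /GRing.scale /=; ring.
      have e3 := @is_derive1_comp _ (@expR R) _ t _ _ (is_derive_expR _) e1.
      have e4 := @is_derive1_comp _ (@sin R) _ t _ _ (is_derive_sin _) e2.
      have := is_deriveM e3 e4; set d := (X in is_derive _ _ _ X) => e5.
      have -> : - 2 * (t * expR (- t ^+ 2) * sin (u * t)) + u * (expR (- t ^+ 2) * cos (u * t)) = d.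
        by rewrite /d /GRing.scale /=; ring.
      exact: e5.
    - exact: mG.
    - exact: eG.
    - move=> x y x1; rewrite (le_trans (ler_normD _ _))// /G [leRHS]mulrDl.
      have [h1 h2] := expR2 (x + y).
      have h3 : expR (- (1 * `|x + y|)) <= expR 1 * expR (- (1 * `|y|)).
        rewrite -expRD ler_expR !mul1r.
        have : `|y| <= `|x + y| + `|x| by rewrite -{1}(addKr x y) addrC ler_normB.
        by lra.
      rewrite lerD//.
      + rewrite !normrM normrN (ger0_norm (expR_ge0 _)) normr_nat -!mulrA ler_wpM2l//.
        rewrite mulrA (le_trans (ler_piMr _ (sin_max _)))// ?mulr_ge0 ?expR_ge0//.
        by rewrite (le_trans h2)// ler_wpM2l ?expR_ge0.
      + rewrite !normrM (ger0_norm (expR_ge0 _)) -!mulrA ler_wpM2l//.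
        rewrite (le_trans (ler_piMr _ (cos_max _))) ?expR_ge0//.
        by rewrite (le_trans h1)// ler_wpM2l ?expR_ge0.
  have i1 : mu.-integrable setT (EFin \o (fun t : R => expR (- t ^+ 2) * cos (u * t))).
    by apply: exp_decay_integrable; [exact: mt|apply: ecos => t; exact: cos_max].
  have ms : measurable_fun setT (fun t : R => t * expR (- t ^+ 2) * sin (u * t)).
    by apply: measurable_funM => //; apply: measurable_funM.
  have i2 : mu.-integrable setT (EFin \o (fun t : R => t * expR (- t ^+ 2) * sin (u * t))).
    apply: exp_decay_integrable => //.
    apply: exp_decay_le (eG (expR 2)) => t; rewrite /G [leRHS]ger0_norm ?mulr_ge0 ?expR_ge0//.
    rewrite !normrM (ger0_norm (expR_ge0 _)) (le_trans (ler_piMr _ (sin_max _))) ?mulr_ge0 ?expR_ge0//.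
    by have [] := expR2 t.
  move: Z; rewrite RintegralD//; last 2 first.
  - by have := integrableZl measurableT (- 2) i2; apply: eq_integrable => // t _; rewrite /= EFinM.
  - by have := integrableZl measurableT u i1; apply: eq_integrable => // t _; rewrite /= EFinM.
  rewrite !RintegralZl// => Z.
  rewrite (_ : (fun t : R => - (t * expR (- t ^+ 2) * sin (u * t))) = (fun t : R => -1 * (t * expR (- t ^+ 2) * sin (u * t)))); last first.
    by apply/funext => t; rewrite mulN1r.
  rewrite RintegralZl//; lra.
apply: (@is_derive_under_integral _ (fun u t => expR (- t ^+ 2) * cos (u * t))
  (fun u t => - (t * expR (- t ^+ 2) * sin (u * t))) (G (expR 2)) u 1 ltr01).
- by move=> x _; exact: mt.
- by move=> x _; apply: ecos => t; exact: cos_max.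
- move=> x t _.
  have e2 : is_derive x (1 : R) (fun x : R => x * t) t.
    by apply: is_derive_eq; rewrite /GRing.scale /=; ring.
  have e4 := @is_derive1_comp _ (@cos R) _ x _ _ (is_derive_cos _) e2.
  have := is_deriveM (is_derive_cst (expR (- t ^+ 2)) x 1) e4; set d := (X in is_derive _ _ _ X) => e5.
  have -> : - (t * expR (- t ^+ 2) * sin (x * t)) = d.
    by rewrite /d /GRing.scale /=; ring.
  exact: e5.
- exact: mG.
- exact: eG.
- move=> x t _; rewrite /G normrN !normrM (ger0_norm (expR_ge0 _)).
  rewrite (le_trans (ler_piMr _ (sin_max _))) ?mulr_ge0 ?expR_ge0//.
  by have [] := expR2 t.
Qed.

(** The integral solves [K' = - (u / 2) * K], so [K u * expR (u ^+ 2 / 4)] is constant, equal to its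
    value at [0], the Gaussian integral. *)
Lemma gaussian_cos (u : R) :
  Rintegral mu setT (fun t : R => expR (- t ^+ 2) * cos (u * t)) = Num.sqrt pi * expR (- (u ^+ 2 / 4)).
Proof.
pose K u := Rintegral mu setT (fun t : R => expR (- t ^+ 2) * cos (u * t)).
have K0 : K 0 = Num.sqrt pi.
  rewrite /K /Rintegral -[RHS]/(fine (Num.sqrt pi)%:E) -integralT_gauss; congr fine.
  by apply: eq_integral => t _; rewrite mul0r cos0 mulr1.
have D (v : R) : is_derive v (1 : R) (fun v : R => K v * expR (v ^+ 2 / 4)) 0.
  have e1 : is_derive v (1 : R) (fun t : R => t ^+ 2 / 4) (v / 2).
    by apply: is_derive_eq; rewrite /GRing.scale /=; field.
  have e3 := @is_derive1_comp _ (@expR R) _ v _ _ (is_derive_expR _) e1.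
  have := is_deriveM (is_derive_gaussian_cos v) e3; set d := (X in is_derive _ _ _ X) => e5.
  have -> : 0 = d by rewrite /d /GRing.scale /= -/(K v); ring.
  exact: e5.
have H (a b : R) : a < b -> K b * expR (b ^+ 2 / 4) = K a * expR (a ^+ 2 / 4).
  by move=> ab; apply: (@is_derive0_const R (fun v => K v * expR (v ^+ 2 / 4))) => // x _; exact: D.
have E : K u * expR (u ^+ 2 / 4) = Num.sqrt pi.
  have E0 : K 0 * expR (0 ^+ 2 / 4) = Num.sqrt pi by rewrite expr0n mul0r expR0 mulr1.
  have [u0|u0|->//] := ltgtP u 0; first by rewrite -(H _ _ u0).
  by rewrite (H _ _ u0).
by rewrite -E -mulrA -expRD subrr expR0 mulr1.
Qed.

(** The integrand is odd: the substitution [t -> - t] equates the integral with its opposite. *)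
Lemma gaussian_sin (u : R) :
  Rintegral mu setT (fun t : R => expR (- t ^+ 2) * sin (u * t)) = 0.
Proof.
have ms : measurable_fun setT (fun t : R => expR (- t ^+ 2) * sin (u * t)).
  by apply: measurable_funM => //; measurable_tac.
have N10 : (-1 : R) != 0 by rewrite oppr_eq0 oner_eq0.
have := @Rintegral_affine R (-1) 0 _ N10 ms.
have i2 : mu.-integrable setT (EFin \o (fun t : R => expR (- t ^+ 2) * sin (u * t))).
  apply: exp_decay_integrable => //; apply: exp_decay_le egauss => t.
  by rewrite normrM ler_piMr// sin_max.
rewrite [X in Rintegral _ _ X = _ -> _](_ : _ = (fun t : R => -1 * (expR (- t ^+ 2) * sin (u * t)))); last first.
  by apply/funext => t; rewrite addr0 !mulN1r sqrrN mulrN sinN mulrN.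
rewrite RintegralZl// normrN normr1 invr1; lra.
Qed.

Lemma gaussian_cos_shift (e v k : R) : 0 < e ->
  Rintegral mu setT (fun t : R => expR (- (e * t) ^+ 2) * cos (t * v + k)) =
  cos k * (e^-1 * Num.sqrt pi * expR (- ((v / e) ^+ 2 / 4))).
Proof.
move=> e0.
have ic (u : R) : mu.-integrable setT (EFin \o (fun t : R => expR (- t ^+ 2) * cos (u * t))).
  apply: exp_decay_integrable; first by apply: measurable_funM => //; measurable_tac.
  by apply: exp_decay_le egauss => t; rewrite normrM ler_piMr// cos_max.
have is_ (u : R) : mu.-integrable setT (EFin \o (fun t : R => expR (- t ^+ 2) * sin (u * t))).
  apply: exp_decay_integrable; first by apply: measurable_funM => //; measurable_tac.
  by apply: exp_decay_le egauss => t; rewrite normrM ler_piMr// sin_max.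
have ms : measurable_fun setT (fun t : R => expR (- t ^+ 2) * cos (v / e * t + k)).
  by apply: measurable_funM => //; measurable_tac.
have := @Rintegral_affine R e 0 _ (lt0r_neq0 e0) ms.
rewrite [X in Rintegral _ _ X = _ -> _](_ : _ = (fun t : R => expR (- (e * t) ^+ 2) * cos (t * v + k))); last first.
  apply/funext => t; rewrite addr0; congr (_ * cos (_ + _)).
  by field; rewrite gt_eqF.
move=> ->; rewrite gtr0_norm//.
rewrite (_ : (fun t : R => _) = (fun t : R => cos k * (expR (- t ^+ 2) * cos (v / e * t)) - sin k * (expR (- t ^+ 2) * sin (v / e * t)))); last first.
  by apply/funext => t; rewrite cosD; ring.
rewrite RintegralB//; last 2 first.
- by have := integrableZl measurableT (cos k) (ic (v / e)); apply: eq_integrable => // t _; rewrite /= EFinM.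
- by have := integrableZl measurableT (sin k) (is_ (v / e)); apply: eq_integrable => // t _; rewrite /= EFinM.
rewrite !RintegralZl// gaussian_cos gaussian_sin; ring.
Qed.

(** The Gaussian in [t] makes the double integral absolutely convergent. Integrating over [t] first
    leaves [h] against a Gaussian of width proportional to [e], normalised by [v = 2 * e * w]. The
    phase survives only as [cos k], so the choice [k = pi / 2] gives zero. *)
Lemma fourier_regularised (h : R -> R) (e k : R) : 0 < e ->
  measurable_fun setT h -> exp_decay h ->
  Rintegral mu setT (fun t : R => expR (- (e * t) ^+ 2) *
    Rintegral mu setT (fun v : R => h v * cos (t * v + k))) =
  cos k * (2 * Num.sqrt pi * Rintegral mu setT (fun w : R => h (2 * e * w) * expR (- w ^+ 2))).
Proof.
move=> e0 mh eh.
have ih := exp_decay_integrable mh eh.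
have mge : measurable_fun setT (fun t : R => expR (- (e * t) ^+ 2)).
  apply: (measurableT_comp mgauss); exact: measurable_funM.
have ihc (t : R) : mu.-integrable setT (EFin \o (fun v : R => h v * cos (t * v + k))).
  apply: exp_decay_integrable; first by apply: measurable_funM => //; measurable_tac.
  by apply: exp_decay_le eh => v; rewrite normrM ler_piMr// cos_max.
pose F (t v : R) := expR (- (e * t) ^+ 2) * (h v * cos (t * v + k)).
have -> : Rintegral mu setT (fun t : R => expR (- (e * t) ^+ 2) *
    Rintegral mu setT (fun v : R => h v * cos (t * v + k))) =
  Rintegral mu setT (fun t : R => Rintegral mu setT (F t)).
  by apply: eq_Rintegral => t _; rewrite RintegralZl.
have eg2 : exp_decay (fun t : R => expR (- (e * t) ^+ 2)).
  have e20 : 0 < e ^+ 2 by rewrite exprn_gt0.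
  by apply: exp_decay_le (exp_decay_gauss e20) => t; rewrite exprMn.
have [C1 [d1 [C10 d10 H1]]] := eg2.
have [C2 [d2 [C20 d20 H2]]] := eh.
have dm0 : 0 < Num.min d1 d2 by rewrite lt_min d10.
rewrite (@Rintegral_swap F (C1 * C2) (Num.min d1 d2))//; first last.
- move=> t v; rewrite /F normrM normrM.
  have -> : C1 * C2 * expR (- (Num.min d1 d2 * `|t|)) * expR (- (Num.min d1 d2 * `|v|)) =
    (C1 * expR (- (Num.min d1 d2 * `|t|))) * (C2 * expR (- (Num.min d1 d2 * `|v|))) by ring.
  rewrite ler_pM//.
    rewrite (le_trans (H1 t))// ler_wpM2l// ler_expR lerN2 ler_wpM2r//.
    by rewrite ge_min lexx.
  rewrite (le_trans (ler_piMr _ (cos_max _)))// (le_trans (H2 v))// ler_wpM2l// ler_expR lerN2 ler_wpM2r//.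
  by rewrite ge_min lexx orbT.
- have mf1 : measurable_fun setT (fun z : R * R => z.1) by exact: measurable_fst.
  have mf2 : measurable_fun setT (fun z : R * R => z.2) by exact: measurable_snd.
  apply: measurable_funM; first exact: (measurableT_comp mge mf1).
  apply: measurable_funM; first exact: (measurableT_comp mh mf2).
  apply: (measurableT_comp (continuous_measurable_fun (@continuous_cos _))).
  by apply: measurable_funD => //; apply: measurable_funM.
have icg (v : R) : mu.-integrable setT (EFin \o (fun t : R => expR (- (e * t) ^+ 2) * cos (t * v + k))).
  apply: exp_decay_integrable; first by apply: measurable_funM => //; measurable_tac.
  by apply: exp_decay_le eg2 => t; rewrite normrM ler_piMr// cos_max.
pose c := cos k * (e^-1 * Num.sqrt pi).
pose g (v : R) := h v * expR (- ((v / e) ^+ 2 / 4)).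
have mg : measurable_fun setT g.
  apply: measurable_funM => //; apply: (measurableT_comp (@measurable_expR R)).
  apply: measurable_funN; apply: measurable_funM => //.
  by apply: (measurableT_comp (@exprn_measurable R setT 2)); exact: measurable_funM.
have eg : exp_decay g.
  apply: exp_decay_le eh => v; rewrite normrM ler_piMr// ger0_norm ?expR_ge0//.
  by rewrite -expR0 ler_expR oppr_le0 divr_ge0// sqr_ge0.
rewrite (_ : (fun v => Rintegral mu setT _) = (fun v : R => c * g v)); last first.
  apply/funext => v.
  rewrite (_ : F^~ v = (fun t : R => h v * (expR (- (e * t) ^+ 2) * cos (t * v + k)))); last first.
    by apply/funext => t; rewrite /F; ring.
  by rewrite RintegralZl// gaussian_cos_shift// /c /g; ring.
rewrite RintegralZl//; last exact: exp_decay_integrable.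
have e20 : 2 * e != 0 by rewrite mulf_neq0 ?gt_eqF.
have := @Rintegral_affine R (2 * e) 0 g e20 mg.
rewrite [X in Rintegral _ _ X = _ -> _](_ : _ = (fun w : R => h (2 * e * w) * expR (- w ^+ 2))); last first.
  apply/funext => w; rewrite addr0 /g; congr (_ * expR _).
  by field; rewrite gt_eqF.
move=> ->; rewrite gtr0_norm ?mulr_gt0// /c.
by field; rewrite gt_eqF.
Qed.

(** [H] is the real part of the Fourier integral of [h1 + i h2], so its total integral only sees
    [h1 0]. Working at the single point [0] is enough, because translations and phases are built
    into the functions to which this is applied. *)
Theorem fourier_inversion_at0 (h1 h2 H : R -> R) :
  measurable_fun setT h1 -> exp_decay h1 -> continuous h1 ->
  measurable_fun setT h2 -> exp_decay h2 -> continuous h2 ->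
  measurable_fun setT H -> exp_decay H ->
  (forall t : R, H t = Rintegral mu setT (fun v : R => h1 v * cos (t * v) - h2 v * sin (t * v))) ->
  Rintegral mu setT H = 2 * pi * h1 0.
Proof.
move=> mh1 eh1 ch1 mh2 eh2 ch2 mH eH HE.
pose e (n : nat) : R := n.+1%:R^-1.
have e0 n : 0 < e n by rewrite /e invr_gt0.
have ecvg : e n @[n --> \oo] --> (0 : R) by exact: cvg_harmonic.
have et (t : R) : e n * t @[n --> \oo] --> (0 : R).
  by rewrite -[X in _ --> X](mul0r t); apply: cvgM => //; exact: cvg_cst.
(* The inserted Gaussian tends to [1] pointwise and is at most [1], so [|H|] dominates. *)
have L1 : Rintegral mu setT (fun t : R => expR (- (e n * t) ^+ 2) * H t) @[n --> \oo] --> Rintegral mu setT H.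
  have mge n : measurable_fun setT (fun t : R => expR (- (e n * t) ^+ 2)).
    apply: (measurableT_comp mgauss); exact: measurable_funM.
  apply: (@cvg_Rintegral_dominated _ _ (fun t => `|H t|)) => //.
  - by move=> n; exact: measurable_funM.
  - move=> t; rewrite -[X in _ --> X]mul1r; apply: cvgM; last exact: cvg_cst.
    have E0 : 1 = expR (- (0 : R) ^+ 2) by rewrite expr0n oppr0 expR0.
    rewrite E0; apply: (@cvg_comp _ _ _ (fun n => - (e n * t) ^+ 2) expR); last exact: continuous_expR.
    by apply: cvgN; rewrite expr2; under eq_fun do rewrite expr2; apply: cvgM; exact: et.
  - exact: measurableT_comp.
  - by apply: exp_decay_le eH => t; rewrite normr_id.
  - move=> n t; rewrite normrM ler_piMl// ger0_norm ?expR_ge0//.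
    by rewrite -expR0 ler_expR oppr_le0 sqr_ge0.
(* By continuity [h1 (2 * e n * w)] tends to [h1 0], and the remaining Gaussian integral supplies
   the second factor [Num.sqrt pi]. *)
have L2 : 2 * Num.sqrt pi * Rintegral mu setT (fun w : R => h1 (2 * e n * w) * expR (- w ^+ 2)) @[n --> \oo] --> 2 * pi * h1 0.
  have -> : 2 * pi * h1 0 = 2 * Num.sqrt pi * Rintegral mu setT (fun w : R => h1 0 * expR (- w ^+ 2)).
    have ig := exp_decay_integrable mgauss egauss.
    rewrite RintegralZl//.
    have := gaussian_cos 0; rewrite expr0n mul0r oppr0 expR0 mulr1.
    rewrite (_ : (fun t : R => expR (- t ^+ 2) * cos (0 * t)) = (fun t : R => expR (- t ^+ 2))); last first.
      by apply/funext => t; rewrite mul0r cos0 mulr1.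
    move=> ->; rewrite -[pi in LHS]sqr_sqrtr ?pi_ge0//; ring.
  apply: cvgM; first exact: cvg_cst.
  have [C [d [C0 d0 HC]]] := eh1.
  apply: (@cvg_Rintegral_dominated _ _ (fun w : R => C * expR (- w ^+ 2))) => //.
  - move=> n; apply: measurable_funM => //.
    by apply: (measurableT_comp mh1); exact: measurable_funM.
  - exact: measurable_funM.
  - move=> w; apply: cvgM; last exact: cvg_cst.
    apply: (@cvg_comp _ _ _ (fun n => 2 * e n * w) h1); last exact: ch1.
    have : 2 * (e n * w) @[n --> \oo] --> (2 * 0 : R).
      by apply: cvgM; [exact: cvg_cst|exact: et].
    by rewrite mulr0; under eq_fun do rewrite mulrA.
  - exact: measurable_funM.
  - exact: exp_decayZ.
  - move=> n w; rewrite normrM (ger0_norm (expR_ge0 _)) ler_wpM2r ?expR_ge0//.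
    rewrite (le_trans (HC _))// ler_piMr// -expR0 ler_expR oppr_le0 mulr_ge0//.
    exact: ltW.
apply: (cvg_unique (@norm_hausdorff _ _) L1); rewrite (_ : (fun n => _) =
  (fun n => 2 * Num.sqrt pi * Rintegral mu setT (fun w : R => h1 (2 * e n * w) * expR (- w ^+ 2)))) //.
apply/funext => n.
have R1 := @fourier_regularised h1 (e n) 0 (e0 n) mh1 eh1.
have R2 := @fourier_regularised h2 (e n) (pi / 2) (e0 n) mh2 eh2.
have i1 (t k : R) : mu.-integrable setT (EFin \o (fun v : R => h1 v * cos (t * v + k))).
  apply: exp_decay_integrable; first by apply: measurable_funM => //; measurable_tac.
  by apply: exp_decay_le eh1 => v; rewrite normrM ler_piMr// cos_max.
have i2 (t k : R) : mu.-integrable setT (EFin \o (fun v : R => h2 v * cos (t * v + k))).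
  apply: exp_decay_integrable; first by apply: measurable_funM => //; measurable_tac.
  by apply: exp_decay_le eh2 => v; rewrite normrM ler_piMr// cos_max.
have ig (h : R -> R) (k : R) : measurable_fun setT h -> exp_decay h ->
    mu.-integrable setT (EFin \o (fun t : R => expR (- (e n * t) ^+ 2) * Rintegral mu setT (fun v : R => h v * cos (t * v + k)))).
  move=> mh eh; apply: exp_decay_integrable.
    apply: measurable_funM.
      by apply: (measurableT_comp mgauss); exact: measurable_funM.
    apply: (@measurable_Rintegral_param _ _ (fun t v : R => h v * cos (t * v + k))).
    apply: measurable_funM; first by apply: (measurableT_comp mh); exact: measurable_snd.
    apply: (measurableT_comp (continuous_measurable_fun (@continuous_cos _))).
    apply: measurable_funD => //; apply: measurable_funM; [exact: measurable_fst|exact: measurable_snd].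
  have e20 : 0 < e n ^+ 2 by rewrite exprn_gt0.
  pose K := Rintegral mu setT (fun v : R => `|h v|).
  apply: exp_decay_le (exp_decayZ K (exp_decay_gauss e20)) => t.
  rewrite !normrM mulrC exprMn ler_wpM2r// (le_trans _ (ler_norm _))//.
  have ihc : mu.-integrable setT (EFin \o (fun v : R => h v * cos (t * v + k))).
    apply: exp_decay_integrable; first by apply: measurable_funM => //; measurable_tac.
    by apply: exp_decay_le eh => v; rewrite normrM ler_piMr// cos_max.
  rewrite (le_trans (le_normr_Rintegral _ ihc))// /K.
  apply: le_Rintegral => //.
  - by have := integrable_norm ihc.
  - by have := integrable_norm (exp_decay_integrable mh eh).
  - by move=> v _; rewrite /= normrM ler_piMr// cos_max.
(* The term [- sin (t * v)] is [cos (t * v + pi / 2)], so its regularised integral carries the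
   factor [cos (pi / 2) = 0]. *)
transitivity (Rintegral mu setT (fun t : R => expR (- (e n * t) ^+ 2) * Rintegral mu setT (fun v : R => h1 v * cos (t * v + 0)))
  + Rintegral mu setT (fun t : R => expR (- (e n * t) ^+ 2) * Rintegral mu setT (fun v : R => h2 v * cos (t * v + pi / 2)))).
  rewrite -RintegralD//; last 2 first.
  - exact: ig.
  - exact: ig.
  apply: eq_Rintegral => t _; rewrite HE -mulrDr; congr (_ * _).
  rewrite -RintegralD//.
  by apply: eq_Rintegral => v _; rewrite addr0 cosDpihalf mulrN.
by rewrite R1 R2 cos0 cos_pihalf mul1r mul0r addr0.
Qed.

End FourierInversion.

Local Open Scope complex_scope.

(** * Complex exponentials, powers and the Gamma function *)

Section ComplexExp.
Variable R : realType.
Notation C := R[i].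
Notation Re := (@complex.Re R).
Notation Im := (@complex.Im R).
Implicit Types z w : C.

Lemma complex_eq z w : Re z = Re w -> Im z = Im w -> z = w.
Proof. by case: z w => a b [c d] /= -> ->. Qed.

Lemma cReD z w : Re (z + w) = Re z + Re w. Proof. by case: z w => ? ? []. Qed.
Lemma cImD z w : Im (z + w) = Im z + Im w. Proof. by case: z w => ? ? []. Qed.
Lemma cReN z : Re (- z) = - Re z. Proof. by case: z. Qed.
Lemma cImN z : Im (- z) = - Im z. Proof. by case: z. Qed.
Lemma cReM z w : Re (z * w) = Re z * Re w - Im z * Im w. Proof. by case: z w => ? ? []. Qed.
Lemma cImM z w : Im (z * w) = Re z * Im w + Im z * Re w. Proof. by case: z w => ? ? []. Qed.

Lemma cReMr z (x : R) : Re (z * x%:C) = Re z * x.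
Proof. by rewrite cReM /= mulr0 subr0. Qed.
Lemma cImMr z (x : R) : Im (z * x%:C) = Im z * x.
Proof. by rewrite cImM /= mulr0 add0r. Qed.

Lemma cRe_sum I (r : seq I) (P : pred I) (F : I -> C) :
  Re (\sum_(i <- r | P i) F i) = \sum_(i <- r | P i) Re (F i).
Proof. by apply: (big_morph Re cReD). Qed.
Lemma cIm_sum I (r : seq I) (P : pred I) (F : I -> C) :
  Im (\sum_(i <- r | P i) F i) = \sum_(i <- r | P i) Im (F i).
Proof. by apply: (big_morph Im cImD). Qed.

Definition cReE := (cReD, cReN, cReM, cImD, cImN, cImM).

Lemma cexpD z w : cexp (z + w) = cexp z * cexp w.
Proof.
by case: z w => a b [c d]; apply: complex_eq; rewrite /cexp /= expRD ?cosD ?sinD; ring.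
Qed.

Lemma cexp0 : cexp (0 : C) = 1.
Proof. by apply: complex_eq; rewrite /cexp /= expR0 ?cos0 ?sin0 ?mulr1 ?mulr0. Qed.

Lemma cexp_sum I (r : seq I) (P : pred I) (F : I -> C) :
  cexp (\sum_(i <- r | P i) F i) = \prod_(i <- r | P i) cexp (F i).
Proof. exact: (big_morph (@cexp R) cexpD cexp0). Qed.

Lemma cexp_real (x : R) : cexp x%:C = (expR x)%:C.
Proof. by apply: complex_eq; rewrite /cexp /= ?cos0 ?sin0 ?mulr1 ?mulr0. Qed.

Lemma cabsM z w : cabs (z * w) = cabs z * cabs w.
Proof.
rewrite /cabs -sqrtrM ?addr_ge0 ?sqr_ge0// !cReE; congr Num.sqrt; ring.
Qed.

Lemma cabs_ge0 z : 0 <= cabs z. Proof. exact: sqrtr_ge0. Qed.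

Lemma cabs1 : cabs (1 : C) = 1.
Proof. by rewrite /cabs /= expr0n addr0 expr1n sqrtr1. Qed.

Lemma cabs_prod I (r : seq I) (P : pred I) (F : I -> C) :
  cabs (\prod_(i <- r | P i) F i) = \prod_(i <- r | P i) cabs (F i).
Proof. exact: (big_morph (@cabs R) cabsM cabs1). Qed.

Lemma cabs_cexp z : cabs (cexp z) = expR (Re z).
Proof.
rewrite /cabs /cexp /= !exprMn -mulrDr cos2Dsin2 mulr1 sqrtr_sqr ger0_norm// expR_ge0.
Qed.

Lemma normRe_le_cabs z : `|Re z| <= cabs z.
Proof. by rewrite -sqrtr_sqr ler_wsqrtr// lerDl sqr_ge0. Qed.
Lemma normIm_le_cabs z : `|Im z| <= cabs z.
Proof. by rewrite -sqrtr_sqr ler_wsqrtr// lerDr sqr_ge0. Qed.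

Lemma cabs_le_ReIm z : cabs z <= `|Re z| + `|Im z|.
Proof.
rewrite -(ler_pXn2r (n := 2)) ?nnegrE ?sqrtr_ge0 ?addr_ge0//.
rewrite sqr_sqrtr ?addr_ge0 ?sqr_ge0// sqrrD !real_normK ?num_real//.
by rewrite lerD2r lerDl mulrn_wge0// mulr_ge0.
Qed.

Lemma carg_lt_pihalf z : 0 < Re z -> `|carg z| < pi / 2.
Proof. by move=> z0; rewrite /carg z0 ltr_norml atan_gtNpi2 atan_ltpi2. Qed.

Lemma cabs_gt0 z : 0 < Re z -> 0 < cabs z.
Proof. by move=> z0; rewrite (lt_le_trans _ (normRe_le_cabs z))// gtr0_norm. Qed.

Lemma polar_Re z : 0 < Re z -> Re z = cabs z * cos (carg z).
Proof.
move=> z0; rewrite /carg z0 cos_atan.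
have E : cabs z = Re z * Num.sqrt (1 + (Im z / Re z) ^+ 2).
  rewrite -{1}(ger0_norm (ltW z0)) -sqrtr_sqr -sqrtrM ?sqr_ge0// /cabs; congr Num.sqrt.
  by field; rewrite gt_eqF.
rewrite E mulfK// gt_eqF// sqrtr_gt0.
by rewrite ltr_pwDl// sqr_ge0.
Qed.

Lemma polar_Im z : 0 < Re z -> Im z = cabs z * sin (carg z).
Proof.
move=> z0; have c0 : cos (carg z) != 0.
  by rewrite gt_eqF// pihalf_norm// carg_lt_pihalf.
have t : tan (carg z) = Im z / Re z by rewrite /carg z0 atanK.
have -> : sin (carg z) = tan (carg z) * cos (carg z) by rewrite /tan divfK.
by rewrite t mulrCA -polar_Re// divfK// gt_eqF.
Qed.

Lemma cpowE z w : 0 < Re z -> cpow z w = cexp (w * Complex (ln (cabs z)) (carg z)).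
Proof.
move=> z0; rewrite /cpow ifF//; apply/eqP => z00.
by move: z0; rewrite z00 ltxx.
Qed.

Lemma cpow_real (x : R) w : 0 < x -> cpow x%:C w = cexp (w * (ln x)%:C).
Proof.
move=> x0; rewrite cpowE//; congr (cexp (_ * _)).
apply: complex_eq; rewrite /= ?/carg /= ?x0 ?mul0r ?atan0//.
by rewrite /cabs /= expr0n addr0 sqrtr_sqr gtr0_norm.
Qed.

End ComplexExp.

(** * Gamma as a Mellin transform, its decay on vertical lines, and Mellin inversion *)

Section GammaMellin.
Variable R : realType.
Notation mu := (@lebesgue_measure R).
Notation C := R[i].
Notation Re := (@complex.Re R).
Notation Im := (@complex.Im R).

(** For [0 < p], the real part of [e^(ik) Gamma(p + iq)], from the Gamma integral in the coordinate
    [v = ln x]; the phase [- (pi / 2)] yields the imaginary part of [Gamma]. *)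
Definition gamI (p q k : R) : R :=
  Rintegral mu setT (fun v : R => expR (p * v - expR v) * cos (q * v + k)).

Lemma gamI_rot0 p q k : gamI p q k = Rintegral mu setT (rotW p q k 0).
Proof.
apply: eq_Rintegral => v _.
by rewrite /rotW cos0 sin0 mulr1 !mulr0 !subr0 addr0.
Qed.

Lemma gamI_shift p q k : 0 < p ->
  gamI p q k = cos k * gamI p q 0 - sin k * gamI p q (- (pi / 2)).
Proof.
move=> p0.
have i1 (k' : R) : mu.-integrable setT (EFin \o (fun v : R => expR (p * v - expR v) * cos (q * v + k'))).
  apply: exp_decay_integrable; first by measurable_tac.
  apply: exp_decay_le (exp_decay_exp_sub_exp p0 (@ltr01 R)) => u.
  by rewrite mul1r normrM ler_piMr// cos_max.
rewrite /gamI -!RintegralZl// -RintegralB//; last 2 first.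
- by have := integrableZl measurableT (cos k) (i1 0); apply: eq_integrable => // t _; rewrite /= EFinM.
- by have := integrableZl measurableT (sin k) (i1 (- (pi / 2))); apply: eq_integrable => // t _; rewrite /= EFinM.
by apply: eq_Rintegral => v _; rewrite addr0 cosBpihalf cosD; ring.
Qed.

(** Real form of the identity that the integral of [exp (s v - w e^v)] is [Gamma(s) w^(-s)], for
    [s = p + iq] and [w = r e^(it)]: translating by [ln r] removes the modulus of [w], rotating by
    [t] removes its argument. *)
Lemma Rintegral_rotated_gamma (p q k r t : R) : 0 < p -> 0 < r -> `|t| < pi / 2 ->
  Rintegral mu setT (fun v : R => expR (p * v - expR v * (r * cos t)) * cos (q * v - expR v * (r * sin t) + k)) =
  expR (- (p * ln r) + q * t) * gamI p q (k - q * ln r - p * t).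
Proof.
move=> p0 r0 t2; have ct := pihalf_norm t2.
set h := (fun v : R => _).
have mh : measurable_fun setT h by rewrite /h; measurable_tac.
rewrite -(Rintegral_translation (- ln r) mh) gamI_rot0 -(@Rintegral_rotW R p q p0 _ t t2).
rewrite -RintegralZl//; last first.
  by apply: exp_decay_integrable; [exact: measurable_rotW|exact: exp_decay_rotW].
apply: eq_Rintegral => v _; rewrite /h /rotW.
have -> : expR (v - ln r) = expR v / r by rewrite expRD expRN lnK.
rewrite [RHS]mulrA -expRD; congr (expR _ * cos _); field; rewrite gt_eqF//.
Qed.

Lemma cGammaE (s : C) : 0 < Re s ->
  cGamma s = Complex (gamI (Re s) (Im s) 0) (gamI (Re s) (Im s) (- (pi / 2))).
Proof.
move=> s0; rewrite /cGamma /Cint.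
(* [F] is [Re] with [k = 0] or [Im] with [k = - (pi / 2)]. *)
have H (k : R) (F : C -> R) : (forall a b : R, F (cexp (Complex a b)) = expR a * cos (b + k)) ->
   Rintegral mu `]0, +oo[ (fun x => F (cpow x%:C (s - 1) * cexp (- x%:C))) = gamI (Re s) (Im s) k.
  move=> HF.
  pose f (x : R) := expR ((Re s - 1) * ln x - x) * cos (Im s * ln x + k).
  have mf : measurable_fun setT f.
    apply: measurable_funM.
      apply: (measurableT_comp (@measurable_expR R)); apply: measurable_funB => //.
      by apply: measurable_funM => //; exact: measurable_ln.
    apply: (measurableT_comp (continuous_measurable_fun (@continuous_cos _))).
    by apply: measurable_funD => //; apply: measurable_funM => //; exact: measurable_ln.
  transitivity (Rintegral mu `]0, +oo[ f).
    apply: eq_Rintegral => x; rewrite inE /= in_itv /= andbT => x0.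
    rewrite cpow_real// -cexpD.
    rewrite (_ : _ - x%:C = Complex ((Re s - 1) * ln x - x) (Im s * ln x)) ?HF//.
    by apply: complex_eq; rewrite !cReE /=; ring.
  rewrite Rintegral_pos_expR//; apply: eq_Rintegral => u _.
  rewrite /f expRK mulrAC -expRD; congr (expR _ * _); ring.
rewrite (H 0 Re) => [|a b]; last by rewrite addr0.
rewrite (H (- (pi / 2)) Im) => [//|a b].
by rewrite cosBpihalf.
Qed.

(* [Cint v |-> exp (s v - z e^v)] is the Mellin transform of [exp (- z x)] in the coordinate [v = ln x] *)
Lemma Cint_exp_sub_polar (s : C) (r t : R) : 0 < Re s -> 0 < r -> `|t| < pi / 2 ->
  Cint setT (fun v : R => cexp (s * v%:C - Complex (r * cos t) (r * sin t) * (expR v)%:C)) =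
  cGamma s * cexp (- s * Complex (ln r) t).
Proof.
move=> s0 r0 t2; rewrite cGammaE// /Cint.
have E (v : R) : cexp (s * v%:C - Complex (r * cos t) (r * sin t) * (expR v)%:C) =
    Complex (expR (Re s * v - expR v * (r * cos t)) * cos (Im s * v - expR v * (r * sin t) + 0))
     (expR (Re s * v - expR v * (r * cos t)) * cos (Im s * v - expR v * (r * sin t) + - (pi / 2))).
  rewrite addr0 cosBpihalf /cexp !cReE /=.
  by apply: complex_eq => /=; rewrite !(mulr0, subr0, add0r) ![expR v * _]mulrC.
under eq_Rintegral do rewrite E /=.
under [X in Complex _ X]eq_Rintegral do rewrite E /=.
rewrite !Rintegral_rotated_gamma//.
have k1 := gamI_shift (Im s) (0 - Im s * ln r - Re s * t) s0.
have k2 := gamI_shift (Im s) (- (pi / 2) - Im s * ln r - Re s * t) s0.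
have e1 : - (pi / 2) - Im s * ln r - Re s * t = (0 - Im s * ln r - Re s * t) - pi / 2 by ring.
rewrite k1 k2 e1 cosBpihalf sinBpihalf.
set c := (0 - Im s * ln r - Re s * t).
have e2 : Re (- s * Complex (ln r) t) = - (Re s * ln r) + Im s * t by rewrite !cReE /=; ring.
have e3 : Im (- s * Complex (ln r) t) = c by rewrite !cReE /= /c; ring.
by apply: complex_eq; rewrite !cReE /cexp /= -?/(Re _) e2 e3; ring.
Qed.

Theorem Cint_exp_sub (s z : C) : 0 < Re s -> 0 < Re z ->
  Cint setT (fun v : R => cexp (s * v%:C - z * (expR v)%:C)) = cGamma s * cpow z (- s).
Proof.
move=> s0 z0; rewrite cpowE// -(Cint_exp_sub_polar s0 (cabs_gt0 z0) (carg_lt_pihalf z0)).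
by rewrite -polar_Re// -polar_Im//; case: z z0.
Qed.

(** Rotating the Gamma integral by an angle [t] or [- t] extracts the factor [expR (- (t * |x|))].
    The rotated integral is bounded by [J], which does not depend on [x], and the factor [2]
    accounts for the real and imaginary parts. *)
Lemma cGamma_decay (c t : R) : 0 < c -> 0 <= t -> t < pi / 2 ->
  exists2 K, 0 <= K & forall x : R, cabs (cGamma (Complex c x)) <= K * expR (- (t * `|x|)).
Proof.
move=> c0 t0 t2.
have tn : `|t| < pi / 2 by rewrite ger0_norm.
have ct := pihalf_norm tn.
pose J := Rintegral mu setT (fun v : R => expR (c * v - cos t * expR v)).
have iJ : mu.-integrable setT (EFin \o (fun v : R => expR (c * v - cos t * expR v))).
  by apply: exp_decay_integrable; [measurable_tac|exact: exp_decay_exp_sub_exp].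
have J0 : 0 <= J by apply: Rintegral_ge0 => v _; exact: expR_ge0.
have B (x k t' : R) : t' = t \/ t' = - t ->
  `|Rintegral mu setT (fun v : R => expR (c * v - expR v * (1 * cos t')) * cos (x * v - expR v * (1 * sin t') + k))| <= J.
  move=> tt'.
  have ct' : cos t' = cos t by case: tt' => ->; rewrite ?cosN.
  have iw : mu.-integrable setT (EFin \o (fun v : R => expR (c * v - expR v * (1 * cos t')) * cos (x * v - expR v * (1 * sin t') + k))).
    apply: exp_decay_integrable; first by measurable_tac.
    apply: exp_decay_le (exp_decay_exp_sub_exp c0 ct) => u.
    by rewrite mul1r ct' [expR u * _]mulrC normrM ler_piMr// cos_max.
  rewrite (le_trans (le_normr_Rintegral _ iw))// /J.
  apply: le_Rintegral => //; first by have := integrable_norm iw.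
  move=> v _; rewrite /= mul1r ct' [expR v * cos t]mulrC normrM (ger0_norm (expR_ge0 _)).
  by rewrite ler_piMr ?expR_ge0// cos_max.
exists (2 * J) => [|x]; first by rewrite mulr_ge0.
(* The direction of rotation follows the sign of [x], so that [x * t'] is always [t * |x|]. *)
pose t' := if 0 <= x then t else - t.
have tt' : t' = t \/ t' = - t by rewrite /t'; case: ifP; [left|right].
have xt : x * t' = t * `|x|.
  rewrite /t'; case: ifPn => [x0|]; first by rewrite ger0_norm// mulrC.
  by rewrite -ltNge => x0; rewrite ltr0_norm// !mulrN mulrC.
have tn' : `|t'| < pi / 2 by case: tt' => ->; rewrite ?normrN.
have E k : gamI c x k = expR (- (t * `|x|)) *
  Rintegral mu setT (fun v : R => expR (c * v - expR v * (1 * cos t')) * cos (x * v - expR v * (1 * sin t') + (k + c * t'))).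
  rewrite Rintegral_rotated_gamma// ln1 !mulr0 oppr0 add0r addr0 addrK xt.
  by rewrite mulrA -expRD addNr expR0 mul1r.
rewrite (le_trans (cabs_le_ReIm _))// cGammaE//= !E !normrM ger0_norm ?expR_ge0//.
have b1 := B x (0 + c * t') t' tt'.
have b2 := B x (- (pi / 2) + c * t') t' tt'.
rewrite -mulrDr mulrC ler_wpM2r ?expR_ge0//.
by apply: (le_trans (lerD b1 b2)); rewrite -mulr2n mulr_natl.
Qed.

Lemma cGamma_cpow_decay (c : R) (z : C) : 0 < c -> 0 < Re z ->
  exp_decay (fun x : R => cabs (cGamma (Complex c x) * cpow z (- Complex c x))).
Proof.
move=> c0 z0; have a2 := carg_lt_pihalf z0.
(* The midpoint between [|carg z|] and [pi / 2]: the power grows at most like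
   [expR (|carg z| * |x|)], so the rate [t - |carg z| > 0] is left. *)
pose t := (`|carg z| + pi / 2) / 2.
have ta : `|carg z| < t by rewrite /t; lra.
have t2 : t < pi / 2 by rewrite /t; lra.
have t0 : 0 <= t by rewrite (le_trans _ (ltW ta)).
clearbody t; have [K K0 HK] := cGamma_decay c0 t0 t2.
exists (K * expR (- (c * ln (cabs z)))), (t - `|carg z|); split.
- by rewrite mulr_ge0 ?expR_ge0.
- by rewrite subr_gt0.
move=> x; rewrite ger0_norm ?cabs_ge0// cabsM cpowE// cabs_cexp.
have -> : Re (- Complex c x * Complex (ln (cabs z)) (carg z)) = - (c * ln (cabs z)) + x * carg z.
  by rewrite !cReE /=; ring.
rewrite (le_trans (ler_wpM2r (expR_ge0 _) (HK x)))//.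
rewrite -!mulrA ler_wpM2l// -!expRD ler_expR.
have : x * carg z <= `|carg z| * `|x| by rewrite mulrC -normrM ler_norm.
rewrite [(t - _) * _]mulrBl; lra.
Qed.

Lemma measurable_gamI (c k : R) : measurable_fun setT (fun x : R => gamI c x k).
Proof.
apply: (@measurable_Rintegral_param _ _ _ (fun x v : R => expR (c * v - expR v) * cos (x * v + k))).
have m1 : measurable_fun setT (fun z : R * R => z.1) by exact: measurable_fst.
have m2 : measurable_fun setT (fun z : R * R => z.2) by exact: measurable_snd.
apply: measurable_funM; apply: measurableT_comp => //.
- apply: measurable_funB; first exact: measurable_funM.
  exact: (measurableT_comp (@measurable_expR R)).
- exact: (continuous_measurable_fun (@continuous_cos _)).
- by apply: measurable_funD => //; exact: measurable_funM.
Qed.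

Lemma measurable_cGamma_cpow (c : R) (z : C) : 0 < c -> 0 < Re z ->
  measurable_fun setT (fun x : R => Re (cGamma (Complex c x) * cpow z (- Complex c x))) /\
  measurable_fun setT (fun x : R => Im (cGamma (Complex c x) * cpow z (- Complex c x))).
Proof.
move=> c0 z0; have mg := measurable_gamI c.
have H1 (x : R) : Re (cGamma (Complex c x) * cpow z (- Complex c x)) =
   gamI c x 0 * (expR (- (c * ln (cabs z)) + x * carg z) * cos (- (x * ln (cabs z)) - c * carg z))
   - gamI c x (- (pi / 2)) * (expR (- (c * ln (cabs z)) + x * carg z) * sin (- (x * ln (cabs z)) - c * carg z)).
  rewrite cGammaE// cpowE// cReM /cexp !cReE /=; congr (_ * (expR _ * cos _) - _ * (expR _ * sin _)); ring.
have H2 (x : R) : Im (cGamma (Complex c x) * cpow z (- Complex c x)) =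
   gamI c x 0 * (expR (- (c * ln (cabs z)) + x * carg z) * sin (- (x * ln (cabs z)) - c * carg z))
   + gamI c x (- (pi / 2)) * (expR (- (c * ln (cabs z)) + x * carg z) * cos (- (x * ln (cabs z)) - c * carg z)).
  rewrite cGammaE// cpowE// cImM /cexp !cReE /=; congr (_ * (expR _ * sin _) + _ * (expR _ * cos _)); ring.
by split; [under eq_fun do rewrite H1; apply: measurable_funB|under eq_fun do rewrite H2; apply: measurable_funD];
  apply: measurable_funM; rewrite ?mg//; measurable_tac.
Qed.

(* Mellin-Barnes: Mellin inversion of the Gamma function on the line [Re = c] *)
Theorem Cint_gamma_cpow (c : R) (z : C) : 0 < c -> 0 < Re z ->
  Cint setT (fun x : R => cGamma (Complex c x) * cpow z (- Complex c x)) = (2 * pi)%:C * cexp (- z).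
Proof.
move=> c0 z0.
(* The real part of [e^(ik) exp (c v - z e^v)]. The Fourier integral of [exp (c v - z e^v)] at [x]
   is [Gamma(c + ix) z^(- c - ix)], and its value at [v = 0] is [exp (- z)]. *)
pose h (k v : R) := expR (c * v - Re z * expR v) * cos (- (Im z * expR v) + k).
have mh k : measurable_fun setT (h k) by rewrite /h; measurable_tac.
have ch k : continuous (h k).
  move=> v; apply: cvgM; apply: continuous_comp; try exact: continuous_expR; try exact: continuous_cos.
    apply: cvgB; first by apply: cvgM; [exact: cvg_cst|exact: cvg_id].
    by apply: cvgM; [exact: cvg_cst|exact: continuous_expR].
  apply: cvgD; last exact: cvg_cst.
  by apply: cvgN; apply: cvgM; [exact: cvg_cst|exact: continuous_expR].
have eh k : exp_decay (h k).
  apply: exp_decay_le (exp_decay_exp_sub_exp c0 z0) => u.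
  by rewrite normrM ler_piMr// cos_max.
have E (x : R) := Cint_exp_sub (s := Complex c x) c0 z0.
have dec := cGamma_cpow_decay c0 z0.
have [m1 m2] := measurable_cGamma_cpow c0 z0.
(* Inversion is used with [h k] and [h (k - pi / 2)], the real and imaginary parts of the same
   function; [k = 0] and [k = - (pi / 2)] then give the two components of the claim. *)
have KK (k : R) (H : R -> R) : measurable_fun setT H -> exp_decay H ->
  (forall x : R, H x = Rintegral mu setT (fun v : R => expR (c * v - Re z * expR v) * cos (x * v - Im z * expR v + k))) ->
  Rintegral mu setT H = 2 * pi * (expR (- Re z) * cos (- Im z + k)).
  move=> mH eH HE.
  rewrite (@fourier_inversion_at0 _ (h k) (h (k - pi / 2)) H)//.
    by rewrite /h mulr0 expR0 !mulr1 sub0r.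
  move=> x; rewrite HE; apply: eq_Rintegral => v _.
  rewrite /h addrA cosBpihalf -addrA cosD; ring.
rewrite /Cint; apply: complex_eq; rewrite !cReE /= mul0r ?subr0 ?addr0.
- rewrite (KK 0)//.
  + by rewrite addr0 cReN cImN.
  + by apply: exp_decay_le dec => x; rewrite [leRHS]ger0_norm ?cabs_ge0// normRe_le_cabs.
  + move=> x; rewrite -E /Cint /=; apply: eq_Rintegral => v _.
    by rewrite addr0 !cReE /=; congr (expR _ * cos _); ring.
- rewrite (KK (- (pi / 2)))//.
  + by rewrite cosBpihalf cReN cImN.
  + by apply: exp_decay_le dec => x; rewrite [leRHS]ger0_norm ?cabs_ge0// normIm_le_cabs.
  + move=> x; rewrite -E /Cint /=; apply: eq_Rintegral => v _.
    by rewrite cosBpihalf !cReE /=; congr (expR _ * sin _); ring.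
Qed.

End GammaMellin.

(** * Iterated integrals *)

Section IteratedIntegrals.
Variable R : realType.
Notation mu := (@lebesgue_measure R).
Notation C := R[i].
Notation Re := (@complex.Re R).
Notation Im := (@complex.Im R).

Fixpoint iterRint {I : eqType} (s : seq I) (D : set R) (f : (I -> R) -> R) (x : I -> R) : R :=
  match s with
  | [::] => f x
  | i :: s' => Rintegral mu D (fun u => iterRint s' D f (upd x i u))
  end.

Lemma Re_iterCint (I : eqType) (s : seq I) D (f : (I -> R) -> C) x :
  Re (iterCint s D f x) = iterRint s D (fun y => Re (f y)) x.
Proof.
by elim: s x => //= i s IH x; apply: eq_Rintegral => u _; exact: IH.
Qed.

Lemma Im_iterCint (I : eqType) (s : seq I) D (f : (I -> R) -> C) x :
  Im (iterCint s D f x) = iterRint s D (fun y => Im (f y)) x.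
Proof.
by elim: s x => //= i s IH x; apply: eq_Rintegral => u _; exact: IH.
Qed.

Lemma iterRint_cat (I : eqType) (s1 s2 : seq I) D f x :
  iterRint (s1 ++ s2) D f x = iterRint s1 D (iterRint s2 D f) x.
Proof.
by elim: s1 x => //= i s IH x; apply: eq_Rintegral => u _; exact: IH.
Qed.

Lemma iterCint_cat (I : eqType) (s1 s2 : seq I) D (f : (I -> R) -> C) x :
  iterCint (s1 ++ s2) D f x = iterCint s1 D (iterCint s2 D f) x.
Proof.
elim: s1 x => //= i s IH x; rewrite /Cint.
by congr Complex; apply: eq_Rintegral => u _; rewrite IH.
Qed.

Lemma updE (I : eqType) (x : I -> R) i u : upd x i u i = u.
Proof. by rewrite /upd eqxx. Qed.

Lemma updNE (I : eqType) (x : I -> R) i j u : j != i -> upd x i u j = x j.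
Proof. by rewrite /upd => /negbTE ->. Qed.

Lemma upd_upd (I : eqType) (x : I -> R) i j u v : i != j ->
  upd (upd x i u) j v = upd (upd x j v) i u.
Proof.
move=> ij; apply/funext => k; rewrite /upd.
by have [->|//] := eqVneq k j; rewrite eq_sym (negbTE ij).
Qed.

(** Integration over [s] overwrites the coordinates in [s], so the base point counts only off [s].
    The two base points may differ, which makes the base point irrelevant once [s] lists every
    index. *)
Lemma iterRint_congr (I : eqType) (s : seq I) (D : set R) (f g : (I -> R) -> R) (x y : I -> R) :
  (forall v : I -> R, (forall i, i \in s -> D (v i)) ->
    f (fun i => if i \in s then v i else x i) = g (fun i => if i \in s then v i else y i)) ->
  iterRint s D f x = iterRint s D g y.
Proof.
elim: s x y => [|i s IH] x y H /=; first by have := H x; apply.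
apply: eq_Rintegral => u /set_mem Du; apply: IH => v Dv.
have E (w : I -> R) : (fun j => if j \in s then v j else upd w i u j) =
    (fun j => if j \in i :: s then (if j \in s then v j else u) else w j).
  by apply/funext => j; rewrite inE /upd; case: (j \in s); [rewrite orbT|rewrite orbF; case: eqP].
rewrite !E; apply: H => j; rewrite inE => ji.
by case: ifPn => [js|_] //; exact: Dv.
Qed.

Lemma iterCint_congr (I : eqType) (s : seq I) (D : set R) (f g : (I -> R) -> C) (x y : I -> R) :
  (forall v : I -> R, (forall i, i \in s -> D (v i)) ->
    f (fun i => if i \in s then v i else x i) = g (fun i => if i \in s then v i else y i)) ->
  iterCint s D f x = iterCint s D g y.
Proof.
move=> H; apply: complex_eq; rewrite ?Re_iterCint ?Im_iterCint;
  by apply: iterRint_congr => v Dv; rewrite H.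
Qed.

(** The integrand has to factor through [h] only at points that agree with [x] off the range of [h].
    Coordinates off that range can thus act as parameters, as needed to integrate over one summand
    of a sum type. *)
Lemma iterRint_map (I J : eqType) (h : I -> J) (s : seq I) (D : set R)
    (g : (J -> R) -> R) (g' : (I -> R) -> R) (x : J -> R) : injective h ->
  (forall x', (forall j, (forall i, j != h i) -> x' j = x j) -> g x' = g' (x' \o h)) ->
  iterRint (map h s) D g x = iterRint s D g' (x \o h).
Proof.
move=> hI; elim: s x => [|i s IH] x H /=; first exact: H.
apply: eq_Rintegral => u _.
rewrite (_ : upd (x \o h) i u = upd x (h i) u \o h); last first.
  by apply/funext => j; rewrite /upd /= (inj_eq hI).
apply: IH => x' Hx'; apply: H => j hj; rewrite Hx'// updNE//; exact: hj.
Qed.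

Lemma iterCint_map (I J : eqType) (h : I -> J) (s : seq I) (D : set R)
    (g : (J -> R) -> C) (g' : (I -> R) -> C) (x : J -> R) : injective h ->
  (forall x', (forall j, (forall i, j != h i) -> x' j = x j) -> g x' = g' (x' \o h)) ->
  iterCint (map h s) D g x = iterCint s D g' (x \o h).
Proof.
move=> hI H; apply: complex_eq; rewrite ?Re_iterCint ?Im_iterCint;
  by apply: iterRint_map => // x' Hx'; rewrite H.
Qed.

(* measurability of [f] for the product sigma-algebra, tested on all measurable families of points *)
Definition coord_measurable (I : Type) (f : (I -> R) -> R) : Prop :=
  forall d (T : measurableType d) (x : T -> I -> R),
    (forall i, measurable_fun setT (fun t => x t i)) ->
    measurable_fun setT (fun t => f (x t)).

Lemma measurable_upd (I : eqType) d (T : measurableType d) (x : T -> I -> R) i :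
  (forall i, measurable_fun setT (fun t => x t i)) ->
  forall j, measurable_fun setT (fun z : T * R => upd (x z.1) i z.2 j).
Proof.
move=> mx j; have [->|ji] := eqVneq j i.
  by under eq_fun do rewrite updE; exact: measurable_snd.
under eq_fun do rewrite updNE//.
by apply: (measurableT_comp (mx j)); exact: measurable_fst.
Qed.

Lemma coord_measurable_upd (I : eqType) (f : (I -> R) -> R) x i : coord_measurable f ->
  measurable_fun setT (fun u : R => f (upd x i u)).
Proof.
move=> mf; apply: mf => j; have [->|ji] := eqVneq j i.
  by under eq_fun do rewrite updE; exact: measurable_id.
by under eq_fun do rewrite updNE//; exact: measurable_cst.
Qed.

Lemma coord_measurable_iterRint (I : eqType) (s : seq I) (D : set R) (f : (I -> R) -> R) :
  measurable D -> coord_measurable f -> coord_measurable (iterRint s D f).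
Proof.
move=> mD mf; elim: s => //= i s IH d T x mx.
under eq_fun do rewrite Rintegral_mkcond.
apply: (@measurable_Rintegral_param _ _ _ (fun t => (fun u => iterRint s D f (upd (x t) i u)) \_ D)).
rewrite (_ : (fun z : T * R => _) = (fun z : T * R => iterRint s D f (upd (x z.1) i z.2) * \1_D z.2)); last first.
  apply/funext => z; rewrite /patch indicE; case: ifP => _; by rewrite ?mulr1 ?mulr0.
apply: measurable_funM; first by apply: IH => j; exact: measurable_upd.
have m1 : measurable_fun [set: R] (\1_D : R -> R) by apply/measurable_indicP.
by apply: (measurableT_comp m1); exact: measurable_snd.
Qed.

(** The constants are uniform in the coordinates outside [s]; this is what makes the condition
    stable under integrating out members of [s]. *)
Definition decay_on (I : eqType) (s : seq I) (f : (I -> R) -> R) :=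
  exists C d : R, [/\ 0 <= C, 0 < d &
    forall x, `|f x| <= C * expR (- (d * \sum_(i <- s) `|x i|))].

Lemma decay_on_perm (I : eqType) (s s' : seq I) f : perm_eq s s' ->
  decay_on s f -> decay_on s' f.
Proof.
move=> ss' [C0 [d [C0_ge d0 H]]]; exists C0, d; split => // x.
by rewrite -(perm_big _ ss').
Qed.

Lemma decay_on_cons (I : eqType) (s : seq I) i f : decay_on (i :: s) f -> decay_on s f.
Proof.
move=> [C0 [d [C0_ge d0 H]]]; exists C0, d; split => // x.
rewrite (le_trans (H x))// ler_wpM2l// ler_expR lerN2 ler_wpM2l ?(ltW d0)//.
by rewrite big_cons lerDr.
Qed.

Lemma decay_on_upd (I : eqType) (s : seq I) i f x : i \notin s ->
  decay_on (i :: s) f -> exp_decay (fun u => f (upd x i u)).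
Proof.
move=> is_ [C0 [d [C0_ge d0 H]]]; exists C0, d; split => // u.
rewrite (le_trans (H _))// ler_wpM2l// ler_expR lerN2 ler_wpM2l ?(ltW d0)//.
by rewrite big_cons updE lerDl sumr_ge0.
Qed.

Lemma decay_on_Rintegral (I : eqType) (s : seq I) i f : i \notin s ->
  coord_measurable f -> decay_on (i :: s) f ->
  decay_on s (fun x => Rintegral mu setT (fun u => f (upd x i u))).
Proof.
move=> is_ mf df; have [C0 [d [C0_ge d0 H]]] := df.
pose E (u : R) := expR (- (d * `|u|)).
have eE : exp_decay E by exists 1, d; split => // u; rewrite mul1r ger0_norm ?expR_ge0.
have mE : measurable_fun setT E by rewrite /E; measurable_tac.
have iE := exp_decay_integrable mE eE.
pose K := Rintegral mu setT E.
have K0 : 0 <= K by apply: Rintegral_ge0 => u _; exact: expR_ge0.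
exists (C0 * K), d; split; rewrite ?mulr_ge0// => x.
have ifx : mu.-integrable setT (EFin \o (fun u => f (upd x i u))).
  by apply: exp_decay_integrable; [exact: coord_measurable_upd|exact: decay_on_upd df].
rewrite (le_trans (le_normr_Rintegral _ ifx))//.
rewrite mulrAC -RintegralZl//; apply: le_Rintegral => //.
- by have := integrable_norm ifx.
- by have := integrableZl measurableT (C0 * expR (- (d * \sum_(i <- s) `|x i|))) iE; apply: eq_integrable => // t _; rewrite /= EFinM.
- move=> u _ /=; rewrite (le_trans (H _))// -mulrA ler_wpM2l// /E -expRD ler_expR.
  rewrite big_cons updE mulrDr opprD addrC lerD2r lerN2 ler_wpM2l ?(ltW d0)//.
  rewrite le_eqVlt; apply/orP; left; apply/eqP; apply: eq_big_seq => j js.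
  by rewrite updNE//; apply: contraNneq is_ => <-.
Qed.

Lemma decay_on_iterRint (I : eqType) (s1 s2 : seq I) f : uniq (s1 ++ s2) ->
  coord_measurable f -> decay_on (s1 ++ s2) f -> decay_on s1 (iterRint s2 setT f).
Proof.
move=> + mf; elim: s2 s1 => [|i s2 IH] s1; first by rewrite cats0.
rewrite -cat_rcons => us df /=; have H := IH _ us df.
have i1 : i \notin s1.
  by move: us; rewrite cat_uniq rcons_uniq => /andP[/andP[]].
apply: decay_on_Rintegral => //; first exact: coord_measurable_iterRint.
by apply: decay_on_perm H; rewrite perm_rcons.
Qed.

Lemma iterRint_integrable (I : eqType) (s : seq I) i f x : uniq (i :: s) ->
  coord_measurable f -> decay_on (i :: s) f ->
  mu.-integrable setT (EFin \o (fun u => iterRint s setT f (upd x i u))).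
Proof.
move=> us mf df; apply: exp_decay_integrable.
  by apply: coord_measurable_upd; exact: coord_measurable_iterRint.
by apply: (@decay_on_upd _ [::]) => //; exact: (@decay_on_iterRint _ [:: i] s).
Qed.

(** Once [s] is integrated out, decay in the two remaining coordinates persists, so the two-variable
    Fubini theorem applies to the inner integral. *)
Lemma iterRint_swap (I : eqType) (s : seq I) i j f x : uniq (i :: j :: s) ->
  coord_measurable f -> decay_on (i :: j :: s) f ->
  iterRint (i :: j :: s) setT f x = iterRint (j :: i :: s) setT f x.
Proof.
move=> us mf df /=.
have ij : i != j by move: us; rewrite /= inE negb_or => /andP[/andP[]].
have [C0 [d [C0_ge d0 H]]] := @decay_on_iterRint _ [:: i; j] s f us mf df.
have mg := coord_measurable_iterRint s measurableT mf.
have m2 : measurable_fun setT (fun z : R * R => iterRint s setT f (upd (upd x i z.1) j z.2)).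
  apply: mg => k; have [->|kj] := eqVneq k j.
    by under eq_fun do rewrite updE; exact: measurable_snd.
  under eq_fun do rewrite updNE//.
  have [->|ki] := eqVneq k i.
    by under eq_fun do rewrite updE; exact: measurable_fst.
  by under eq_fun do rewrite updNE//; exact: measurable_cst.
have b2 u v : `|iterRint s setT f (upd (upd x i u) j v)| <=
    C0 * expR (- (d * `|u|)) * expR (- (d * `|v|)).
  rewrite (le_trans (H _))// !big_cons big_nil addr0 updE updNE// updE.
  by rewrite mulrDr opprD expRD mulrA.
apply: (etrans (Rintegral_swap d0 m2 b2)).
by apply: eq_Rintegral => v _; apply: eq_Rintegral => u _; rewrite upd_upd.
Qed.

Lemma iterRint_move (I : eqType) (s : seq I) i f x : uniq s -> i \in s ->
  coord_measurable f -> decay_on s f ->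
  iterRint s setT f x = iterRint (i :: rem i s) setT f x.
Proof.
move=> + + mf; elim: s x => // j s IH x us; rewrite inE => ijs df.
rewrite [rem _ _]/=; have [ji|ji] := eqVneq j i; first by rewrite ji.
have is_ : i \in s by move: ijs; rewrite eq_sym (negbTE ji).
have us' : uniq s by case/andP: us.
have pe : perm_eq (j :: s) (j :: i :: rem i s) by rewrite perm_cons perm_to_rem.
have u2 : uniq (j :: i :: rem i s) by rewrite -(perm_uniq pe).
rewrite -(iterRint_swap _ u2 mf (decay_on_perm pe df)).
by apply: eq_Rintegral => u _; apply: IH => //; exact: decay_on_cons df.
Qed.

(** The head of [s] is brought to the front of [s'] by adjacent swaps, and induction handles the
    tails. *)
Lemma iterRint_perm (I : eqType) (s s' : seq I) f x : perm_eq s s' -> uniq s ->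
  coord_measurable f -> decay_on s f ->
  iterRint s setT f x = iterRint s' setT f x.
Proof.
move=> + + mf; elim: s s' x => [|i s IH] s' x ss' us df.
  by move: ss'; rewrite perm_sym => /perm_nilP ->.
have is' : i \in s' by rewrite -(perm_mem ss') inE eqxx.
have us' : uniq s' by rewrite -(perm_uniq ss').
rewrite (iterRint_move _ us' is' mf (decay_on_perm ss' df)).
apply: eq_Rintegral => u _; apply: IH.
- by rewrite -(perm_cons i) (perm_trans ss')// perm_to_rem.
- by case/andP: us.
- exact: decay_on_cons df.
Qed.

Lemma iterRint_pZl (I : eqType) (s : seq I) (k : R) f x : 0 < k ->
  coord_measurable f ->
  iterRint s setT (fun y => k * f y) x = k * iterRint s setT f x.
Proof.
move=> k0 mf; elim: s x => //= i s IH x.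
rewrite -Rintegral_pZl//; first by apply: eq_Rintegral => u _; exact: IH.
by apply: coord_measurable_upd; exact: coord_measurable_iterRint.
Qed.

Lemma iterRint_lin (I : eqType) (s : seq I) (a b : R) f g x : uniq s ->
  coord_measurable f -> decay_on s f -> coord_measurable g -> decay_on s g ->
  iterRint s setT (fun y => a * f y + b * g y) x =
  a * iterRint s setT f x + b * iterRint s setT g x.
Proof.
move=> + mf + mg; elim: s x => //= i s IH x us df dg.
have i1 := iterRint_integrable x us mf df.
have i2 := iterRint_integrable x us mg dg.
rewrite -!RintegralZl// -RintegralD//; last 2 first.
- by have := integrableZl measurableT a i1; apply: eq_integrable => // t _; rewrite /= EFinM.
- by have := integrableZl measurableT b i2; apply: eq_integrable => // t _; rewrite /= EFinM.
apply: eq_Rintegral => u _; apply: IH.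
- by case/andP: us.
- exact: decay_on_cons df.
- exact: decay_on_cons dg.
Qed.

(** Each Jacobian [expR u] is a positive constant for the inner integrals, so [iterRint_pZl] moves
    it inside with measurability alone. *)
Lemma iterRint_expR (I : eqType) (s : seq I) f x : uniq s -> coord_measurable f ->
  iterRint s `]0, +oo[ f x = iterRint s setT
   (fun u => (\prod_(i <- s) expR (u i)) * f (fun i => if i \in s then expR (u i) else u i)) x.
Proof.
move=> + mf; elim: s x => [|i s IH] x /=; first by rewrite big_nil mul1r.
case/andP=> is_ us.
have mF : coord_measurable (fun u : I -> R => (\prod_(j <- s) expR (u j)) * f (fun j => if j \in s then expR (u j) else u j)).
  move=> d T y my; apply: measurable_funM.
    by apply: measurable_prod => j _; exact: (measurableT_comp (@measurable_expR R)).
  apply: mf => j; case: (j \in s); last exact: my.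
  exact: (measurableT_comp (@measurable_expR R)).
rewrite Rintegral_pos_expR; last first.
  by apply: coord_measurable_upd; apply: coord_measurable_iterRint => //; exact: measurable_itv.
apply: eq_Rintegral => u _; rewrite IH// mulrC -iterRint_pZl ?expR_gt0//.
apply: iterRint_congr => v _; rewrite big_cons (negbTE is_) updE mulrA; congr (_ * _ * f _).
  by apply: eq_big_seq => j js; rewrite js.
apply/funext => j; rewrite inE.
case: (j \in s); first by rewrite orbT.
by rewrite orbF /upd; case: eqP.
Qed.

Lemma CintZ (D : set R) (c : C) (f : R -> C) : measurable D ->
  mu.-integrable D (EFin \o (fun x => Re (f x))) ->
  mu.-integrable D (EFin \o (fun x => Im (f x))) ->
  Cint D (fun x => c * f x) = c * Cint D f.
Proof.
move=> mD i1 i2; have mD' : measurable (D : set (measurableTypeR R)) by [].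
have iZ (k : R) (g : R -> R) : mu.-integrable D (EFin \o g) ->
    mu.-integrable D (EFin \o (fun x => k * g x)).
  by move=> ig; have := integrableZl mD' k ig; apply: eq_integrable => // t _; rewrite /= EFinM.
rewrite /Cint; apply: complex_eq; rewrite !cReE /= -!RintegralZl//.
- by rewrite -RintegralB//; [apply: eq_Rintegral => x _; rewrite cReM|exact: iZ|exact: iZ].
- by rewrite -RintegralD//; [apply: eq_Rintegral => x _; rewrite cImM|exact: iZ|exact: iZ].
Qed.

(** The constant [c] is there for the induction: it absorbs the factor [h i u] fixed by the outer
    variable. *)
Lemma iterCint_prod (I : eqType) (s : seq I) (h : I -> R -> C) (c : C) x : uniq s ->
  (forall i, i \in s -> mu.-integrable setT (EFin \o (fun x => Re (h i x)))) ->
  (forall i, i \in s -> mu.-integrable setT (EFin \o (fun x => Im (h i x)))) ->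
  iterCint s setT (fun y => c * \prod_(i <- s) h i (y i)) x =
  c * \prod_(i <- s) Cint setT (h i).
Proof.
elim: s c x => [|i s IH] c x /=; first by rewrite !big_nil.
move=> /andP[is_ us] i1 i2; rewrite big_cons.
transitivity (Cint setT (fun u : R => (c * \prod_(j <- s) Cint setT (h j)) * h i u)).
  rewrite /Cint; congr Complex; apply: eq_Rintegral => u _.
    rewrite mulrAC -(IH _ (upd x i u))//; last 2 first.
    + by move=> j js; apply: i1; rewrite inE js orbT.
    + by move=> j js; apply: i2; rewrite inE js orbT.
    congr complex.Re; apply: iterCint_congr => v _.
    rewrite big_cons (negbTE is_) updE mulrA; congr (_ * _).
  rewrite mulrAC -(IH _ (upd x i u))//; last 2 first.
  + by move=> j js; apply: i1; rewrite inE js orbT.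
  + by move=> j js; apply: i2; rewrite inE js orbT.
  congr complex.Im; apply: iterCint_congr => v _.
  by rewrite big_cons (negbTE is_) updE mulrA; congr (_ * _).
rewrite CintZ//; last 2 first.
- by apply: i1; rewrite inE eqxx.
- by apply: i2; rewrite inE eqxx.
by rewrite mulrAC mulrA.
Qed.

(** * Complex-valued iterated integrals *)

Definition Ccoord_measurable (I : Type) (f : (I -> R) -> C) :=
  coord_measurable (fun x => Re (f x)) /\ coord_measurable (fun x => Im (f x)).

Definition Cdecay_on (I : eqType) (s : seq I) (f : (I -> R) -> C) :=
  decay_on s (fun x => cabs (f x)).

Lemma Cdecay_onP (I : eqType) (s : seq I) (f : (I -> R) -> C) : Cdecay_on s f ->
  decay_on s (fun x => Re (f x)) /\ decay_on s (fun x => Im (f x)).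
Proof.
move=> [C0 [d [C0_ge d0 H]]]; split; exists C0, d; split => // x;
  rewrite (le_trans _ (H x))// [leRHS]ger0_norm ?cabs_ge0//.
- exact: normRe_le_cabs.
- exact: normIm_le_cabs.
Qed.

Lemma iterCint_perm (I : eqType) (s s' : seq I) f x : perm_eq s s' -> uniq s ->
  Ccoord_measurable f -> Cdecay_on s f ->
  iterCint s setT f x = iterCint s' setT f x.
Proof.
move=> ss' us [m1 m2] /Cdecay_onP[d1 d2]; apply: complex_eq;
  by rewrite ?Re_iterCint ?Im_iterCint; apply: iterRint_perm.
Qed.

Lemma iterCintZ (I : eqType) (s : seq I) (c : C) f x : uniq s ->
  Ccoord_measurable f -> Cdecay_on s f ->
  iterCint s setT (fun y => c * f y) x = c * iterCint s setT f x.
Proof.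
move=> us [m1 m2] /Cdecay_onP[d1 d2]; apply: complex_eq.
- rewrite Re_iterCint [RHS]cReM Re_iterCint Im_iterCint -mulNr -iterRint_lin//.
  by apply: iterRint_congr => v _; rewrite cReM mulNr.
- rewrite Im_iterCint [RHS]cImM Re_iterCint Im_iterCint -iterRint_lin//.
  by apply: iterRint_congr => v _; rewrite cImM.
Qed.

Lemma Cdecay_on_iterCint (I : eqType) (s1 s2 : seq I) f : uniq (s1 ++ s2) ->
  Ccoord_measurable f -> Cdecay_on (s1 ++ s2) f -> Cdecay_on s1 (iterCint s2 setT f).
Proof.
move=> us [m1 m2] /Cdecay_onP[d1 d2].
have [C1 [e1 [C1_ge e1_gt H1]]] := decay_on_iterRint us m1 d1.
have [C2 [e2 [C2_ge e2_gt H2]]] := decay_on_iterRint us m2 d2.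
exists (C1 + C2), (Num.min e1 e2); split; rewrite ?addr_ge0 ?lt_min ?e1_gt// => x.
rewrite ger0_norm ?cabs_ge0// (le_trans (cabs_le_ReIm _))// Re_iterCint Im_iterCint mulrDl.
have S0 : 0 <= \sum_(i <- s1) `|x i| by rewrite sumr_ge0.
rewrite lerD//.
- rewrite (le_trans (H1 x))// ler_wpM2l// ler_expR lerN2 ler_wpM2r//.
  by rewrite ge_min lexx.
- rewrite (le_trans (H2 x))// ler_wpM2l// ler_expR lerN2 ler_wpM2r//.
  by rewrite ge_min lexx orbT.
Qed.

Lemma Ccoord_measurable_iterCint (I : eqType) (s : seq I) (D : set R) f : measurable D ->
  Ccoord_measurable f -> Ccoord_measurable (iterCint s D f).
Proof.
move=> mD [m1 m2]; split.
- rewrite (_ : (fun x => _) = iterRint s D (fun y => Re (f y))).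
    exact: coord_measurable_iterRint.
  by apply/funext => x; rewrite Re_iterCint.
- rewrite (_ : (fun x => _) = iterRint s D (fun y => Im (f y))).
    exact: coord_measurable_iterRint.
  by apply/funext => x; rewrite Im_iterCint.
Qed.

End IteratedIntegrals.

(** * Linear changes of variables *)

Section LinearChange.
Variable R : realType.
Notation mu := (@lebesgue_measure R).
Variable n : nat.
Notation K := 'I_n.+1.
Notation M := 'M[R]_n.+1.
Implicit Types (A B : M) (f : (K -> R) -> R) (x u : K -> R).

Definition mxact A u : K -> R := fun i => \sum_j A i j * u j.

Lemma mxactM A B u : mxact (A *m B) u = mxact A (mxact B u).
Proof.
apply/funext => i; rewrite /mxact.
under eq_bigr do rewrite mxE mulr_suml.
rewrite exchange_big; apply: eq_bigr => k _; rewrite mulr_sumr.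
by apply: eq_bigr => j _; rewrite mulrA.
Qed.

Lemma mxact1 u : mxact 1%:M u = u.
Proof.
apply/funext => i; rewrite /mxact (bigD1 i)//= mxE eqxx mul1r big1 ?addr0// => j ji.
by rewrite mxE eq_sym (negbTE ji) mul0r.
Qed.

Lemma coord_measurable_mxact A f : coord_measurable f ->
  coord_measurable (fun u => f (mxact A u)).
Proof.
move=> mf d T x mx; apply: mf => i.
by apply: measurable_sum => j; exact: measurable_funM.
Qed.

Lemma decay_on_mxact A f : A \in unitmx ->
  decay_on (enum K) f -> decay_on (enum K) (fun u => f (mxact A u)).
Proof.
move=> Au [C [d [C0 d0 H]]].
(* The double sum bounds the operator norm of the inverse for the sum norm, and the summand [1]
   keeps [b] positive; the sum norm of [u] is at most [b] times that of [mxact A u], so the rate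
   drops from [d] to [d / b]. *)
pose b := 1 + \sum_i \sum_j `|invmx A i j|.
have b0 : 0 < b by rewrite ltr_pwDl// sumr_ge0// => i _; rewrite sumr_ge0.
exists C, (d / b); split; rewrite ?divr_gt0// => u.
rewrite (le_trans (H _))// ler_wpM2l// ler_expR lerN2 -mulrA ler_wpM2l ?(ltW d0)//.
rewrite mulrC ler_pdivrMr// !big_enum /=.
rewrite -[in X in X <= _](mxact1 u) -(mulVmx Au) mxactM.
set w := mxact A u.
have wj j : `|w j| <= \sum_i `|w i| by rewrite (bigD1 j)//= lerDl sumr_ge0.
have S0 : 0 <= \sum_i `|w i| by rewrite sumr_ge0.
rewrite mulrC /b mulrDl mul1r mulr_suml (le_trans (y := \sum_i (\sum_j `|invmx A i j|) * \sum_i `|w i|))//; last by rewrite lerDr.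
apply: ler_sum => i _; rewrite mulr_suml (le_trans (ler_norm_sum _ _ _))//.
by apply: ler_sum => j _; rewrite normrM ler_wpM2l.
Qed.

Definition change_of_variables A := forall f x,
  coord_measurable f -> decay_on (enum K) f ->
  iterRint (enum K) setT (fun u => f (mxact A u)) x =
  `|\det A|^-1 * iterRint (enum K) setT f x.

Lemma iterRint_enum_base f x y :
  iterRint (enum K) setT f x = iterRint (enum K) setT f y.
Proof. by apply: iterRint_congr => v _; congr (f _); apply/funext => i; rewrite mem_enum. Qed.

Lemma change_of_variables_mul A B : A \in unitmx -> B \in unitmx ->
  change_of_variables A -> change_of_variables B -> change_of_variables (A *m B).
Proof.
move=> Au Bu cA cB f x mf df.
rewrite (_ : (fun u => _) = (fun u => f (mxact A (mxact B u)))); last first.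
  by apply/funext => u; rewrite mxactM.
rewrite (cB (fun u => f (mxact A u))); last 2 first.
- exact: coord_measurable_mxact.
- exact: decay_on_mxact.
by rewrite cA// det_mulmx normrM invfM mulrA [_^-1 * _ in LHS]mulrC.
Qed.

Lemma change_of_variables_perm (s : 'S_n.+1) : change_of_variables (perm_mx s).
Proof.
move=> f x mf df.
have -> : (fun u => f (mxact (perm_mx s) u)) = (fun u => f (u \o s)).
  apply/funext => u; congr f; apply/funext => i; rewrite /mxact (bigD1 (s i))//=.
  rewrite !mxE eqxx mul1r big1 ?addr0// => j ji.
  by rewrite !mxE eq_sym (negbTE ji) mul0r.
rewrite det_perm normrX normrN1 expr1n invr1 mul1r.
have mf' : coord_measurable (fun u => f (u \o s)).
  by move=> d T y my; apply: mf => i; exact: my.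
have us : uniq (map s (enum K)) by rewrite (map_inj_uniq (@perm_inj _ s)) enum_uniq.
have ps : perm_eq (map s (enum K)) (enum K).
  apply: uniq_perm; rewrite ?us ?enum_uniq//.
  by move=> i; rewrite mem_enum; apply/mapP; exists (s^-1%g i); rewrite ?mem_enum// permKV.
have df' : decay_on (map s (enum K)) (fun u => f (u \o s)).
  have [C [d [C0 d0 H]]] := df; exists C, d; split => // u.
  by rewrite big_map; exact: H.
rewrite -(iterRint_perm x ps us mf' df').
rewrite (@iterRint_map R _ _ s _ _ _ f x (@perm_inj _ s))//.
exact: iterRint_enum_base.
Qed.

(** The identity matrix with row [k] taken from [A]. It moves only coordinate [k], so its change of
    variables is a one-dimensional affine substitution. *)
Definition rowmx_at (k : K) A : M := \matrix_(i, j) if i == k then A i j else (i == j)%:R.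

Lemma mxact_rowmx_at k A u : mxact (rowmx_at k A) u = upd u k (\sum_j A k j * u j).
Proof.
apply/funext => i; rewrite /mxact /upd.
have [->|ik] := eqVneq i k.
  by apply: eq_bigr => j _; rewrite mxE eqxx.
rewrite (bigD1 i)//= mxE (negbTE ik) eqxx mul1r big1 ?addr0// => j ji.
by rewrite mxE (negbTE ik) eq_sym (negbTE ji) mul0r.
Qed.

Lemma change_of_variables_rowmx_at k A : A k k != 0 -> \det (rowmx_at k A) = A k k ->
  change_of_variables (rowmx_at k A).
Proof.
move=> Akk dA f x mf df.
have Eu : rowmx_at k A \in unitmx by rewrite unitmxE dA unitfE.
(* Coordinate [k] is made innermost, where the contribution of the other coordinates to row [k] is a
   constant translation. *)
have pk : perm_eq (enum K) (rcons (rem k (enum K)) k).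
  by rewrite perm_sym perm_rcons perm_sym; apply: perm_to_rem; rewrite mem_enum.
rewrite (iterRint_perm x pk (enum_uniq _))//; last 2 first.
- exact: coord_measurable_mxact.
- exact: decay_on_mxact.
rewrite (iterRint_perm x pk (enum_uniq _) mf)// dA -cats1 !iterRint_cat.
rewrite -iterRint_pZl ?invr_gt0 ?normr_gt0//; last exact: coord_measurable_iterRint.
congr (iterRint _ _ _ x); apply/funext => y /=.
have mg : measurable_fun setT (fun u : R => f (upd y k u)) by exact: coord_measurable_upd.
rewrite -(Rintegral_affine (\sum_(j | j != k) A k j * y j) Akk mg).
apply: eq_Rintegral => u _; congr f; rewrite mxact_rowmx_at.
apply/funext => i; rewrite /upd; case: eqP => // _.
rewrite (bigD1 k)//= eqxx; congr (_ + _).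
by apply: eq_bigr => j jk; rewrite (negbTE jk).
Qed.

Definition rowsmx (S : pred K) A : M := \matrix_(i, j) if S i then A i j else (i == j)%:R.

(** A row can be appended by a right factor as long as the rows already present vanish in column
    [k]. This fixes the order: from the top for lower triangular matrices, from the bottom for upper
    triangular ones. *)
Lemma rowsmx_step (S S' : pred K) k A : ~~ S k ->
  (forall i, S' i = (i == k) || S i) -> (forall i, S i -> A i k = 0) ->
  rowsmx S' A = rowsmx S A *m rowmx_at k A.
Proof.
move=> Sk SS' Aik; apply/matrixP => i j; rewrite !mxE SS'.
have [->|ik] /= := eqVneq i k.
  rewrite (bigD1 k)//= !mxE (negbTE Sk) !eqxx mul1r big1 ?addr0// => l lk.
  by rewrite !mxE (negbTE Sk) eq_sym (negbTE lk) mul0r.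
case: ifPn => Si.
  have [->|jk] := eqVneq j k.
    rewrite Aik// big1// => l _; rewrite !mxE Si.
    have [->|lk] := eqVneq l k; first by rewrite Aik// mul0r.
    by rewrite mulr0.
  rewrite (bigD1 j)//= !mxE Si (negbTE jk) eqxx mulr1 big1 ?addr0// => l lj.
  rewrite !mxE Si; have [->|lk] := eqVneq l k; first by rewrite Aik// mul0r.
  by rewrite (negbTE lj) mulr0.
rewrite (bigD1 i)//= !mxE (negbTE Si) eqxx mul1r (negbTE ik) big1 ?addr0// => l li.
by rewrite !mxE (negbTE Si) eq_sym (negbTE li) mul0r.
Qed.

Lemma change_of_variables1 : change_of_variables 1%:M.
Proof.
move=> f x _ _; rewrite det1 normr1 invr1 mul1r.
by congr (iterRint _ _ _ x); apply/funext => u; rewrite mxact1.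
Qed.

Lemma det_rowmx_at k A : is_trig_mx A \/ is_trig_mx A^T -> \det (rowmx_at k A) = A k k.
Proof.
have E : \prod_i rowmx_at k A i i = A k k.
  rewrite (bigD1 k)//= mxE eqxx big1 ?mulr1// => i ik.
  by rewrite mxE (negbTE ik) eqxx.
case=> [/is_trig_mxP|/is_trig_mxP] H.
- rewrite det_trig//; apply/is_trig_mxP => i j ij; rewrite mxE H//.
  case: eqP => // _; case: eqP => // ijE; by rewrite ijE ltnn in ij.
- rewrite -det_tr det_trig; first by rewrite -E; apply: eq_bigr => i _; rewrite mxE.
  apply/is_trig_mxP => i j ij; rewrite !mxE; have := H i j ij; rewrite mxE => ->.
  case: eqP => // _; case: eqP => // ijE; by rewrite ijE ltnn in ij.
Qed.

Lemma change_of_variables_step (S S' : pred K) k A : is_trig_mx A \/ is_trig_mx A^T ->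
  A k k != 0 -> ~~ S k -> (forall i, S' i = (i == k) || S i) -> (forall i, S i -> A i k = 0) ->
  rowsmx S A \in unitmx /\ change_of_variables (rowsmx S A) ->
  rowsmx S' A \in unitmx /\ change_of_variables (rowsmx S' A).
Proof.
move=> tA Akk Sk SS' Aik [Su cS].
have dk := det_rowmx_at k tA.
have Eu : rowmx_at k A \in unitmx by rewrite unitmxE dk unitfE.
rewrite (rowsmx_step Sk SS' Aik); split; first by rewrite unitmx_mul Su.
by apply: change_of_variables_mul => //; exact: change_of_variables_rowmx_at.
Qed.

Lemma rowsmx0 A (S : pred K) : (forall i, S i = false) -> rowsmx S A = 1%:M.
Proof. by move=> S0; apply/matrixP => i j; rewrite !mxE S0. Qed.

Lemma rowsmxT A (S : pred K) : (forall i, S i = true) -> rowsmx S A = A.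
Proof. by move=> S0; apply/matrixP => i j; rewrite !mxE S0. Qed.

Lemma change_of_variables_lower A : is_trig_mx A -> (forall i, A i i != 0) ->
  change_of_variables A.
Proof.
move=> tA Aii.
have H m : (m <= n.+1)%N -> rowsmx (fun i : K => i < m)%N A \in unitmx /\
    change_of_variables (rowsmx (fun i : K => i < m)%N A).
  elim: m => [|m IH] mn.
    rewrite rowsmx0//; split; [exact: unitmx1|exact: change_of_variables1].
  apply: (change_of_variables_step (k := Ordinal mn)) (IH (ltnW mn)) => //.
  - by left.
  - by rewrite ltnn.
  - by move=> i; rewrite ltnS leq_eqVlt.
  - by move=> i im; apply: (is_trig_mxP tA).
have [_] := H n.+1 (leqnn _); rewrite rowsmxT// => i; exact: ltn_ord.
Qed.

Lemma change_of_variables_upper A : is_trig_mx A^T -> (forall i, A i i != 0) ->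
  change_of_variables A.
Proof.
move=> tA Aii.
have H m : (m <= n.+1)%N -> rowsmx (fun i : K => n.+1 - m <= i)%N A \in unitmx /\
    change_of_variables (rowsmx (fun i : K => n.+1 - m <= i)%N A).
  elim: m => [|m IH] mn.
    rewrite rowsmx0; first by split; [exact: unitmx1|exact: change_of_variables1].
    by move=> i; rewrite subn0 leqNgt ltn_ord.
  have km : (n.+1 - m.+1 < n.+1)%N by rewrite subSS ltnS leq_subr.
  have E : (n.+1 - m = (n.+1 - m.+1).+1)%N by rewrite subSS subSn.
  apply: (change_of_variables_step (k := Ordinal km)) (IH (ltnW mn)) => //.
  - by right.
  - by rewrite /= E ltnn.
  - by move=> i; rewrite E leq_eqVlt -val_eqE /= eq_sym.
  - move=> i; rewrite E => im; have := is_trig_mxP tA (Ordinal km) i im.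
    by rewrite mxE.
have [_] := H n.+1 (leqnn _); rewrite rowsmxT// => i; by rewrite subnn.
Qed.

(** By the LUP decomposition [A] is a product of a permutation, where the claim is a reordering of
    the integrals, and two triangular matrices, which factor into one-row matrices. *)
Theorem change_of_variables_unitmx A : A \in unitmx -> change_of_variables A.
Proof.
move=> Au; have := cormen_lup_correct A.
have := cormen_lup_perm A; have := cormen_lup_lower A; have := cormen_lup_upper A.
case: (cormen_lup A) => [[P L] U] /= HU HL /is_perm_mxP[s ->] PLU.
have tL : is_trig_mx L.
  by apply/is_trig_mxP => i j ij; rewrite HL ?(ltnW ij)//; case: eqP => // ijE; rewrite ijE ltnn in ij.
have L1 i : L i i = 1 by rewrite HL// eqxx.
have tU : is_trig_mx U^T by apply/is_trig_mxP => i j ij; rewrite mxE HU.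
have dL : \det L = 1 by rewrite det_trig// big1.
have AE : A = perm_mx (s^-1)%g *m (L *m U).
  by rewrite -[L *m U]PLU mulmxA -perm_mxM mulVg perm_mx1 mul1mx.
have Lu : L \in unitmx by rewrite unitmxE dL unitr1.
have Pu (t : 'S_n.+1) : (perm_mx t : M) \in unitmx by exact: unitmx_perm.
have Uu : U \in unitmx by move: Au; rewrite AE !unitmx_mul => /andP[_ /andP[]].
have U0 i : U i i != 0.
  have : \det U != 0 by move: Uu; rewrite unitmxE unitfE.
  rewrite -det_tr det_trig// => /prodf_neq0 /(_ i isT).
  by rewrite mxE.
rewrite AE; apply: change_of_variables_mul => //.
- by rewrite unitmx_mul Lu.
- exact: change_of_variables_perm.
- apply: change_of_variables_mul => //.
  + by apply: change_of_variables_lower => // i; rewrite L1 oner_neq0.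
  + exact: change_of_variables_upper.
Qed.

Lemma iterCint_mxact A (f : (K -> R) -> R[i]) x : A \in unitmx ->
  Ccoord_measurable f -> Cdecay_on (enum K) f ->
  iterCint (enum K) setT (fun u => f (mxact A u)) x =
  (`|\det A|^-1)%:C%C * iterCint (enum K) setT f x.
Proof.
move=> Au [m1 m2] /Cdecay_onP[d1 d2]; have cA := change_of_variables_unitmx Au.
rewrite mulrC; apply: complex_eq; rewrite ?cReMr ?cImMr ?Re_iterCint ?Im_iterCint mulrC.
- exact: (cA (fun u => complex.Re (f u))).
- exact: (cA (fun u => complex.Im (f u))).
Qed.

End LinearChange.

(** * Complex-valued integrands *)

Section ComplexMeasurability.
Variable R : realType.
Notation C := R[i].
Notation Re := (@complex.Re R).
Notation Im := (@complex.Im R).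
Context d (T : measurableType d).
Implicit Types f g : T -> C.

Definition Cmeasurable f :=
  measurable_fun setT (fun t => Re (f t)) /\ measurable_fun setT (fun t => Im (f t)).

Lemma Cmeasurable_cst (c : C) : Cmeasurable (fun=> c).
Proof. by split; exact: measurable_cst. Qed.

Lemma Cmeasurable_real (f : T -> R) : measurable_fun setT f -> Cmeasurable (fun t => (f t)%:C).
Proof. by move=> mf; split => //; exact: measurable_cst. Qed.

Lemma CmeasurableD f g : Cmeasurable f -> Cmeasurable g -> Cmeasurable (fun t => f t + g t).
Proof.
move=> [f1 f2] [g1 g2]; split; under eq_fun do rewrite !cReE; exact: measurable_funD.
Qed.

Lemma CmeasurableN f : Cmeasurable f -> Cmeasurable (fun t => - f t).
Proof. by move=> [f1 f2]; split; under eq_fun do rewrite !cReE; exact: measurable_funN. Qed.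

Lemma CmeasurableM f g : Cmeasurable f -> Cmeasurable g -> Cmeasurable (fun t => f t * g t).
Proof.
move=> [f1 f2] [g1 g2]; split; under eq_fun do rewrite !cReE.
- by apply: measurable_funB; apply: measurable_funM.
- by apply: measurable_funD; apply: measurable_funM.
Qed.

Lemma Cmeasurable_sum (I : Type) (s : seq I) (P : pred I) (F : I -> T -> C) :
  (forall i, Cmeasurable (F i)) -> Cmeasurable (fun t => \sum_(i <- s | P i) F i t).
Proof.
move=> mF; elim: s => [|i s IH].
  by under eq_fun do rewrite big_nil; exact: Cmeasurable_cst.
under eq_fun do rewrite big_cons; case: (P i) => //; exact: CmeasurableD.
Qed.

Lemma Cmeasurable_prod (I : Type) (s : seq I) (P : pred I) (F : I -> T -> C) :
  (forall i, P i -> Cmeasurable (F i)) -> Cmeasurable (fun t => \prod_(i <- s | P i) F i t).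
Proof.
move=> mF; elim: s => [|i s IH].
  by under eq_fun do rewrite big_nil; exact: Cmeasurable_cst.
have [Pi|Pi] := boolP (P i).
  by under eq_fun do rewrite big_cons Pi; apply: CmeasurableM => //; exact: mF.
by under eq_fun do rewrite big_cons (negbTE Pi).
Qed.

Lemma Cmeasurable_cexp f : Cmeasurable f -> Cmeasurable (fun t => cexp (f t)).
Proof.
move=> [f1 f2]; split; rewrite /cexp /=; apply: measurable_funM.
- exact: (measurableT_comp (@measurable_expR R)).
- exact: (measurableT_comp (continuous_measurable_fun (@continuous_cos _))).
- exact: (measurableT_comp (@measurable_expR R)).
- exact: (measurableT_comp (continuous_measurable_fun (@continuous_sin _))).
Qed.

End ComplexMeasurability.

(** * Complex powers under positive scaling, decay of products, exponential substitution *)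

Section MoreIterated.
Variable R : realType.
Notation C := R[i].
Notation Re := (@complex.Re R).
Notation Im := (@complex.Im R).

(** Scaling by a positive real leaves the principal argument unchanged, so the logarithms add
    without a branch correction. *)
Lemma cpow_mulr_expR (z w : C) (y : R) : 0 < Re z ->
  cpow (z * (expR y)%:C) w = cpow z w * cexp (w * y%:C).
Proof.
move=> z0; have zy0 : 0 < Re (z * (expR y)%:C) by rewrite cReMr mulr_gt0 ?expR_gt0.
rewrite !cpowE// -cexpD -mulrDr; congr (cexp (_ * _)).
have -> : cabs (z * (expR y)%:C) = cabs z * expR y.
  by rewrite cabsM -cexp_real cabs_cexp.
rewrite lnM ?posrE ?cabs_gt0 ?expR_gt0// expRK.
apply: complex_eq; rewrite cReE //= addr0 /carg z0 zy0 cReMr cImMr.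
by congr atan; field; rewrite !gt_eqF ?expR_gt0.
Qed.

Lemma cpowD (z w1 w2 : C) : 0 < Re z -> cpow z (w1 + w2) = cpow z w1 * cpow z w2.
Proof. by move=> z0; rewrite !cpowE// mulrDl cexpD. Qed.

Lemma cpowM_N (z w : C) : 0 < Re z -> cpow z w * cpow z (- w) = 1.
Proof. by move=> z0; rewrite -cpowD// subrr cpowE// mul0r cexp0. Qed.

Lemma decay_on_prod (I : eqType) (s : seq I) (h : I -> R -> R) :
  (forall i, i \in s -> exp_decay (h i)) ->
  decay_on s (fun x => \prod_(i <- s) h i (x i)).
Proof.
elim: s => [|i s IH] H.
  exists 1, 1; split => // x; rewrite !big_nil mulr0 oppr0 expR0 mulr1 normr1//.
have [C1 [d1 [C10 d10 H1]]] := H i (mem_head _ _).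
have [C2 [d2 [C20 d20 H2]]] : decay_on s (fun x => \prod_(i <- s) h i (x i)).
  by apply: IH => j js; apply: H; rewrite inE js orbT.
exists (C1 * C2), (Num.min d1 d2); split; rewrite ?mulr_ge0 ?lt_min ?d10// => x.
have S0 : 0 <= \sum_(i <- s) `|x i| by rewrite sumr_ge0.
rewrite !big_cons normrM mulrDr opprD expRD mulrACA ler_pM//.
- rewrite (le_trans (H1 _))// ler_wpM2l// ler_expR lerN2 ler_wpM2r//.
  by rewrite ge_min lexx.
- rewrite (le_trans (H2 _))// ler_wpM2l// ler_expR lerN2 ler_wpM2r//.
  by rewrite ge_min lexx orbT.
Qed.

Lemma iterCint_expR (I : eqType) (s : seq I) (f : (I -> R) -> C) x : uniq s -> Ccoord_measurable f ->
  iterCint s `]0, +oo[ f x = iterCint s setT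
   (fun u => f (fun i => if i \in s then expR (u i) else u i) * (\prod_(i <- s) expR (u i))%:C) x.
Proof.
move=> us [m1 m2]; apply: complex_eq; rewrite ?Re_iterCint ?Im_iterCint iterRint_expR//;
  by apply: iterRint_congr => v _; rewrite ?cReMr ?cImMr mulrC.
Qed.

End MoreIterated.

(** * The Feynman integral *)

Section Feynman.
Variable R : realType.
Notation mu := (@lebesgue_measure R).
Notation C := R[i].
Notation Re := (@complex.Re R).
Notation Im := (@complex.Im R).
Variables (n N : nat) (a : 'I_N -> 'I_n -> nat) (z : 'I_N -> C) (sigma : {set 'I_N}).
Variables (nu0 : C) (nu : 'I_n -> C) (c : 'I_N -> R).
Hypothesis nN : (n.+1 <= N)%N.
Hypothesis z_gt0 : forall j, 0 < Re (z j).
Hypothesis card_sigma : #|sigma| = n.+1.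
Hypothesis det_neq0 : \det (Asig R a sigma) != 0.
Hypothesis nu0_gt0 : 0 < Re nu0.
Hypothesis c_gt0 : forall j, j \in ~: sigma -> 0 < c j.
Hypothesis gap_gt0 : forall k, 0 < mxRv (Asiginv R a sigma) (fun i => Re (nub nu0 nu i)) k
  - mxRv (Asiginv R a sigma) (Asigbar_c a sigma c) k.

Notation K := 'I_n.+1.
Notation A := (Asig R a sigma).
Notation B := (Asiginv R a sigma).
Notation nb := (nub nu0 nu).

(** Default value of [nth] in [sg], never returned because [sigma] has [n.+1] elements. *)
Let j0 : 'I_N := Ordinal (leq_trans (ltn0Sn n) nN).
Definition sg (k : K) : 'I_N := nth j0 (enum sigma) k.

Lemma sig_elE k : sig_el sigma k = Some (sg k).
Proof.
rewrite /sig_el /sg; have := onthTE (enum sigma) k.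
rewrite -cardE card_sigma ltn_ord.
by case E : (onth _ _) => [j|//] _; rewrite (onth_nth _ _ _ _ E).
Qed.

Lemma AE i k : A i k = (Acol a (sg k) i)%:R.
Proof. by rewrite mxE sig_elE. Qed.

Lemma zsigE k : zsig sigma z k = z (sg k).
Proof. by rewrite /zsig sig_elE. Qed.

Lemma sum_sigma (V : nmodType) (F : 'I_N -> V) : \sum_(j in sigma) F j = \sum_k F (sg k).
Proof.
rewrite -big_enum (big_nth j0) -cardE card_sigma big_mkord.
by apply: eq_bigr.
Qed.

Lemma sum_split (V : nmodType) (F : 'I_N -> V) :
  \sum_j F j = \sum_k F (sg k) + \sum_(j in ~: sigma) F j.
Proof.
rewrite (bigID (mem sigma)) /= sum_sigma; congr (_ + _).
by apply: eq_bigl => j; rewrite inE.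
Qed.

Lemma A_unit : A \in unitmx. Proof. by rewrite unitmxE unitfE. Qed.

(** For [j] outside [sigma], the entries of the matrix product of the inverse of [A_sigma] with
    [A_(bar sigma)]. *)
Definition bcoef k j : R := \sum_i B k i * (Acol a j i)%:R.

(** Since [A B = 1], pairing [B w] with [A^T u] gives back the pairing of [w] with [u]. Hence
    exponents acquire the factor [B] in the coordinates [v = A^T u]. *)
Lemma sum_mxact (w u : K -> R) :
  \sum_k (\sum_l B k l * w l) * mxact A^T u k = \sum_i w i * u i.
Proof.
have E i l : \sum_k A i k * B k l = (i == l)%:R.
  by have /matrixP/(_ i l) := mulmxV A_unit; rewrite mxE [in RHS]mxE => <-.
transitivity (\sum_l \sum_i (\sum_k A i k * B k l) * (w l * u i)).
  under eq_bigr do rewrite mulr_suml.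
  rewrite exchange_big; apply: eq_bigr => l _.
  under [RHS]eq_bigr do rewrite mulr_suml.
  rewrite exchange_big; apply: eq_bigr => k _; rewrite /mxact mulr_sumr.
  by apply: eq_bigr => i _; rewrite mxE; ring.
rewrite exchange_big; apply: eq_bigr => i _; rewrite (bigD1 i)//= E eqxx mul1r big1 ?addr0// => l li.
by rewrite E eq_sym (negbTE li) mul0r.
Qed.

Lemma csum_mxact (w : K -> C) (u : K -> R) :
  \sum_k mxCv B w k * (mxact A^T u k)%:C = \sum_i w i * (u i)%:C.
Proof.
apply: complex_eq; rewrite ?cRe_sum ?cIm_sum.
- under eq_bigr do rewrite cReMr.
  under [RHS]eq_bigr do rewrite cReMr.
  rewrite -[RHS]sum_mxact; apply: eq_bigr => k _; congr (_ * _).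
  by rewrite /mxCv cRe_sum; apply: eq_bigr => l _; rewrite mulrC cReMr mulrC.
- under eq_bigr do rewrite cImMr.
  under [RHS]eq_bigr do rewrite cImMr.
  rewrite -[RHS]sum_mxact; apply: eq_bigr => k _; congr (_ * _).
  by rewrite /mxCv cIm_sum; apply: eq_bigr => l _; rewrite mulrC cImMr mulrC.
Qed.

(** The row of ones in [Acol] adds [u ord0] to every exponent, so the second sum is [e^(u_0)] times
    [Gz] at the exponentials of the other coordinates. *)
Definition Flog (u : K -> R) : C :=
  cexp (\sum_i nb i * (u i)%:C - \sum_j z j * (expR (\sum_i (Acol a j i)%:R * u i))%:C).

Definition flog (v : K -> R) : C :=
  cexp (\sum_k mxCv B nb k * (v k)%:C - \sum_k z (sg k) * (expR (v k))%:C
    - \sum_(j in ~: sigma) z j * (expR (\sum_k bcoef k j * v k))%:C).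

Lemma Flog_flog u : Flog u = flog (mxact A^T u).
Proof.
rewrite /Flog /flog csum_mxact (sum_split (fun j => z j * _)) opprD addrA.
have E1 k : \sum_i (Acol a (sg k) i)%:R * u i = mxact A^T u k.
  by rewrite /mxact; apply: eq_bigr => i _; rewrite mxE AE.
have E2 j : \sum_i (Acol a j i)%:R * u i = \sum_k bcoef k j * mxact A^T u k.
  by rewrite -(sum_mxact (fun i => (Acol a j i)%:R)).
have S1 : \sum_k z (sg k) * (expR (\sum_i (Acol a (sg k) i)%:R * u i))%:C =
    \sum_k z (sg k) * (expR (mxact A^T u k))%:C by apply: eq_bigr => k _; rewrite E1.
have S2 : \sum_(j in ~: sigma) z j * (expR (\sum_i (Acol a j i)%:R * u i))%:C =
    \sum_(j in ~: sigma) z j * (expR (\sum_k bcoef k j * mxact A^T u k))%:C.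
  by apply: eq_bigr => j _; rewrite E2.
by rewrite S1 S2.
Qed.

Definition Lj (j : 'I_N) (s : R) : C := cGamma (Complex (c j) s) * cpow (z j) (- Complex (c j) s).

Definition gam (s : 'I_N -> R) (k : K) : C := mxCv B nb k - mxCv B (Asigbar_t a sigma (on_gamma c s)) k.

(** The coordinates [inl k] are the [v_k], the coordinates [inr j] the ordinates [s_j] on the
    contour. Putting both in one sum type turns the exchange of the [v]- and [s]-integrals into a
    permutation of a list of coordinates. *)
Definition gjoint (x : K + 'I_N -> R) : C :=
  (\prod_(j in ~: sigma) Lj j (x (inr j))) *
  cexp (\sum_k gam (x \o inr) k * (x (inl k))%:C - \sum_k z (sg k) * (expR (x (inl k)))%:C).

Lemma mxCv_Asigbar (t : 'I_N -> C) k :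
  mxCv B (Asigbar_t a sigma t) k = \sum_(j in ~: sigma) (bcoef k j)%:C * t j.
Proof.
rewrite /mxCv /Asigbar_t; under eq_bigr do rewrite mulr_sumr.
rewrite exchange_big; apply: eq_bigr => j _.
rewrite /bcoef rmorph_sum mulr_suml; apply: eq_bigr => i _.
by rewrite mulrA -rmorphM.
Qed.

Lemma Re_gam s k : Re (gam s k) = mxRv B (fun i => Re (nb i)) k - mxRv B (Asigbar_c a sigma c) k.
Proof.
rewrite /gam !cReE /mxCv !cRe_sum; congr (_ - _).
- by apply: eq_bigr => i _; rewrite mulrC cReMr mulrC.
- apply: eq_bigr => i _; rewrite mulrC cReMr mulrC; congr (_ * _).
  by rewrite /Asigbar_t cRe_sum; apply: eq_bigr => j _; rewrite mulrC cReMr mulrC.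
Qed.

Lemma gam_gt0 s k : 0 < Re (gam s k). Proof. by rewrite Re_gam. Qed.

Lemma Lj_integrable j (y : R) : j \in ~: sigma ->
  let h := fun s : R => Lj j s * cexp (- Complex (c j) s * y%:C) in
  mu.-integrable setT (EFin \o (fun s => Re (h s))) /\
  mu.-integrable setT (EFin \o (fun s => Im (h s))).
Proof.
move=> js h; have zy0 : 0 < Re (z j * (expR y)%:C) by rewrite cReMr mulr_gt0 ?expR_gt0.
have E s : h s = cGamma (Complex (c j) s) * cpow (z j * (expR y)%:C) (- Complex (c j) s).
  by rewrite /h /Lj cpow_mulr_expR// mulrA.
have [m1 m2] := measurable_cGamma_cpow (c_gt0 js) zy0.
have D := cGamma_cpow_decay (c_gt0 js) zy0.
split; under eq_fun do rewrite E; apply: exp_decay_integrable => //;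
  apply: exp_decay_le D => s; rewrite [leRHS]ger0_norm ?cabs_ge0//.
- exact: normRe_le_cabs.
- exact: normIm_le_cabs.
Qed.

Lemma Cint_Lj j (y : R) : j \in ~: sigma ->
  Cint setT (fun s : R => Lj j s * cexp (- Complex (c j) s * y%:C)) =
  (2 * pi)%:C * cexp (- (z j * (expR y)%:C)).
Proof.
move=> js; have zy0 : 0 < Re (z j * (expR y)%:C) by rewrite cReMr mulr_gt0 ?expR_gt0.
rewrite -(Cint_gamma_cpow (c_gt0 js) zy0); congr Cint; apply/funext => s.
by rewrite /Lj cpow_mulr_expR// mulrA.
Qed.

(** The exponent is bilinear in [v] and [t]. Collected by [j] instead of [k], the integrand is a
    constant times a product of one-variable functions of the [s_j], each integrated by the
    Mellin-Barnes formula. *)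
Lemma iterCint_inr (x : K + 'I_N -> R) :
  iterCint (map inr (enum (~: sigma))) setT gjoint x =
  (2 * pi)%:C ^+ #|~: sigma| * flog (x \o inl).
Proof.
set v := x \o inl.
pose y j := \sum_k bcoef k j * v k.
pose c0 : C := cexp (\sum_k mxCv B nb k * (v k)%:C - \sum_k z (sg k) * (expR (v k))%:C).
pose g' (s : 'I_N -> R) : C :=
  c0 * \prod_(j <- enum (~: sigma)) (Lj j (s j) * cexp (- Complex (c j) (s j) * (y j)%:C)).
rewrite (@iterCint_map R _ _ inr _ _ _ g'); last 2 first.
- by move=> i j [].
- move=> x' Hx'; have Ev k : x' (inl k) = v k by apply: Hx' => i.
  set s := x' \o inr.
  have P1 : \prod_(j <- enum (~: sigma)) (Lj j (s j) * cexp (- Complex (c j) (s j) * (y j)%:C)) =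
     (\prod_(j in ~: sigma) Lj j (s j)) * cexp (\sum_(j in ~: sigma) - Complex (c j) (s j) * (y j)%:C).
    by rewrite big_enum big_split /= cexp_sum.
  have S1 : \sum_k gam s k * (x' (inl k))%:C = \sum_k mxCv B nb k * (v k)%:C
      + \sum_(j in ~: sigma) - Complex (c j) (s j) * (y j)%:C.
    rewrite /gam; under eq_bigr do rewrite mulrBl Ev.
    rewrite sumrB -sumrN; congr (_ + _).
    under eq_bigr do rewrite mxCv_Asigbar mulr_suml -sumrN.
    rewrite exchange_big; apply: eq_bigr => j _.
    rewrite /y rmorph_sum mulr_sumr; apply: eq_bigr => k _.
    by rewrite rmorphM /on_gamma /=; ring.
  have S2 : \sum_k z (sg k) * (expR (x' (inl k)))%:C = \sum_k z (sg k) * (expR (v k))%:C.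
    by apply: eq_bigr => k _; rewrite Ev.
  transitivity (c0 * ((\prod_(j in ~: sigma) Lj j (s j)) * cexp (\sum_(j in ~: sigma) - Complex (c j) (s j) * (y j)%:C))); last by rewrite -P1.
  by rewrite /gjoint S1 S2 [RHS]mulrCA /c0 -cexpD addrAC.
rewrite /g' (@iterCint_prod R _ _ (fun j s => Lj j s * cexp (- Complex (c j) s * (y j)%:C)))%R ?enum_uniq//; last 2 first.
- by move=> j; rewrite mem_enum => js; have [] := Lj_integrable (y j) js.
- by move=> j; rewrite mem_enum => js; have [] := Lj_integrable (y j) js.
rewrite big_enum /= (eq_bigr (fun j => (2 * pi)%:C * cexp (- (z j * (expR (y j))%:C)))); last first.
  by move=> j js; exact: Cint_Lj.
rewrite big_split /= prodr_const mulrCA; congr (_ * _).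
by rewrite -cexp_sum /c0 -cexpD sumrN.
Qed.

(** The Mellin-Barnes integrand with the prefactor [z_sigma^(- A_sigma^-1 nu)] still inside, as
    [MBinnerE] shows. *)
Definition MBinner (s : 'I_N -> R) : C :=
  (\prod_(j in ~: sigma) Lj j (s j)) *
  \prod_k (cGamma (gam s k) * cpow (z (sg k)) (- gam s k)).

Lemma iterCint_inl (x : K + 'I_N -> R) :
  iterCint (map inl (enum K)) setT gjoint x = MBinner (x \o inr).
Proof.
set s := x \o inr.
pose h k (u : R) : C := cexp (gam s k * u%:C - z (sg k) * (expR u)%:C).
pose g' (v : K -> R) : C := (\prod_(j in ~: sigma) Lj j (s j)) * \prod_(k <- enum K) h k (v k).
rewrite (@iterCint_map R _ _ inl _ _ _ g'); last 2 first.
- by move=> i j [].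
- move=> x' Hx'; rewrite /gjoint /g' big_enum.
  have Es j : x' (inr j) = s j by apply: Hx' => i.
  have -> : x' \o inr = s by apply/funext => j; exact: Es.
  congr (_ * _); first by apply: eq_bigr => j _; rewrite Es.
  by rewrite /h -cexp_sum sumrB.
have mh k : Cmeasurable (h k).
  apply: Cmeasurable_cexp; apply: CmeasurableD; last apply: CmeasurableN.
    by apply: CmeasurableM; [exact: Cmeasurable_cst|apply: Cmeasurable_real; exact: measurable_id].
  by apply: CmeasurableM; [exact: Cmeasurable_cst|apply: Cmeasurable_real; exact: measurable_expR].
have dh k : exp_decay (fun u => cabs (h k u)).
  apply: exp_decay_le (exp_decay_exp_sub_exp (gam_gt0 s k) (z_gt0 (sg k))) => u.
  by rewrite /h cabs_cexp cReD cReN !cReMr.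
rewrite /g' iterCint_prod ?enum_uniq//; last 2 first.
- move=> k _; apply: exp_decay_integrable; first by have [] := mh k.
  by apply: exp_decay_le (dh k) => u; rewrite [leRHS]ger0_norm ?cabs_ge0// normRe_le_cabs.
- move=> k _; apply: exp_decay_integrable; first by have [] := mh k.
  by apply: exp_decay_le (dh k) => u; rewrite [leRHS]ger0_norm ?cabs_ge0// normIm_le_cabs.
rewrite big_enum; congr (_ * _); apply: eq_bigr => k _.
by rewrite /h Cint_exp_sub// gam_gt0.
Qed.

(** * Measurability and decay of the joint integrand *)

Let sinl := map (@inl K 'I_N) (enum K).
Let sinr := map (@inr K 'I_N) (enum (~: sigma)).

Lemma uniq_joint : uniq (sinl ++ sinr).
Proof.
have I1 : injective (@inl K 'I_N) by move=> ? ? [].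
have I2 : injective (@inr K 'I_N) by move=> ? ? [].
rewrite cat_uniq (map_inj_uniq I1) (map_inj_uniq I2) !enum_uniq andbT /=.
by apply/hasPn => y /mapP[j _ ->]; apply/negP => /mapP[].
Qed.

Lemma gjoint_measurable : Ccoord_measurable gjoint.
Proof.
suff H : forall d (T : measurableType d) (x : T -> K + 'I_N -> R),
  (forall i, measurable_fun setT (fun t => x t i)) -> Cmeasurable (fun t => gjoint (x t)).
  by split => d T x mx; have [] := H d T x mx.
move=> d T x mx; apply: CmeasurableM.
  apply: Cmeasurable_prod => j js.
  have [m1 m2] := measurable_cGamma_cpow (c_gt0 js) (z_gt0 j).
  by split; [exact: (measurableT_comp m1)|exact: (measurableT_comp m2)].
have mr (f : T -> R) (w : C) : measurable_fun setT f -> Cmeasurable (fun t => w * (f t)%:C).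
  by move=> mf; apply: CmeasurableM; [exact: Cmeasurable_cst|exact: Cmeasurable_real].
apply: Cmeasurable_cexp; apply: CmeasurableD.
  apply: Cmeasurable_sum => k; apply: CmeasurableM; last exact: Cmeasurable_real.
  rewrite /gam; apply: CmeasurableD; first exact: Cmeasurable_cst.
  apply: CmeasurableN; under eq_fun do rewrite mxCv_Asigbar.
  apply: Cmeasurable_sum => j; apply: CmeasurableM; first exact: Cmeasurable_cst.
  by split => /=; [exact: measurable_cst|exact: mx].
apply: CmeasurableN; apply: Cmeasurable_sum => k; apply: mr.
exact: (measurableT_comp (@measurable_expR R)).
Qed.

(** On the vertical contour [Re (gam s k)] does not depend on [s], so [cabs (gjoint x)] is exactly a
    product of one-variable functions. Positivity of [c] gives decay in the [s_j], and the positive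
    gap gives decay in the [v_k]. *)
Lemma gjoint_decay : Cdecay_on (sinl ++ sinr) gjoint.
Proof.
pose h (i : K + 'I_N) (u : R) : R := match i with
  | inl k => expR ((mxRv B (fun i => Re (nb i)) k - mxRv B (Asigbar_c a sigma c) k) * u - Re (z (sg k)) * expR u)
  | inr j => cabs (Lj j u) end.
have := @decay_on_prod R _ (sinl ++ sinr) h.
rewrite /Cdecay_on (_ : (fun x => cabs (gjoint x)) = (fun x => \prod_(i <- sinl ++ sinr) h i (x i))).
  apply=> i; rewrite mem_cat => /orP[/mapP[k _ ->]|/mapP[j + ->]] /=.
    exact: exp_decay_exp_sub_exp.
  by rewrite mem_enum => js; exact: (cGamma_cpow_decay (c_gt0 js) (z_gt0 j)).
apply/funext => x; rewrite big_cat !big_map !big_enum [RHS]mulrC /=.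
rewrite /gjoint cabsM cabs_prod cabs_cexp; congr (_ * _).
rewrite cReD cReN !cRe_sum -sumrB expR_sum; apply: eq_bigr => k _.
by rewrite !cReMr Re_gam.
Qed.

(** The zeros are placeholders: integration over [sinr] overwrites those with index outside [sigma],
    and [gjoint] reads no others. *)
Definition joinl (v : K -> R) : K + 'I_N -> R :=
  fun i => match i with inl k => v k | inr _ => 0 end.

Lemma two_pi_neq0 : (2 * pi : R)%:C != 0.
Proof. by rewrite (fmorph_eq0 (real_complex R)) mulf_neq0// gt_eqF// pi_gt0. Qed.

Lemma flogE v : flog v = (2 * pi)%:C ^- #|~: sigma| * iterCint sinr setT gjoint (joinl v).
Proof.
by rewrite iterCint_inr mulKf ?expf_neq0 ?two_pi_neq0.
Qed.

Lemma flog_measurable : Ccoord_measurable flog.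
Proof.
suff H : forall d (T : measurableType d) (x : T -> K -> R),
  (forall i, measurable_fun setT (fun t => x t i)) -> Cmeasurable (fun t => flog (x t)).
  by split => d T x mx; have [] := H d T x mx.
move=> d T x mx.
have mr (f : T -> R) (w : C) : measurable_fun setT f -> Cmeasurable (fun t => w * (f t)%:C).
  by move=> mf; apply: CmeasurableM; [exact: Cmeasurable_cst|exact: Cmeasurable_real].
apply: Cmeasurable_cexp; apply: CmeasurableD; first apply: CmeasurableD.
- by apply: Cmeasurable_sum => k; apply: mr.
- apply: CmeasurableN; apply: Cmeasurable_sum => k; apply: mr.
  exact: (measurableT_comp (@measurable_expR R)).
- apply: CmeasurableN; apply: Cmeasurable_sum => j; apply: mr.
  apply: (measurableT_comp (@measurable_expR R)).
  by apply: measurable_sum => k; exact: measurable_funM.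
Qed.

Lemma CdecayZ (I : eqType) (s : seq I) (w : C) (f : (I -> R) -> C) :
  Cdecay_on s f -> Cdecay_on s (fun x => w * f x).
Proof.
move=> [C0 [d [C0_ge d0 H]]]; exists (cabs w * C0), d; split; rewrite ?mulr_ge0 ?cabs_ge0// => x.
rewrite cabsM normrM ger0_norm ?cabs_ge0// -mulrA ler_wpM2l ?cabs_ge0//.
Qed.

(** Inherited from [gjoint], of which [flog] is a partial integral up to a constant. The terms with
    index in [sigma] alone need not force decay as [v_k] tends to minus infinity, since
    [mxCv B nb k] may have negative real part. *)
Lemma flog_decay : Cdecay_on (enum K) flog.
Proof.
have [C0 [d [C0_ge d0 H]]] := CdecayZ ((2 * pi)%:C ^- #|~: sigma|)
  (Cdecay_on_iterCint uniq_joint gjoint_measurable gjoint_decay).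
exists C0, d; split => // v; rewrite flogE (le_trans (H _))//.
by rewrite big_map.
Qed.

Lemma Flog_measurable : Ccoord_measurable Flog.
Proof.
have [m1 m2] := flog_measurable.
split; under eq_fun do rewrite Flog_flog.
- exact: (coord_measurable_mxact _ m1).
- exact: (coord_measurable_mxact _ m2).
Qed.

Lemma Flog_decay : Cdecay_on (enum K) Flog.
Proof.
rewrite /Cdecay_on; under eq_fun do rewrite Flog_flog.
by apply: (@decay_on_mxact _ _ A^T (fun v => cabs (flog v))); rewrite ?unitmx_tr ?A_unit//; exact: flog_decay.
Qed.

(** The [0] at [ord0] is a placeholder, overwritten by the integration over [ord0] in [hint]. *)
Definition consK (w : 'I_n -> R) : K -> R := fun i => if unlift ord0 i is Some i' then w i' else 0.

Definition hint (w : 'I_n -> R) : C := iterCint [:: ord0] setT Flog (consK w).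

Lemma consK_lift w i : consK w (lift ord0 i) = w i.
Proof. by rewrite /consK liftK. Qed.

Lemma Re_Gz_gt0 (x : 'I_n -> R) : (forall i, 0 < x i) -> 0 < Re (Gz a z x).
Proof.
move=> x0; rewrite /Gz cRe_sum (bigD1 j0)//= ltr_pwDl// ?sumr_ge0// => [|j _].
- by rewrite cReMr mulr_gt0// prodr_gt0// => i _; rewrite exprn_gt0.
- by rewrite cReMr (mulr_ge0 (ltW (z_gt0 j)))// prodr_ge0// => i _; rewrite exprn_ge0 ?ltW.
Qed.

Lemma cexp_sub_integrable (s w : C) : 0 < Re s -> 0 < Re w ->
  mu.-integrable setT (EFin \o (fun u : R => Re (cexp (s * u%:C - w * (expR u)%:C)))) /\
  mu.-integrable setT (EFin \o (fun u : R => Im (cexp (s * u%:C - w * (expR u)%:C)))).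
Proof.
move=> s0 w0.
have [m1 m2] : Cmeasurable (fun u : R => cexp (s * u%:C - w * (expR u)%:C)).
  apply: Cmeasurable_cexp; apply: CmeasurableD; last apply: CmeasurableN.
    by apply: CmeasurableM; [exact: Cmeasurable_cst|apply: Cmeasurable_real; exact: measurable_id].
  by apply: CmeasurableM; [exact: Cmeasurable_cst|apply: Cmeasurable_real; exact: measurable_expR].
have dh : exp_decay (fun u : R => cabs (cexp (s * u%:C - w * (expR u)%:C))).
  apply: exp_decay_le (exp_decay_exp_sub_exp s0 w0) => u.
  by rewrite cabs_cexp cReD cReN !cReMr.
split; apply: exp_decay_integrable => //; apply: exp_decay_le dh => u;
  rewrite [leRHS]ger0_norm ?cabs_ge0//.
- exact: normRe_le_cabs.
- exact: normIm_le_cabs.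
Qed.

(** The integral over [u_0] is the Gamma integral [Cint_exp_sub] at [nu0] and [G]; it applies
    because [G], a positive combination of the [z j], has positive real part. *)
Lemma hintE w : hint w = cGamma nu0 *
  ((\prod_i cexp (nu i * (w i)%:C)) * cpow (Gz a z (fun i => expR (w i))) (- nu0)).
Proof.
set G := Gz _ _ _; have G0 : 0 < Re G by apply: Re_Gz_gt0 => i; exact: expR_gt0.
have E u : Flog (upd (consK w) ord0 u) =
    (\prod_i cexp (nu i * (w i)%:C)) * cexp (nu0 * u%:C - G * (expR u)%:C).
  have nb0 : nb ord0 = nu0 by rewrite /nub unlift_none.
  have nbl i : nb (lift ord0 i) = nu i by rewrite /nub liftK.
  have ul i : upd (consK w) ord0 u (lift ord0 i) = w i.
    by rewrite updNE ?consK_lift// eq_sym neq_lift.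
  have S1 : \sum_i nb i * (upd (consK w) ord0 u i)%:C = nu0 * u%:C + \sum_i nu i * (w i)%:C.
    rewrite big_ord_recl nb0 updE; congr (_ + _).
    by apply: eq_bigr => i _; rewrite nbl ul.
  have S2 : \sum_j z j * (expR (\sum_i (Acol a j i)%:R * upd (consK w) ord0 u i))%:C = G * (expR u)%:C.
    rewrite /G /Gz mulr_suml; apply: eq_bigr => j _; rewrite -mulrA -rmorphM; congr (_ * _%:C).
    rewrite big_ord_recl updE /Acol unlift_none mul1r expRD mulrC; congr (_ * _).
    rewrite expR_sum; apply: eq_bigr => i _.
    by rewrite liftK ul expRM_natl.
  by rewrite /Flog S1 S2 -cexp_sum -cexpD addrAC addrC.
have [i1 i2] := cexp_sub_integrable nu0_gt0 G0.
rewrite /hint /=; transitivity (Cint setT (fun u : R =>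
   (\prod_i cexp (nu i * (w i)%:C)) * cexp (nu0 * u%:C - G * (expR u)%:C))).
  by congr Cint; apply/funext => u; exact: E.
by rewrite CintZ// Cint_exp_sub// mulrCA.
Qed.

(** * Reduction of the Feynman integral to logarithmic coordinates *)

Let slift := map (lift ord0) (enum 'I_n).

Lemma perm_slift : perm_eq (enum K) (slift ++ [:: ord0]).
Proof. by rewrite enum_ordSl perm_sym perm_catC /=. Qed.

Lemma uniq_slift : uniq (slift ++ [:: ord0]).
Proof. by rewrite -(perm_uniq perm_slift) enum_uniq. Qed.

Lemma hint_measurable : Ccoord_measurable hint.
Proof.
have [m1 m2] := Ccoord_measurable_iterCint [:: ord0] measurableT Flog_measurable.
have mc d (T : measurableType d) (x : T -> 'I_n -> R) :
  (forall i, measurable_fun setT (fun t => x t i)) -> forall i, measurable_fun setT (fun t => consK (x t) i).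
  by move=> mx i; rewrite /consK; case: (unlift ord0 i) => [i'|//]; exact: mx.
by split=> d T x mx; [apply: m1|apply: m2]; exact: mc.
Qed.

Lemma hint_decay : Cdecay_on (enum 'I_n) hint.
Proof.
have dF : Cdecay_on (slift ++ [:: ord0]) Flog by apply: decay_on_perm perm_slift Flog_decay.
have [C0 [d [C0_ge d0 H]]] := Cdecay_on_iterCint uniq_slift Flog_measurable dF.
exists C0, d; split => // w; rewrite (le_trans (H _))// big_map.
by under eq_bigr do rewrite consK_lift.
Qed.

Lemma iterCint_Flog : iterCint (enum K) setT Flog (fun=> 0) = iterCint (enum 'I_n) setT hint (fun=> 0).
Proof.
have H (x' : K -> R) : iterCint [:: ord0] setT Flog x' = hint (x' \o lift ord0).
  have U u : upd x' ord0 u = upd (consK (x' \o lift ord0)) ord0 u.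
    apply/funext => i; rewrite /upd; case: eqP => // /eqP i0.
    by rewrite /consK; case: unliftP => [j ->//|i0']; rewrite i0' eqxx in i0.
  by rewrite /hint /=; under eq_fun do rewrite U.
rewrite (iterCint_perm _ perm_slift (enum_uniq _) Flog_measurable Flog_decay) iterCint_cat /slift.
exact: (@iterCint_map R 'I_n K (lift ord0) (enum 'I_n) setT _ hint (fun=> 0) (@lift_inj _ ord0)
  (fun x' _ => H x')).
Qed.

Lemma JA_iterCint_hint : JA a nu0 nu z = iterCint (enum 'I_n) setT hint (fun=> 0).
Proof.
(* Below, the integrand of [JA] is recovered from [hint] by dividing by [cGamma nu0]. If that number
   were zero, both sides would vanish, so nonvanishing of Gamma need not be proved. *)
have [G0|G0] := eqVneq (cGamma nu0) 0.
  have h0 : hint = (fun w => 0 * hint w).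
    by apply/funext => w; rewrite hintE G0 !mul0r.
  rewrite /JA G0 mul0r h0 iterCintZ ?enum_uniq ?mul0r//; last exact: hint_decay.
  exact: hint_measurable.
(* [phi] agrees with the integrand of [JA] at positive points and, being built from [hint] and [ln],
   is measurable everywhere, as the exponential substitution requires. *)
pose phi (x : 'I_n -> R) : C :=
  (cGamma nu0)^-1 * hint (fun i => ln (x i)) * (\prod_i expR (- ln (x i)))%:C.
have mphi : Ccoord_measurable phi.
  suff H : forall d (T : measurableType d) (x : T -> 'I_n -> R),
    (forall i, measurable_fun setT (fun t => x t i)) -> Cmeasurable (fun t => phi (x t)).
    by split => d T x mx; have [] := H d T x mx.
  move=> d T x mx.
  have ml i : measurable_fun setT (fun t => ln (x t i)) by exact: (measurableT_comp (@measurable_ln R)).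
  apply: CmeasurableM; last first.
    apply: Cmeasurable_real; apply: measurable_prod => i _.
    by apply: (measurableT_comp (@measurable_expR R)); exact: measurable_funN.
  apply: CmeasurableM; first exact: Cmeasurable_cst.
  by have [m1 m2] := hint_measurable; split; [apply: m1|apply: m2].
rewrite /JA; transitivity (cGamma nu0 * iterCint (enum 'I_n) `]0, +oo[ phi (fun=> 0)).
  congr (_ * _); apply: iterCint_congr => v v0.
  pose w (i : 'I_n) : R := if i \in enum 'I_n then v i else 0.
  change (\prod_i cpow (w i)%:C (nu i - 1) * cpow (Gz a z w) (- nu0) = phi w).
  have w0 i : 0 < w i.
    have := v0 i; rewrite /w mem_enum => /(_ isT).
    by rewrite /= in_itv /= andbT.
  rewrite /phi hintE mulKf//.
  have -> : (fun i => expR (ln (w i))) = w by apply/funext => i; rewrite lnK// posrE.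
  rewrite rmorph_prod mulrAC -big_split; congr (_ * _).
  apply: eq_bigr => i _; rewrite cpow_real//= -cexp_real -cexpD /=; congr cexp.
  by rewrite rmorphN; ring.
rewrite iterCint_expR ?enum_uniq//.
transitivity (cGamma nu0 * iterCint (enum 'I_n) setT (fun u => (cGamma nu0)^-1 * hint u) (fun=> 0)).
  congr (_ * _); apply: iterCint_congr => v _.
  pose w (i : 'I_n) : R := if i \in enum 'I_n then v i else 0.
  change (phi (fun i => if i \in enum 'I_n then expR (w i) else w i) *
    (\prod_(i <- enum 'I_n) expR (w i))%:C = (cGamma nu0)^-1 * hint w).
  have -> : (fun i => if i \in enum 'I_n then expR (w i) else w i) = (fun i => expR (w i)).
    by apply/funext => i; rewrite mem_enum.
  rewrite /phi; under eq_fun do rewrite expRK.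
  under eq_bigr do rewrite expRK expRN.
  have P1 : \prod_i (expR (w i))^-1 * \prod_(i <- enum 'I_n) expR (w i) = 1.
    by rewrite big_enum -big_split big1// => i _ /=; rewrite mulVf// gt_eqF ?expR_gt0.
  have P2 : (\prod_i (expR (w i))^-1)%:C * (\prod_(i <- enum 'I_n) expR (w i))%:C = 1 :> C.
    by rewrite -rmorphM P1.
  by rewrite -[LHS]mulrA P2 mulr1.
rewrite iterCintZ ?enum_uniq//; last exact: hint_decay.
  by rewrite mulrA divff// mul1r.
exact: hint_measurable.
Qed.

(** * Interchange of the integrals and conclusion *)

Lemma joint_swap : iterCint (enum K) setT flog (fun=> 0) =
  (2 * pi)%:C ^- #|~: sigma| * iterCint (enum (~: sigma)) setT MBinner (fun=> 0).
Proof.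
pose o : K + 'I_N -> R := fun=> 0.
have I1 : injective (@inl K 'I_N) by move=> ? ? [].
have I2 : injective (@inr K 'I_N) by move=> ? ? [].
have mg := Ccoord_measurable_iterCint sinr measurableT gjoint_measurable.
have dg := Cdecay_on_iterCint uniq_joint gjoint_measurable gjoint_decay.
have us : uniq sinl by rewrite (map_inj_uniq I1) enum_uniq.
pose h x := (2 * pi)%:C ^- #|~: sigma| * iterCint sinr setT gjoint x.
have Hl x' : h x' = flog (x' \o inl).
  by rewrite /h iterCint_inr mulKf// expf_neq0// two_pi_neq0.
have Hr x' : iterCint sinl setT gjoint x' = MBinner (x' \o inr) by rewrite iterCint_inl.
rewrite -[LHS](@iterCint_map R K _ inl (enum K) setT h flog o I1 (fun x' _ => Hl x')).
rewrite /h iterCintZ//; congr (_ * _).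
rewrite -iterCint_cat.
(* Left of the permutation the [s]-integrals are innermost and produce [flog]; right of it the
   [v]-integrals are, and produce [MBinner]. *)
have pc : perm_eq (sinl ++ sinr) (sinr ++ sinl) by rewrite perm_catC.
rewrite (iterCint_perm _ pc uniq_joint gjoint_measurable gjoint_decay) iterCint_cat.
exact: (@iterCint_map R 'I_N _ inr (enum (~: sigma)) setT _ MBinner o I2 (fun x' _ => Hr x')).
Qed.

Lemma JA_MBinner : JA a nu0 nu z = (`|\det A|^-1)%:C *
  ((2 * pi)%:C ^- #|~: sigma| * iterCint (enum (~: sigma)) setT MBinner (fun=> 0)).
Proof.
rewrite JA_iterCint_hint -iterCint_Flog -joint_swap.
rewrite (_ : Flog = (fun u => flog (mxact A^T u))); last by apply/funext => u; exact: Flog_flog.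
rewrite iterCint_mxact ?det_tr ?unitmx_tr ?A_unit//; first exact: flog_measurable.
exact: flog_decay.
Qed.

Lemma MBinnerE s : MBinner s = (\prod_k cpow (zsig sigma z k) (- mxCv B nb k)) *
  MBintegrand a sigma nu0 nu z (on_gamma c s).
Proof.
rewrite /MBinner /MBintegrand /Lj !big_split /=.
have -> : \prod_k cpow (z (sg k)) (- gam s k) = (\prod_k cpow (zsig sigma z k) (- mxCv B nb k)) *
   \prod_k cpow (zsig sigma z k) (mxCv B (Asigbar_t a sigma (on_gamma c s)) k).
  rewrite -big_split; apply: eq_bigr => k _.
  by rewrite zsigE /gam opprB addrC cpowD.
rewrite /gam; ring.
Qed.

Lemma MBinner_measurable_decay :
  Ccoord_measurable MBinner /\ Cdecay_on (enum (~: sigma)) MBinner.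
Proof.
have pc : perm_eq (sinl ++ sinr) (sinr ++ sinl) by rewrite perm_catC.
have u2 : uniq (sinr ++ sinl) by rewrite -(perm_uniq pc) uniq_joint.
have [m1 m2] := Ccoord_measurable_iterCint sinl measurableT gjoint_measurable.
have [C0 [d [C0_ge d0 H]]] := Cdecay_on_iterCint u2 gjoint_measurable (decay_on_perm pc gjoint_decay).
pose J (s : 'I_N -> R) : K + 'I_N -> R := fun i => match i with inl _ => 0 | inr j => s j end.
have E s : MBinner s = iterCint sinl setT gjoint (J s) by rewrite iterCint_inl.
have mJ d' (T : measurableType d') (x : T -> 'I_N -> R) :
  (forall i, measurable_fun setT (fun t => x t i)) -> forall i, measurable_fun setT (fun t => J (x t) i).
  by move=> mx [i|i] /=; [exact: measurable_cst|exact: mx].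
split.
  split=> d' T x mx; under eq_fun do rewrite E; [apply: m1|apply: m2]; exact: mJ.
by exists C0, d; split => // s; rewrite E (le_trans (H _))// big_map.
Qed.

Lemma JA_mellin_barnes : JA a nu0 nu z =
    \prod_k cpow (zsig sigma z k) (- mxCv B nb k)
    / (`|\det A|)%:C
    * (((2%:R * pi)%:C * Complex 0 1) ^- rr sigma
       * gamma_int sigma c (MBintegrand a sigma nu0 nu z)).
Proof.
set Z := \prod_k cpow _ _.
(* [Z'] is the inverse of the prefactor [Z]; multiplication by it turns [MBinner] into
   [MBintegrand]. *)
pose Z' := \prod_k cpow (zsig sigma z k) (mxCv B nb k).
have ZZ : Z' * Z = 1.
  by rewrite /Z' /Z -big_split big1// => k _ /=; rewrite zsigE cpowM_N.
have [mM dM] := MBinner_measurable_decay.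
have E : iterCint (enum (~: sigma)) setT (fun s => MBintegrand a sigma nu0 nu z (on_gamma c s)) (fun=> 0) =
    Z' * iterCint (enum (~: sigma)) setT MBinner (fun=> 0).
  rewrite -iterCintZ ?enum_uniq//; congr (iterCint _ _ _ _); apply/funext => s.
  by rewrite MBinnerE -/Z mulrA ZZ mul1r.
have i0 : Complex 0 1 != 0 :> C by rewrite eq_complex /= oner_eq0 andbF.
rewrite JA_MBinner /gamma_int E /rr exprMn invfM fmorphV /=.
(* The factor [i^r] in [gamma_int], from [dt = i ds] in each variable, cancels the one in
   [(2 pi i)^r]. *)
have ir : (Complex 0 1 : C) ^+ #|~: sigma| != 0 by rewrite expf_neq0.
set I := iterCint _ _ _ _; set D := (_ ^- _ : C); set Y := (Complex 0 1) ^+ _.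
have -> : D / Y * (Y * (Z' * I)) = Z' * (D * I) by rewrite -mulrA mulKf//; ring.
by rewrite mulrACA [Z * Z']mulrC ZZ mul1r.
Qed.

End Feynman.

Theorem theorem2 (R : realType) (n N : nat) (a : 'I_N -> 'I_n -> nat)
  (z : 'I_N -> R[i]) (sigma : {set 'I_N}) (nu0 : R[i]) (nu : 'I_n -> R[i])
  (c : 'I_N -> R) :
  (1 <= n)%N -> (n.+1 <= N)%N -> injective a ->
  (forall j, 0 < complex.Re (z j)) ->
  #|sigma| = n.+1 ->
  \det (Asig R a sigma) != 0 ->
  0 < complex.Re nu0 ->
  (forall j, j \in ~: sigma -> 0 < c j) ->
  (forall k, 0 < mxRv (Asiginv R a sigma)
                      (fun i => complex.Re (nub nu0 nu i)) k
                 - mxRv (Asiginv R a sigma) (Asigbar_c a sigma c) k) ->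
  gamma_abs_conv sigma c (MBintegrand a sigma nu0 nu z) ->
  JA a nu0 nu z =
    \prod_k cpow (zsig sigma z k) (- mxCv (Asiginv R a sigma) (nub nu0 nu) k)
    / (`|\det (Asig R a sigma)|)%:C
    * (((2%:R * pi)%:C * Complex 0 1) ^- rr sigma
       * gamma_int sigma c (MBintegrand a sigma nu0 nu z)).
Proof.
move=> _ nN _ z_gt0 card_sigma det_neq0 nu0_gt0 c_gt0 gap_gt0 _.
exact: JA_mellin_barnes.
Qed.
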